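(* Let $A$ be a locally unital graded algebra that is locally finite-dimensional and bounded below, equipped with a graded triangular basis with weight poset $(\Lambda,\leq)$, and let $\lambda\in\Lambda$. Then the standardization functor $j^\lambda_!: A_\lambda\text{-gmod}\to A_{\geq\lambda}\text{-gmod}$ is exact and takes modules that are locally finite-dimensional and bounded below to modules that are locally finite-dimensional and bounded below. Similarly, the costandardization functor $j^\lambda_*: A_\lambda\text{-gmod}\to A_{\geq\lambda}\text{-gmod}$ is exact and takes modules that are locally finite-dimensional and bounded above to modules that are locally finite-dimensional and bounded above.
   Context: Conventions. $\Bbbk$ is an algebraically closed field; all algebras, categories and functors are $\Bbbk$-linear; graded means $\mathbb Z$-graded. A locally unital graded algebra is a graded associative algebra $A=\bigoplus_{i,j\in\mathbf I}1_iA1_j$ with a given family of mutually orthogonal homogeneous idempotents $1_i$ $(i\in\mathbf I)$. Graded left modules are locally unital: $V=\bigoplus_{i}1_iV$. $A$-gmod is the abelian category of graded left $A$-modules with degree-preserving homomorphisms. $\operatorname{Hom}_A(V,W)=\bigoplus_{d\in\mathbb Z}\operatorname{Hom}_A(V,W)_d$, where $\operatorname{Hom}_A(V,W)_d$ is the space of $A$-module homomorphisms $f$ with $f(V_n)\subseteq W_{n+d}$ for all $n$. A graded module $V$ is locally finite-dimensional if $\dim 1_iV_d<\infty$ for all $i,d$; it is bounded below (resp. above) if for each $i$ there is $N_i\in\mathbb Z$ with $1_iV_d=0$ for $d<N_i$ (resp. $d>N_i$). $A$ is locally finite-dimensional and bounded below if all $(1_iA1_j)_d$ are finite-dimensional and,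 for all $i,j$, $(1_iA1_j)_d=0$ for $d\ll 0$. Graded triangular basis. For such $A$ this is the following data: a subset $\mathbf S\subseteq\mathbf I$; a poset $(\Lambda,\leq)$ that is lower finite (each $\{\mu\in\Lambda:\mu\leq\lambda\}$ is finite); a function $\mathbf S\to\Lambda$, $s\mapsto\dot s$, with finite (possibly empty) fibers $\mathbf S_\lambda$; homogeneous sets $\mathrm X(i,s)\subset1_iA1_s$, $\mathrm H(s,t)\subset1_sA1_t$, $\mathrm Y(t,j)\subset1_tA1_j$ for $i,j\in\mathbf I$, $s,t\in\mathbf S$. With $\mathrm X(s)=\bigcup_i\mathrm X(i,s)$, $\mathrm Y(t)=\bigcup_j\mathrm Y(t,j)$, the axioms are: (A1) the products $xhy$ for $(x,h,y)\in\bigcup_{s,t\in\mathbf S}\mathrm X(s)\times\mathrm H(s,t)\times\mathrm Y(t)$ form a basis of $A$; (A2) $\mathrm X(s,s)=\mathrm Y(s,s)=\{1_s\}$ for $s\in\mathbf S$; (A3) for $s\neq t$ in $\mathbf S$: $\mathrm X(s,t)\neq\varnothing\Rightarrow\dot s>\dot t$, $\mathrm H(s,t)\neq\varnothing\Rightarrow\dot s=\dot t$, $\mathrm Y(s,t)\neq\varnothing\Rightarrow\dot s<\dot t$; (A4) for each $i\in\mathbf I-\mathbf S$, the sets $\{s\in\mathbf S:\mathrm X(i,s)\neq\varnothing\}$ and $\{s\in\mathbf S:\mathrm Y(s,i)\neq\varnothing\}$ are finite. Functors. For $\lambda\in\Lambda$ let $e_\lambda=\sum_{s\in\mathbf S_\lambda}1_s$;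 let $A_{\geq\lambda}$ be the quotient of $A$ by the two-sided ideal generated by all $e_\mu$ with $\mu\not\geq\lambda$ (a locally unital graded algebra with idempotents the images $\bar1_i$, $i\in\mathbf I$), let $\bar e_\lambda$ be the image of $e_\lambda$ in it, and let $A_\lambda=\bar e_\lambda A_{\geq\lambda}\bar e_\lambda$, a unital graded algebra. Let $j^\lambda:A_{\geq\lambda}\text{-gmod}\to A_\lambda\text{-gmod}$, $V\mapsto\bar e_\lambda V$, with left adjoint $j^\lambda_!=A_{\geq\lambda}\bar e_\lambda\otimes_{A_\lambda}-$ and right adjoint $j^\lambda_*=\bigoplus_{i\in\mathbf I}\operatorname{Hom}_{A_\lambda}(\bar e_\lambda A_{\geq\lambda}\bar1_i,-)$. *)

(* Defs.v *)
From HB Require Import structures.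
From mathcomp Require Import all_boot all_order all_algebra.
From mathcomp Require Import finmap all_classical.
From mathcomp Require Import freeg.

Set Implicit Arguments.
Unset Strict Implicit.
Unset Printing Implicit Defensive.

Import Order.TTheory GRing.Theory.
Local Open Scope classical_set_scope.
Local Open Scope ring_scope.

Section Submodules.
Variables (k : fieldType) (V : lmodType k).
Implicit Types (N G : set V).

Definition is_submod N :=
  N 0 /\ forall (c : k) (u v : V), N u -> N v -> N (c *: u + v).

Lemma is_submodD N u v : is_submod N -> N u -> N v -> N (u + v).
Proof. by case=> _ H Nu Nv; rewrite -[u]scale1r; apply: H. Qed.

Lemma is_submodZ N c u : is_submod N -> N u -> N (c *: u).
Proof. by case=> N0 H Nu; rewrite -[_ *: _]addr0; apply: H. Qed.

Lemma is_submodB N u v : is_submod N -> N u -> N v -> N (u - v).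
Proof. by move=> [_ H] Nu Nv; rewrite addrC -scaleN1r; apply: H. Qed.

Lemma is_submod_sum (J : eqType) N (s : seq J) (f : J -> V) :
  is_submod N -> (forall j, j \in s -> N (f j)) -> N (\sum_(j <- s) f j).
Proof.
move=> HN Hf; rewrite big_seq_cond; elim/big_ind: _ => //.
- by case: HN.
- by move=> *; apply: is_submodD.
- by move=> j /andP[/Hf].
Qed.

Definition spanned G : set V := smallest is_submod G.

Lemma is_submod_spanned G : is_submod (spanned G).
Proof.
split=> [N [[]]//|c u v Hu Hv N [HN GN]].
by apply: (HN.2); [apply: Hu | apply: Hv].
Qed.

Lemma spanned_in G v : G v -> spanned G v.
Proof. by move=> Gv N [_]; apply. Qed.

Lemma spanned_sub G N : is_submod N -> G `<=` N -> spanned G `<=` N.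
Proof. by move=> HN GN v; apply. Qed.

Definition fin_dim N :=
  exists (n : nat) (b : 'I_n -> V), (forall i, N (b i)) /\
    forall v, N v -> exists c : 'I_n -> k, v = \sum_(i < n) c i *: b i.

(** Internal direct sum: [V = (+)_j G j]. *)
Definition direct_sum (J : choiceType) (G : J -> set V) :=
  [/\ forall j, is_submod (G j),
      forall v, exists (s : seq J) (f : J -> V),
        (forall j, G j (f j)) /\ v = \sum_(j <- s) f j
    & forall (s : seq J) (f : J -> V), uniq s -> (forall j, G j (f j)) ->
        \sum_(j <- s) f j = 0 -> forall j, j \in s -> f j = 0].

End Submodules.

Section SubType.
Variables (k : fieldType) (V : lmodType k) (N : set V) (HN : is_submod N).

Definition sub_pred of is_submod N : {pred V} := fun v => `[< N v >].
Local Notation P := (sub_pred HN).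

Lemma sub_pred_closed : submod_closed P.
Proof.
split; first by apply/asboolP; case: HN.
by move=> c u v /asboolP Nu /asboolP Nv; apply/asboolP; apply: (HN.2).
Qed.
HB.instance Definition _ := GRing.isSubmodClosed.Build k V P sub_pred_closed.

Record sub_mod := SubMod { sub_val :> V; _ : sub_val \in P }.
HB.instance Definition _ := [isSub for sub_val].
HB.instance Definition _ := [Choice of sub_mod by <:].
HB.instance Definition _ := [SubChoice_isSubLmodule of sub_mod by <:].

Lemma sub_modP (u : sub_mod) : N u.
Proof. by case: u => u /= /asboolP. Qed.

Definition to_sub (v : V) (Nv : N v) : sub_mod := SubMod (asboolT Nv).

Definition quot_mod := Quotient.quot P.
HB.instance Definition _ := GRing.Zmodule.on quot_mod.

Definition quot_pi (v : V) : quot_mod := \pi_(Quotient.quot P)%qT v.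
Definition quot_repr (q : quot_mod) : V := repr (q : Quotient.quot P).

Lemma quot_piP u v : quot_pi u = quot_pi v <-> N (u - v).
Proof.
split=> [/eqP|H]; rewrite ?/quot_pi.
  by rewrite -Quotient.idealrBE => /asboolP.
by apply/eqP; rewrite -Quotient.idealrBE; apply/asboolP.
Qed.

Lemma quot_reprK q : quot_pi (quot_repr q) = q.
Proof. exact: reprK. Qed.

Lemma quot_piB u v : quot_pi (u - v) = quot_pi u - quot_pi v.
Proof. exact: (raddfB (\pi_(Quotient.quot P)%qT)). Qed.
Lemma quot_piD u v : quot_pi (u + v) = quot_pi u + quot_pi v.
Proof. exact: (raddfD (\pi_(Quotient.quot P)%qT)). Qed.

Definition quot_scale (c : k) (q : quot_mod) := quot_pi (c *: quot_repr q).

Lemma quot_scaleE c v : quot_scale c (quot_pi v) = quot_pi (c *: v).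
Proof.
apply/quot_piP; rewrite -scalerBr; apply: is_submodZ => //.
by apply/quot_piP; rewrite quot_reprK.
Qed.

Fact quot_scaleA a b q : quot_scale a (quot_scale b q) = quot_scale (a * b) q.
Proof. by rewrite -[q]quot_reprK !quot_scaleE scalerA. Qed.
Fact quot_scale1 q : quot_scale 1 q = q.
Proof. by rewrite -[q]quot_reprK !quot_scaleE scale1r. Qed.
Fact quot_scaleDr a p q : quot_scale a (p + q) = quot_scale a p + quot_scale a q.
Proof.
by rewrite -[q]quot_reprK -[p]quot_reprK -quot_piD !quot_scaleE scalerDr quot_piD.
Qed.
Fact quot_scaleDl q a b : quot_scale (a + b) q = quot_scale a q + quot_scale b q.
Proof. by rewrite -[q]quot_reprK !quot_scaleE scalerDl quot_piD. Qed.
HB.instance Definition _ := GRing.Zmodule_isLmodule.Build k quot_mod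
  quot_scaleA quot_scale1 quot_scaleDr quot_scaleDl.

Fact quot_pi_linear : linear quot_pi.
Proof. by move=> c u v; rewrite quot_piD -quot_scaleE. Qed.
HB.instance Definition _ := GRing.isLinear.Build k V quot_mod _ quot_pi quot_pi_linear.

Lemma quot_pi0 v : N v -> quot_pi v = 0.
Proof. by move=> Nv; rewrite -(linear0 quot_pi); apply/quot_piP; rewrite subr0. Qed.

End SubType.

Section LinearFunctions.
Variables (k : fieldType) (U V : lmodType k) (f : U -> V) (Hf : linear f).
Let g : {linear U -> V} := HB.pack f (GRing.isLinear.Build k U V _ f Hf).

Lemma lin0 : f 0 = 0. Proof. exact: (linear0 g). Qed.
Lemma linD u v : f (u + v) = f u + f v. Proof. exact: (linearD g). Qed.
Lemma linB u v : f (u - v) = f u - f v. Proof. exact: (linearB g). Qed.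
Lemma linZ c u : f (c *: u) = c *: f u. Proof. exact: (linearZ_LR g). Qed.
Lemma lin_sum J (s : seq J) (F : J -> U) :
  f (\sum_(j <- s) F j) = \sum_(j <- s) f (F j).
Proof. exact: (linear_sum g). Qed.

End LinearFunctions.

Lemma sum_widen (V : nmodType) (J : eqType) (s t : seq J) (f : J -> V) :
  uniq s -> uniq t -> {subset s <= t} -> (forall j, j \notin s -> f j = 0) ->
  \sum_(j <- t) f j = \sum_(j <- s) f j.
Proof.
move=> us ut st f0; rewrite (bigID (mem s)) /= [X in _ + X]big1 ?addr0 => [|j /f0 //].
rewrite -big_filter; apply/perm_big/uniq_perm; rewrite ?filter_uniq // => j.
by rewrite mem_filter; case: (boolP (j \in s)) => //= /st.
Qed.

Section DirectSums.
Variables (k : fieldType) (V : lmodType k) (J : choiceType) (G : J -> set V).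

Definition decomposes v (s : seq J) (f : J -> V) :=
  [/\ uniq s, forall j, G j (f j), forall j, j \notin s -> f j = 0
    & v = \sum_(j <- s) f j].

Definition sum_of : set V := [set v | exists s f, decomposes v s f].

Hypothesis submodG : forall j, is_submod (G j).

Lemma is_submod_sum_of : is_submod sum_of.
Proof.
split.
  by exists [::], (fun=> 0); split=> // [j|]; rewrite ?big_nil //; case: (submodG j).
move=> c u v [s [f [us Gf f0 ->]]] [t [g [ut Gg g0 ->]]].
exists (undup (s ++ t)), (fun j => c *: f j + g j); split.
- exact: undup_uniq.
- by move=> j; apply: (submodG j).2.
- by move=> j; rewrite mem_undup mem_cat negb_or => /andP[/f0-> /g0->]; rewrite scaler0 addr0.
- rewrite big_split -scaler_sumr /=; congr (_ *: _ + _); apply/esym/sum_widen => //;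
    by rewrite ?undup_uniq // => j; rewrite mem_undup mem_cat => ->; rewrite ?orbT.
Qed.

Lemma sum_of_in j v : G j v -> sum_of v.
Proof.
move=> Gv; exists [:: j], (fun i => if i == j then v else 0); split=> //.
- by move=> i; case: eqP => [->//|_]; case: (submodG i).
- by move=> i; rewrite inE => /negbTE ->.
- by rewrite big_seq1 eqxx.
Qed.

Lemma decomposes_of (s : seq J) (f : J -> V) : (forall j, G j (f j)) ->
  sum_of (\sum_(j <- s) f j).
Proof.
move=> Gf; apply: is_submod_sum is_submod_sum_of _ => j _; exact: sum_of_in (Gf j).
Qed.

Lemma direct_sum_of_proj (p : J -> V -> V) : (forall v, sum_of v) ->
  (forall j, linear (p j)) -> (forall j v, G j v -> p j v = v) ->
  (forall i j v, i != j -> G j v -> p i v = 0) -> direct_sum G.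
Proof.
move=> span lp p1 p0; split=> // [v|s f us Gf sum0 j js].
  by have [s [f [_ Gf _ ->]]] := span v; exists s, f.
have := congr1 (p j) sum0; rewrite (lin0 (lp j)) (lin_sum (lp j)).
by rewrite (bigD1_seq j) //= big1 => [|i ij]; rewrite ?addr0 ?(p1 _ _ (Gf j)) // (p0 j i) // eq_sym.
Qed.

Lemma direct_sum_of_idem (p : J -> V -> V) : (forall v, sum_of v) ->
  (forall j, linear (p j)) -> (forall j v, p j (p j v) = p j v) ->
  (forall i j v, i != j -> p i (p j v) = 0) ->
  (forall j, G j = [set p j v | v in setT]) -> direct_sum G.
Proof.
move=> span lp pp pq defG; apply: direct_sum_of_proj span lp _ _ => [j v|i j v].
  by rewrite defG => -[w _ <-].
by move=> ij; rewrite defG => -[w _ <-]; apply: pq.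
Qed.

End DirectSums.

Section Projections.
Variables (k : fieldType) (V : lmodType k) (J : choiceType) (G : J -> set V).
Hypothesis dG : direct_sum G.

Let submodG : forall j, is_submod (G j). Proof. by case: dG. Qed.

Lemma direct_sum_sum_of v : sum_of G v.
Proof.
by case: dG => _ + _ => /(_ v)[s [f [Gf ->]]]; apply: decomposes_of.
Qed.

Definition ds_supp v : seq J := sval (cid (direct_sum_sum_of v)).
Definition ds_proj j v : V := sval (cid (svalP (cid (direct_sum_sum_of v)))) j.

Lemma ds_projP v : decomposes G v (ds_supp v) (ds_proj^~ v).
Proof. exact: svalP (cid (svalP (cid (direct_sum_sum_of v)))). Qed.

Lemma ds_projG j v : G j (ds_proj j v).
Proof. by case: (ds_projP v). Qed.

Lemma ds_proj_sum v : v = \sum_(j <- ds_supp v) ds_proj j v.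
Proof. by case: (ds_projP v). Qed.

Lemma ds_proj_eq v s f : decomposes G v s f -> forall j, ds_proj j v = f j.
Proof.
case=> us Gf f0 ev j; have [ut Gg g0 ev'] := ds_projP v.
set t := ds_supp v in ut g0 ev'.
have [_ _ ind] := dG.
have /(ind (undup (s ++ t)) (fun i => ds_proj i v - f i) (undup_uniq _)) H :
  forall i, G i (ds_proj i v - f i) by move=> i; apply: is_submodB.
have [/H/eqP|] := boolP (j \in undup (s ++ t)).
  rewrite subr_eq0 => /(_ _)/eqP; apply.
  rewrite big_split sumrN /= -(_ : v = \sum_(i <- undup (s ++ t)) f i).
    rewrite -(_ : v = \sum_(i <- undup (s ++ t)) ds_proj i v) ?subrr //.
    rewrite [LHS]ev'; apply/esym/sum_widen => //; first exact: undup_uniq.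
    by move=> i; rewrite mem_undup mem_cat => ->; rewrite orbT.
  rewrite [LHS]ev; apply/esym/sum_widen => //; first exact: undup_uniq.
  by move=> i; rewrite mem_undup mem_cat => ->.
by rewrite mem_undup mem_cat negb_or => /andP[/f0-> /g0->].
Qed.

Lemma ds_proj_linear j : linear (ds_proj j).
Proof.
move=> c u v; have [us Gf f0 eu] := ds_projP u; have [ut Gg g0 ev] := ds_projP v.
apply: (@ds_proj_eq _ (undup (ds_supp u ++ ds_supp v))
         (fun j => c *: ds_proj j u + ds_proj j v)); split.
- exact: undup_uniq.
- by move=> i; apply: (submodG i).2.
- by move=> i; rewrite mem_undup mem_cat negb_or => /andP[/f0-> /g0->]; rewrite scaler0 addr0.
- rewrite big_split -scaler_sumr /= [in LHS]eu [in LHS]ev.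
  congr (_ *: _ + _); apply/esym/sum_widen => //;
    by rewrite ?undup_uniq // => i; rewrite mem_undup mem_cat => ->; rewrite ?orbT.
Qed.

Lemma ds_proj_in i j v : G j v -> ds_proj i v = if i == j then v else 0.
Proof.
move=> Gv; apply: (@ds_proj_eq _ [:: j] (fun i => if i == j then v else 0)); split=> //.
- by move=> h; case: eqP => [->//|_]; case: (submodG h).
- by move=> h; rewrite inE => /negbTE ->.
- by rewrite big_seq1 eqxx.
Qed.

Lemma ds_proj_id j v : G j v -> ds_proj j v = v.
Proof. by move/(ds_proj_in j); rewrite eqxx. Qed.

Lemma ds_proj_ne i j v : i != j -> G j v -> ds_proj i v = 0.
Proof. by move=> /negbTE ij /(ds_proj_in i); rewrite ij. Qed.

Lemma ds_ind (P : set V) : is_submod P -> (forall j v, G j v -> P v) -> forall v, P v.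
Proof.
move=> HP GP v; rewrite (ds_proj_sum v); apply: is_submod_sum => // j _.
exact: GP (ds_projG j v).
Qed.

End Projections.

(** [A = (+)_{i,j} 1_i A 1_j], with its product not assumed to have a unit; a
    unital graded algebra is the case [I = unit]. The last field says that [A] is
    the direct sum of the [1_i A 1_j], the one on [ga_gr] that it is the direct
    sum of its homogeneous components. *)
Record lu_galgebra (k : fieldType) (I : choiceType) := LUGAlgebra {
  ga_sort :> lmodType k;
  ga_mul : ga_sort -> ga_sort -> ga_sort;
  ga_one : I -> ga_sort;
  ga_gr : int -> set ga_sort;
  ga_mul_linearr : forall a, linear (ga_mul a);
  ga_mul_linearl : forall b, linear (ga_mul^~ b);
  ga_mulA : associative ga_mul;
  ga_oneM : forall i j,
    ga_mul (ga_one i) (ga_one j) = if i == j then ga_one i else 0;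
  ga_one_homog : forall i, exists d, ga_gr d (ga_one i);
  ga_gr_direct : direct_sum ga_gr;
  ga_grM : forall d e a b,
    ga_gr d a -> ga_gr e b -> ga_gr (d + e) (ga_mul a b);
  ga_peirce : direct_sum (fun p : I * I =>
    [set ga_mul (ga_mul (ga_one p.1) a) (ga_one p.2) | a in setT])
}.
Arguments ga_mul {k I} _ _ _.
Arguments ga_one {k I} _ _.
Arguments ga_gr {k I} _ _ _.

Section AlgebraTheory.
Variables (k : fieldType) (I : choiceType) (A : lu_galgebra k I).
Implicit Types (a b : A) (i j : I).
Local Notation "a ** b" := (ga_mul A a b) (at level 40, left associativity).
Local Notation one := (ga_one A).

Lemma ga_mulDr a b c : a ** (b + c) = a ** b + a ** c.
Proof. exact: (linD (ga_mul_linearr a)). Qed.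
Lemma ga_mulBr a b c : a ** (b - c) = a ** b - a ** c.
Proof. exact: (linB (ga_mul_linearr a)). Qed.
Lemma ga_mulDl a b c : (a + b) ** c = a ** c + b ** c.
Proof. exact: (linD (ga_mul_linearl c)). Qed.
Lemma ga_mulBl a b c : (a - b) ** c = a ** c - b ** c.
Proof. exact: (linB (ga_mul_linearl c)). Qed.
Lemma ga_mulZr x a b : a ** (x *: b) = x *: (a ** b).
Proof. exact: (linZ (ga_mul_linearr a)). Qed.
Lemma ga_mulZl x a b : (x *: a) ** b = x *: (a ** b).
Proof. exact: (linZ (ga_mul_linearl b)). Qed.
Lemma ga_mul0r a : a ** 0 = 0. Proof. exact: (lin0 (ga_mul_linearr a)). Qed.
Lemma ga_mul0l a : 0 ** a = 0. Proof. exact: (lin0 (ga_mul_linearl a)). Qed.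
Lemma ga_mul_sumr J (s : seq J) (F : J -> A) a :
  a ** (\sum_(j <- s) F j) = \sum_(j <- s) a ** F j.
Proof. exact: (lin_sum (ga_mul_linearr a)). Qed.
Lemma ga_mul_suml J (s : seq J) (F : J -> A) a :
  (\sum_(j <- s) F j) ** a = \sum_(j <- s) F j ** a.
Proof. exact: (lin_sum (ga_mul_linearl a)). Qed.

Lemma ga_gr_submod d : is_submod (ga_gr A d).
Proof. by case: (ga_gr_direct A). Qed.

Lemma ga_one_gr0 i : ga_gr A 0 (one i).
Proof.
have [d H] := ga_one_homog A i; have [d0|d0] := eqVneq d 0; first by rewrite -d0.
have H2 := ga_grM H H; rewrite ga_oneM eqxx in H2.
have ne : d != d + d by rewrite -subr_eq0 opprD addNKr oppr_eq0.
have := ds_proj_id (ga_gr_direct A) H.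
rewrite (ds_proj_ne (ga_gr_direct A) ne H2) => <-.
by case: (ga_gr_submod 0).
Qed.

Lemma ga_local_unit a : exists s : seq I, uniq s /\
  (\sum_(i <- s) one i) ** a = a /\ a ** (\sum_(i <- s) one i) = a.
Proof.
pose u (s : seq I) := \sum_(i <- s) one i.
have uE (s : seq I) i : uniq s -> (u s ** one i = if i \in s then one i else 0)
    /\ (one i ** u s = if i \in s then one i else 0).
  move=> us; rewrite /u ga_mul_suml ga_mul_sumr; case: ifP => is_.
    rewrite (bigD1_seq i) //= ga_oneM eqxx big1; last first.
      by move=> j /negbTE ji; rewrite ga_oneM ji.
    rewrite (bigD1_seq i) //= ga_oneM eqxx big1 ?addr0 // => j.
    by rewrite eq_sym => /negbTE ji; rewrite ga_oneM ji.
  rewrite big_seq big1 => [|j js]; last first.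
    by rewrite ga_oneM; case: eqP => // ji; rewrite -ji js in is_.
  split=> //; rewrite big_seq big1 => [//|j js].
  by rewrite ga_oneM; case: eqP => // ji; rewrite ji js in is_.
have [t [f [_ Gf _ ->]]] := direct_sum_sum_of (ga_peirce A) a.
pose s := undup ([seq p.1 | p <- t] ++ [seq p.2 | p <- t]).
exists s; split; first exact: undup_uniq.
have us : uniq s by apply: undup_uniq.
rewrite -/(u s) ga_mul_sumr ga_mul_suml; split; apply: eq_big_seq => p pt;
  have [b _ <-] := Gf p.
  rewrite !ga_mulA (uE s p.1 us).1 ifT //.
  by rewrite mem_undup mem_cat map_f.
rewrite -!ga_mulA (uE s p.2 us).2 ifT //.
by rewrite mem_undup mem_cat orbC map_f.
Qed.

End AlgebraTheory.

Record gmodule (k : fieldType) (I : choiceType) (A : lu_galgebra k I) := GModule {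
  gm_sort :> lmodType k;
  gm_act : A -> gm_sort -> gm_sort;
  gm_gr : int -> set gm_sort;
  gm_act_linearr : forall a, linear (gm_act a);
  gm_act_linearl : forall v, linear (gm_act^~ v);
  gm_actA : forall a b v, gm_act a (gm_act b v) = gm_act (ga_mul A a b) v;
  gm_gr_direct : direct_sum gm_gr;
  gm_grM : forall d e a v,
    ga_gr A d a -> gm_gr e v -> gm_gr (d + e) (gm_act a v);
  gm_peirce : direct_sum (fun i : I => [set gm_act (ga_one A i) v | v in setT])
}.
Arguments gm_act {k I A} _ _ _.
Arguments gm_gr {k I A} _ _ _.

Section ModuleTheory.
Variables (k : fieldType) (I : choiceType) (A : lu_galgebra k I).
Implicit Types (U V W : gmodule A).

Lemma gm_gr_submod V d : is_submod (gm_gr V d).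
Proof. by case: (gm_gr_direct V). Qed.

Lemma gm_peirce_submod (V : lmodType k) (act : A -> V -> V) :
  (forall a, linear (act a)) -> 
  forall i, is_submod [set act (ga_one A i) v | v in setT].
Proof.
move=> lr i; split; first by exists 0; rewrite ?(lin0 (lr _)).
by move=> c _ _ [u _ <-] [v _ <-]; exists (c *: u + v) => //; apply: lr.
Qed.

Lemma gm_peirce_of (V : lmodType k) (act : A -> V -> V) :
  (forall a, linear (act a)) -> (forall v, linear (act^~ v)) ->
  (forall a b v, act a (act b v) = act (ga_mul A a b) v) ->
  (forall v, sum_of (fun i : I => [set act (ga_one A i) v | v in setT]) v) ->
  direct_sum (fun i : I => [set act (ga_one A i) v | v in setT]).
Proof.
move=> lr ll aA sp; apply: (@direct_sum_of_idem _ _ _ _ _ (fun i => act (ga_one A i))) => //.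
- exact: gm_peirce_submod.
- by move=> j v; rewrite aA ga_oneM eqxx.
- by move=> i j v /negbTE ij; rewrite aA ga_oneM ij (lin0 (ll v)).
Qed.

(** [gm_hom d f]: [f] belongs to [Hom_A(V, W)_d]. *)
Definition gm_hom V W (d : int) (f : V -> W) :=
  [/\ linear f, forall a v, f (gm_act V a v) = gm_act W a (f v)
    & forall n v, gm_gr V n v -> gm_gr W (n + d) (f v)].

(** Morphisms of [A]-gmod. *)
Record gmod_mor V W := GModMor { gh_fun :> V -> W; gh_homP : gm_hom 0 gh_fun }.

Lemma gmod_mor_ext V W (f g : gmod_mor V W) : f =1 g -> f = g.
Proof.
case: f g => [f Hf] [g Hg] /= /funext fg; rewrite -{g}fg in Hg *.
by congr GModMor; apply: Prop_irrelevance.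
Qed.

Lemma gm_hom_id V : gm_hom 0 (@id V).
Proof. by split=> // n v; rewrite addr0. Qed.

Lemma gm_hom_comp U V W d e (f : U -> V) (g : V -> W) :
  gm_hom d f -> gm_hom e g -> gm_hom (d + e) (g \o f).
Proof.
move=> [lf af gf] [lg ag gg]; split=> [c u v|a v|n v /gf/gg] /=.
- by rewrite lf lg.
- by rewrite af ag.
- by rewrite addrA.
Qed.

Definition gmod_id V : gmod_mor V V := GModMor (gm_hom_id V).
Definition gmod_comp U V W (g : gmod_mor V W) (f : gmod_mor U V) : gmod_mor U W :=
  GModMor (gm_hom_comp (gh_homP f) (gh_homP g)).

Definition short_exact U V W (f : gmod_mor U V) (g : gmod_mor V W) :=
  [/\ injective f, forall v, g v = 0 <-> exists u, f u = v
    & forall w, exists v, g v = w].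

(** The component [1_i V_d]. *)
Definition gm_piece V (i : I) (d : int) : set V :=
  [set gm_act V (ga_one A i) v | v in gm_gr V d].

Definition locally_fd V := forall i d, fin_dim (@gm_piece V i d).
Definition bounded_below V := forall i, exists N : int,
  forall d, (d < N)%R -> @gm_piece V i d = [set 0].
Definition bounded_above V := forall i, exists N : int,
  forall d, (N < d)%R -> @gm_piece V i d = [set 0].

(** The component [(1_i A 1_j)_d]. *)
Definition ga_piece (i j : I) (d : int) : set A :=
  [set ga_mul A (ga_mul A (ga_one A i) a) (ga_one A j) | a in ga_gr A d].

Definition ga_locally_fd := forall i j d, fin_dim (ga_piece i j d).
Definition ga_bounded_below := forall i j, exists N : int,
  forall d, (d < N)%R -> ga_piece i j d = [set 0].

End ModuleTheory.

(** [k]-linear functors from [A]-gmod to [B]-gmod. *)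
Record gmod_functor (k : fieldType) (I J : choiceType)
    (A : lu_galgebra k I) (B : lu_galgebra k J) := GModFunctor {
  gf_ob :> gmodule A -> gmodule B;
  gf_mor : forall V W, gmod_mor V W -> gmod_mor (gf_ob V) (gf_ob W);
  gf_id : forall V, gf_mor (gmod_id V) = gmod_id (gf_ob V);
  gf_comp : forall U V W (g : gmod_mor V W) (f : gmod_mor U V),
    gf_mor (gmod_comp g f) = gmod_comp (gf_mor g) (gf_mor f);
  gf_linear : forall V W (c : k) (f g h : gmod_mor V W),
    (forall v, h v = c *: f v + g v) ->
    forall v, gf_mor h v = c *: gf_mor f v + gf_mor g v
}.
Arguments gf_mor {k I J A B} _ {V W} _.

Definition exact_functor (k : fieldType) (I J : choiceType)
    (A : lu_galgebra k I) (B : lu_galgebra k J) (F : gmod_functor A B) :=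
  forall (U V W : gmodule A) (f : gmod_mor U V) (g : gmod_mor V W),
    short_exact f g -> short_exact (gf_mor F f) (gf_mor F g).

Section QuotientAlgebra.
Variables (k : fieldType) (I : choiceType) (A : lu_galgebra k I).
Local Notation "a ** b" := (ga_mul A a b) (at level 40, left associativity).

Definition is_ideal (N : set A) :=
  is_submod N /\ forall a x, N x -> N (a ** x) /\ N (x ** a).

Definition ideal_gen (G : set A) : set A := smallest is_ideal G.

Lemma ideal_gen_ideal G : is_ideal (ideal_gen G).
Proof.
split; first split.
- by move=> N [[[]]].
- by move=> c u v Hu Hv N [[HN HM] GN]; apply: HN.2; [apply: Hu|apply: Hv].
- by move=> a x Hx; split=> N HN; have /(_ a x) := HN.1.2; case=> //; apply: Hx.
Qed.

Lemma ideal_gen_sub G : G `<=` ideal_gen G.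
Proof. by move=> x Gx N [_]; apply. Qed.

Variables (G : set A) (HG : forall g, G g -> exists d, ga_gr A d g).
Local Notation N := (ideal_gen G).
Local Notation grp := (ds_proj (ga_gr_direct A)).

Let idealN := ideal_gen_ideal G.

Lemma ideal_gen_homog x : N x -> forall d, N (grp d x).
Proof.
suff H : N `<=` [set x | forall d, N (grp d x)] by apply: H.
have lp e := ds_proj_linear (ga_gr_direct A) e.
move=> y; apply; split; last first.
  move=> g Gg d; have [e He] := HG Gg; rewrite (ds_proj_in _ d He).
  by case: eqP => _; [apply: ideal_gen_sub | case: idealN => -[]].
split; first split.
- by move=> d; rewrite (lin0 (lp d)); case: idealN => -[].
- by move=> c u v Hu Hv d; rewrite (lp d); apply: idealN.1.2.
move=> a z Hz.
suff H e b : ga_gr A e b -> forall d,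
    grp d (b ** z) = b ** grp (d - e) z /\ grp d (z ** b) = grp (d - e) z ** b.
  by split=> d; rewrite [a](ds_proj_sum (ga_gr_direct A)) ?ga_mul_suml ?ga_mul_sumr
    (lin_sum (lp d)); apply: is_submod_sum (idealN.1) _ => e _;
    [rewrite (H _ _ (ds_projG (ga_gr_direct A) e a) d).1
    |rewrite (H _ _ (ds_projG (ga_gr_direct A) e a) d).2];
    have [] := idealN.2 (grp e a) _ (Hz (d - e)).
move=> Hb d; move: z {Hz}; apply: (ds_ind (ga_gr_direct A)).
  split; first by rewrite !(ga_mul0l, ga_mul0r, lin0 (lp _)).
  move=> c u v [Hu1 Hu2] [Hv1 Hv2].
  by rewrite !(lp, ga_mulDr, ga_mulDl, ga_mulZr, ga_mulZl) Hu1 Hv1 Hu2 Hv2.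
move=> n z Hz; rewrite (ds_proj_in _ d (ga_grM Hb Hz)) (ds_proj_in _ d (ga_grM Hz Hb)).
rewrite (ds_proj_in _ (d - e) Hz) subr_eq [n + e]addrC.
by case: ifP; rewrite ?ga_mul0l ?ga_mul0r.
Qed.

Definition quot_alg_sort : lmodType k := quot_mod idealN.1.
Local Notation Q := quot_alg_sort.
Local Notation pi := (quot_pi idealN.1 : A -> Q).
Local Notation rep := (@quot_repr _ _ _ idealN.1).

Definition quot_alg_mul (x y : Q) : Q := pi (rep x ** rep y).
Definition quot_alg_one i : Q := pi (ga_one A i).
Definition quot_alg_gr d : set Q := [set pi a | a in ga_gr A d].

Lemma quot_alg_piM a b : quot_alg_mul (pi a) (pi b) = pi (a ** b).
Proof.
have rN c : N (rep (pi c) - c).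
  by apply/(@quot_piP _ _ _ idealN.1); rewrite quot_reprK.
apply/(@quot_piP _ _ _ idealN.1).
rewrite -[X in N X](subrKA (rep (pi a) ** b)) -ga_mulBr -ga_mulBl.
by apply: is_submodD idealN.1 _ _; [have [] := idealN.2 (rep (pi a)) _ (rN b)
  |have [] := idealN.2 b _ (rN a)].
Qed.

Lemma quot_alg_ind (P : Q -> Prop) : (forall a, P (pi a)) -> forall x, P x.
Proof. by move=> H x; rewrite -(quot_reprK x); apply: H. Qed.

Let pi_lin : linear pi := @quot_pi_linear _ _ _ idealN.1.

Fact quot_alg_mul_linearr x : linear (quot_alg_mul x).
Proof.
move: x; apply: quot_alg_ind => x c; apply: quot_alg_ind => u.
apply: quot_alg_ind => v.
by rewrite -pi_lin !quot_alg_piM ga_mul_linearr pi_lin.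
Qed.

Fact quot_alg_mul_linearl x : linear (quot_alg_mul^~ x).
Proof.
move: x; apply: quot_alg_ind => x c; apply: quot_alg_ind => u.
apply: quot_alg_ind => v.
by rewrite -pi_lin !quot_alg_piM (ga_mul_linearl x) pi_lin.
Qed.

Fact quot_alg_mulA : associative quot_alg_mul.
Proof.
apply: quot_alg_ind => x; apply: quot_alg_ind => y; apply: quot_alg_ind => z.
by rewrite !quot_alg_piM ga_mulA.
Qed.

Fact quot_alg_oneM i j : quot_alg_mul (quot_alg_one i) (quot_alg_one j) =
  if i == j then quot_alg_one i else 0.
Proof.
by rewrite quot_alg_piM ga_oneM; case: ifP; rewrite // (lin0 pi_lin).
Qed.

Fact quot_alg_one_homog i : exists d, quot_alg_gr d (quot_alg_one i).
Proof. by exists 0, (ga_one A i) => //; apply: ga_one_gr0. Qed.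

Fact quot_alg_gr_direct : direct_sum quot_alg_gr.
Proof.
have lp d := ds_proj_linear (ga_gr_direct A) d.
have subgr d : is_submod (quot_alg_gr d).
  have [g0 gl] := ga_gr_submod A d; split; first by exists 0; rewrite ?(lin0 pi_lin).
  move=> c _ _ [u gu <-] [v gv <-]; exists (c *: u + v); first exact: gl.
  by rewrite pi_lin.
have pE d a : pi (grp d (rep (pi a))) = pi (grp d a).
  apply/(@quot_piP _ _ _ idealN.1); rewrite -(linB (lp d)).
  by apply: ideal_gen_homog; apply/(@quot_piP _ _ _ idealN.1); rewrite quot_reprK.
apply: (@direct_sum_of_proj _ _ _ _ _ (fun d x => pi (grp d (rep x)))) => //.
- apply: quot_alg_ind => a; rewrite (ds_proj_sum (ga_gr_direct A) a) (lin_sum pi_lin).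
  by apply: decomposes_of => // d; exists (grp d a) => //; apply: ds_projG.
- move=> d c; apply: quot_alg_ind => u; apply: quot_alg_ind => v.
  by rewrite -pi_lin !pE lp pi_lin.
- by move=> d _ [a Ha <-]; rewrite pE ds_proj_id.
- by move=> d e _ de [a Ha <-]; rewrite pE (ds_proj_ne _ de Ha) (lin0 pi_lin).
Qed.

Fact quot_alg_grM d e x y : quot_alg_gr d x -> quot_alg_gr e y ->
  quot_alg_gr (d + e) (quot_alg_mul x y).
Proof.
move=> [a Ha <-] [b Hb <-]; exists (a ** b); first exact: ga_grM.
by rewrite quot_alg_piM.
Qed.

Fact quot_alg_peirce : direct_sum (fun p : I * I =>
  [set quot_alg_mul (quot_alg_mul (quot_alg_one p.1) x) (quot_alg_one p.2)
     | x in setT]).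
Proof.
pose p (ij : I * I) x :=
  quot_alg_mul (quot_alg_mul (quot_alg_one ij.1) x) (quot_alg_one ij.2).
have lp ij : linear (p ij).
  by move=> c u v; rewrite /p quot_alg_mul_linearr (quot_alg_mul_linearl (quot_alg_one ij.2)).
apply: (@direct_sum_of_idem _ _ _ _ _ p) => //.
- move=> ij; split; first by exists 0; rewrite // -/(p _ _) (lin0 (lp _)).
  by move=> c _ _ [u _ <-] [v _ <-]; exists (c *: u + v) => //; rewrite -!/(p _ _) lp.
- apply: quot_alg_ind => a.
  rewrite (ds_proj_sum (ga_peirce A) a) (lin_sum pi_lin).
  apply: decomposes_of => [ij|ij].
    split; first by exists 0; rewrite // -/(p _ _) (lin0 (lp _)).
    by move=> c _ _ [u _ <-] [v _ <-]; exists (c *: u + v) => //; rewrite -!/(p _ _) lp.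
  have [b _ <-] := ds_projG (ga_peirce A) ij a.
  by exists (pi b); rewrite // /quot_alg_one !quot_alg_piM.
- move=> ij x; rewrite /p !quot_alg_mulA quot_alg_oneM eqxx -!quot_alg_mulA.
  by rewrite quot_alg_oneM eqxx.
- move=> [i j] [i' j'] x ne; rewrite /p !quot_alg_mulA /= quot_alg_oneM.
  rewrite -2!quot_alg_mulA quot_alg_oneM.
  move: ne; rewrite xpair_eqE negb_and [j' == j]eq_sym; case: eqP => /= [_|_ _].
    by move=> /negbTE ->; rewrite !(lin0 (quot_alg_mul_linearr _)).
  by rewrite (lin0 (quot_alg_mul_linearl _)).
Qed.

Definition quot_alg : lu_galgebra k I :=
  LUGAlgebra quot_alg_mul_linearr quot_alg_mul_linearl quot_alg_mulA
    quot_alg_oneM quot_alg_one_homog quot_alg_gr_direct quot_alg_grM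
    quot_alg_peirce.

Definition quot_alg_pi : A -> quot_alg := pi.

End QuotientAlgebra.

Section SumLemmas.
Variables (k : fieldType) (V : lmodType k).

Lemma sub_direct_sum (J : choiceType) (G : J -> set V) (dG : direct_sum G)
    (N : set V) (HN : is_submod N) :
  (forall j v, N v -> N (ds_proj dG j v)) ->
  direct_sum (fun j => [set x : sub_mod HN | G j (sub_val x)]).
Proof.
move=> Np; have subG j : is_submod (G j) by have [] := dG.
split.
- move=> j; split=> /= [|c u v Gu Gv]; first by case: (subG j).
  exact: (subG j).2.
- move=> v; exists (ds_supp dG (sub_val v)).
  exists (fun j => to_sub HN (Np j _ (sub_modP v))); split.
    by move=> j; apply: ds_projG.
  apply: val_inj; rewrite [LHS](ds_proj_sum dG) (lin_sum (f := val)) //.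
- move=> s f us Gf /(congr1 val); rewrite (lin_sum (f := val)) // => sum0 j js.
  have [_ _ ind] := dG; apply: val_inj; exact: (ind s _ us Gf sum0 j js).
Qed.

Variables (W : lmodType k) (J : choiceType) (G : J -> set V).
Variables (dG : direct_sum G) (g : J -> V -> W) (Hg : forall j, linear (g j)).

(** The linear map that is [g j] on [G j]. *)
Definition ds_fold (v : V) : W := \sum_(j <- ds_supp dG v) g j (ds_proj dG j v).

Lemma ds_fold_supp s v : uniq s -> (forall j, j \notin s -> ds_proj dG j v = 0) ->
  ds_fold v = \sum_(j <- s) g j (ds_proj dG j v).
Proof.
move=> us s0; have [ut _ t0 _] := ds_projP dG v.
transitivity (\sum_(j <- undup (ds_supp dG v ++ s)) g j (ds_proj dG j v)).
  apply/esym/sum_widen; rewrite ?undup_uniq //.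
    by move=> j; rewrite mem_undup mem_cat => ->.
  by move=> j /t0 ->; rewrite (lin0 (Hg j)).
apply/sum_widen; rewrite ?undup_uniq //.
  by move=> j; rewrite mem_undup mem_cat => ->; rewrite orbT.
by move=> j /s0 ->; rewrite (lin0 (Hg j)).
Qed.

Lemma ds_fold_linear : linear ds_fold.
Proof.
move=> c u v.
pose s := undup (ds_supp dG (c *: u + v) ++ ds_supp dG u ++ ds_supp dG v).
have us : uniq s by apply: undup_uniq.
have s0 w : {subset ds_supp dG w <= s} -> forall j, j \notin s -> ds_proj dG j w = 0.
  move=> ws j js; have [_ _ t0 _] := ds_projP dG w.
  by apply: t0; apply: contra js => /ws.
have sub w : w \in [:: c *: u + v; u; v] -> {subset ds_supp dG w <= s}.
  move=> ws j jw; rewrite mem_undup !mem_cat.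
  by move: ws jw; rewrite !inE => /or3P[]/eqP-> ->; rewrite ?orbT.
rewrite (ds_fold_supp us (s0 _ (sub (c *: u + v) _))) ?inE ?eqxx //.
rewrite (ds_fold_supp us (s0 _ (sub u _))) ?inE ?eqxx ?orbT //.
rewrite (ds_fold_supp us (s0 _ (sub v _))) ?inE ?eqxx ?orbT //.
rewrite scaler_sumr -big_split; apply: eq_bigr => j _ /=.
by rewrite (ds_proj_linear dG j) (Hg j).
Qed.

Lemma ds_fold_in j v : G j v -> ds_fold v = g j v.
Proof.
move=> Gv; rewrite (@ds_fold_supp [:: j]) //.
  by rewrite big_seq1 (ds_proj_id dG Gv).
by move=> i; rewrite inE => ij; rewrite (ds_proj_ne dG ij Gv).
Qed.

End SumLemmas.

Section FreeModules.
Variables (k : fieldType) (K : choiceType) (W : lmodType k) (f : K -> W).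

Lemma fglift_linear : linear (fglift f : {freeg K / k} -> W).
Proof.
have fD u v : fglift f (u + v) = fglift f u + fglift f v.
  have := lift_is_additive f (u + v) v; rewrite addrK => ->.
  by rewrite subrK.
have f0 : fglift f 0 = 0 by apply: (addIr (fglift f 0)); rewrite -fD !add0r.
have fS (s : seq K) (F : K -> {freeg K / k}) :
    fglift f (\sum_(x <- s) F x) = \sum_(x <- s) fglift f (F x).
  by elim: s => [|x s IHs]; rewrite ?big_nil ?f0 // !big_cons fD IHs.
move=> c u v; rewrite fD; congr (_ + _).
rewrite -[in RHS](freeg_sumE u) [c *: u]/(fgscale c u) /fgscale !fS scaler_sumr.
by apply: eq_bigr => x _; rewrite !liftU scalerA.
Qed.

End FreeModules.

Section Tensor.
Variables (k : fieldType) (M V : lmodType k) (X : Type).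
Variables (ra : M -> X -> M) (la : X -> V -> V).

Local Notation F := ({freeg (M * V)%type / k}).
Local Notation gen m v := (Freeg [:: (1, (m, v))] : F).

Inductive tensor_rel : F -> Prop :=
| TensorLinearl c m m' v :
    tensor_rel (gen (c *: m + m') v - (c *: gen m v + gen m' v))
| TensorLinearr c m v v' :
    tensor_rel (gen m (c *: v + v') - (c *: gen m v + gen m v'))
| TensorBalanced m x v :
    tensor_rel (gen (ra m x) v - gen m (la x v)).

(** The tensor product [M (x)_X V]: the quotient of the free module on [M * V]
    by the bilinearity relations and [(m x) (x) v = m (x) (x v)]. *)
Definition tensor : lmodType k := quot_mod (is_submod_spanned tensor_rel).
Local Notation pi := (quot_pi (is_submod_spanned tensor_rel) : F -> tensor).

Definition tens (m : M) (v : V) : tensor := pi (gen m v).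

Let pi_lin : linear pi := @quot_pi_linear _ _ _ (is_submod_spanned tensor_rel).

Lemma tens_linearl v : linear (tens^~ v).
Proof.
move=> c m m'; rewrite /tens -pi_lin; apply/quot_piP.
by apply: spanned_in; exact: TensorLinearl.
Qed.

Lemma tens_linearr m : linear (tens m).
Proof.
move=> c v v'; rewrite /tens -pi_lin; apply/quot_piP.
by apply: spanned_in; exact: TensorLinearr.
Qed.

Lemma tens_bal m x v : tens (ra m x) v = tens m (la x v).
Proof. by apply/quot_piP; apply: spanned_in; exact: TensorBalanced. Qed.

Lemma tensor_ind (P : set tensor) : is_submod P ->
  (forall m v, P (tens m v)) -> forall t, P t.
Proof.
move=> HP Pt t; rewrite -(quot_reprK t) -(freeg_sumE (quot_repr t)).
rewrite (lin_sum pi_lin); apply: is_submod_sum => // -[m v] _.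
set c := coeff _ _; suff -> : Freeg [:: (c, (m, v))] = c *: gen m v.
  by rewrite (linZ pi_lin); apply: is_submodZ => //; apply: Pt.
by apply/eqP/freeg_eqP => x; rewrite coeffZ !coeffU mul1r.
Qed.

Section Lift.
Variables (W : lmodType k) (phi : M -> V -> W).
Hypotheses (phil : forall v, linear (phi^~ v)) (phir : forall m, linear (phi m)).
Hypothesis phib : forall m x v, phi (ra m x) v = phi m (la x v).

Definition tensor_lift (t : tensor) : W :=
  fglift (fun mv => phi mv.1 mv.2) (quot_repr t).

Let lw := fglift_linear (fun mv : M * V => phi mv.1 mv.2).

Lemma tensor_lift_pi u : tensor_lift (pi u) = fglift (fun mv => phi mv.1 mv.2) u.
Proof.
apply/eqP; rewrite -subr_eq0 -(linB lw); apply/eqP.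
have : spanned tensor_rel (quot_repr (pi u) - u).
  by apply/(@quot_piP _ _ _ (is_submod_spanned tensor_rel)); rewrite quot_reprK.
move: (quot_repr (pi u) - u) => w; move: w.
apply: (@spanned_sub _ _ _ [set w | fglift (fun mv => phi mv.1 mv.2) w = 0]).
  split=> [|c u1 v1 /= Hu Hv] /=; first exact: (lin0 lw).
  by rewrite lw Hu Hv scaler0 addr0.
move=> w [c m m' v|c m v v'|m x v] /=; rewrite (linB lw) ?lw !liftU /= !scale1r.
- by rewrite phil subrr.
- by rewrite phir subrr.
- by rewrite phib subrr.
Qed.

Lemma tensor_lift_linear : linear tensor_lift.
Proof.
move=> c u v; rewrite -(quot_reprK u) -(quot_reprK v) -pi_lin !tensor_lift_pi.
exact: lw.
Qed.

Lemma tensor_lift_tens m v : tensor_lift (tens m v) = phi m v.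
Proof. by rewrite tensor_lift_pi liftU scale1r. Qed.

End Lift.
End Tensor.

Section Corner.
Variables (k : fieldType) (I : choiceType) (B : lu_galgebra k I).
Local Notation "a ** b" := (ga_mul B a b) (at level 40, left associativity).

Lemma ga_proj_mull d f a x : ga_gr B d a ->
  ds_proj (ga_gr_direct B) (d + f) (a ** x) = a ** ds_proj (ga_gr_direct B) f x.
Proof.
move=> Ha; have lp n : linear (ds_proj (ga_gr_direct B) n) := ds_proj_linear _ n.
move: x; apply: (ds_ind (ga_gr_direct B)).
  split=> /=; first by rewrite !(lin0 (lp _), ga_mul0r).
  by move=> c u v /= Hu Hv; rewrite !(lp, ga_mulDr, ga_mulZr) Hu Hv.
move=> n x Hx /=; rewrite (ds_proj_in _ _ (ga_grM Ha Hx)) (ds_proj_in _ _ Hx).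
by rewrite (can_eq (addKr d)); case: eqP; rewrite ?ga_mul0r.
Qed.

Lemma ga_proj_mulr d f a x : ga_gr B d a ->
  ds_proj (ga_gr_direct B) (f + d) (x ** a) = ds_proj (ga_gr_direct B) f x ** a.
Proof.
move=> Ha; have lp n : linear (ds_proj (ga_gr_direct B) n) := ds_proj_linear _ n.
move: x; apply: (ds_ind (ga_gr_direct B)).
  split=> /=; first by rewrite !(lin0 (lp _), ga_mul0l).
  by move=> c u v /= Hu Hv; rewrite !(lp, ga_mulDl, ga_mulZl) Hu Hv.
move=> n x Hx /=; rewrite (ds_proj_in _ _ (ga_grM Hx Ha)) (ds_proj_in _ _ Hx).
by rewrite (can_eq (addrK d)); case: eqP; rewrite ?ga_mul0l.
Qed.

Definition two_sided (e f : B) : set B := [set e ** x ** f | x in setT].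

Lemma two_sided_submod e f : is_submod (two_sided e f).
Proof.
split; first by exists 0; rewrite // ga_mul0r ga_mul0l.
move=> c _ _ [u _ <-] [v _ <-]; exists (c *: u + v) => //.
by rewrite ga_mulDr ga_mulDl ga_mulZr ga_mulZl.
Qed.

Lemma two_sidedP e f x : e ** e = e -> f ** f = f -> two_sided e f x ->
  e ** x = x /\ x ** f = x.
Proof. by move=> ee ff [y _ <-]; rewrite !ga_mulA ee -!ga_mulA ff. Qed.

Lemma two_sided_in e f x : e ** x = x -> x ** f = x -> two_sided e f x.
Proof. by move=> ex xf; exists x; rewrite ?ex ?xf. Qed.

Lemma two_sided_proj e f d x : ga_gr B 0 e -> ga_gr B 0 f ->
  two_sided e f x -> two_sided e f (ds_proj (ga_gr_direct B) d x).
Proof.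
move=> He Hf [y _ <-]; exists (ds_proj (ga_gr_direct B) d y) => //.
by rewrite -(ga_proj_mull d y He) -(ga_proj_mulr _ _ Hf) add0r addr0.
Qed.

Variables (e : B) (ee : e ** e = e) (e0 : ga_gr B 0 e).

(** [eBe], with unit [e]. *)
Definition corner_sort : lmodType k := sub_mod (two_sided_submod e e).
Implicit Types x y z : corner_sort.

Let corP x : e ** val x = val x /\ val x ** e = val x.
Proof. exact: two_sidedP ee ee (sub_modP x). Qed.

Fact corner_mul_in x y : two_sided e e (val x ** val y).
Proof. by apply: two_sided_in; rewrite ?ga_mulA ?(corP x).1 // -ga_mulA (corP y).2. Qed.
Definition corner_mul x y : corner_sort := to_sub _ (corner_mul_in x y).
Fact corner_one_in : two_sided e e e. Proof. exact: two_sided_in. Qed.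
Definition corner_one (_ : unit) : corner_sort := to_sub _ corner_one_in.
Definition corner_gr d : set corner_sort := [set x | ga_gr B d (sub_val x)].

Fact corner_mul_linearr x : linear (corner_mul x).
Proof. by move=> c u v; apply: val_inj; apply: (ga_mul_linearr (val x)). Qed.
Fact corner_mul_linearl x : linear (corner_mul^~ x).
Proof. by move=> c u v; apply: val_inj; apply: (ga_mul_linearl (val x)). Qed.
Fact corner_mulA : associative corner_mul.
Proof. by move=> x y z; apply: val_inj; apply: ga_mulA. Qed.
Fact corner_1mul u x : corner_mul (corner_one u) x = x.
Proof. by apply: val_inj; apply: (corP x).1. Qed.
Fact corner_mul1 u x : corner_mul x (corner_one u) = x.
Proof. by apply: val_inj; apply: (corP x).2. Qed.
Fact corner_oneM i j : corner_mul (corner_one i) (corner_one j) =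
  if i == j then corner_one i else 0.
Proof. by rewrite corner_1mul; case: i; case: j. Qed.
Fact corner_one_homog i : exists d, corner_gr d (corner_one i).
Proof. by exists 0. Qed.
Fact corner_gr_direct : direct_sum corner_gr.
Proof.
apply: (sub_direct_sum (dG := ga_gr_direct B)) => d x.
exact: two_sided_proj.
Qed.
Fact corner_grM d n x y : corner_gr d x -> corner_gr n y ->
  corner_gr (d + n) (corner_mul x y).
Proof. exact: ga_grM. Qed.
Fact corner_peirce : direct_sum (fun p : unit * unit =>
  [set corner_mul (corner_mul (corner_one p.1) x) (corner_one p.2) | x in setT]).
Proof.
have im p : [set corner_mul (corner_mul (corner_one p.1) x) (corner_one p.2)
    | x in setT] = setT.
  apply/seteqP; split=> // x _; exists x => //.
  by rewrite corner_1mul corner_mul1.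
split=> [p|v|s f us _].
- by rewrite im.
- by exists [:: (tt, tt)], (fun=> v); split=> [p|]; rewrite ?im ?big_seq1.
- move=> sum0 p ps; move: sum0; rewrite (bigD1_seq p) //= big1 ?addr0 //.
Qed.

Definition corner : lu_galgebra k unit :=
  LUGAlgebra corner_mul_linearr corner_mul_linearl corner_mulA corner_oneM
    corner_one_homog corner_gr_direct corner_grM corner_peirce.

(** [Be], a left [B]- and right [eBe]-module. *)
Definition right_set : set B := [set x ** e | x in setT].

Lemma right_set_submod : is_submod right_set.
Proof.
split; first by exists 0; rewrite // ga_mul0l.
move=> c _ _ [u _ <-] [v _ <-]; exists (c *: u + v) => //.
by rewrite ga_mulDl ga_mulZl.
Qed.

Definition right_bimod : lmodType k := sub_mod right_set_submod.
Local Notation Be := right_bimod.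

Let BeP (m : Be) : val m ** e = val m.
Proof.
have [x _ E] := sub_modP m; have -> : val m = x ** e by exact: esym E.
by rewrite -ga_mulA ee.
Qed.

Fact right_ract_in (m : Be) (x : corner) : right_set (val m ** val (x : corner_sort)).
Proof. by exists (val m ** val x); rewrite // -ga_mulA (corP x).2. Qed.
Definition right_ract (m : Be) (x : corner) : Be := to_sub _ (right_ract_in m x).

Fact right_lact_in (a : B) (m : Be) : right_set (a ** val m).
Proof. by exists (a ** val m); rewrite // -ga_mulA BeP. Qed.
Definition right_lact (a : B) (m : Be) : Be := to_sub _ (right_lact_in a m).

Definition right_gr d : set Be := [set m | ga_gr B d (sub_val m)].

Fact right_gr_direct : direct_sum right_gr.
Proof.
apply: (sub_direct_sum (dG := ga_gr_direct B)) => d x [y _ <-].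
exists (ds_proj (ga_gr_direct B) d y) => //.
by rewrite -(ga_proj_mulr _ _ e0) addr0.
Qed.

Fact right_ractA (a : B) (m : Be) x :
  right_lact a (right_ract m x) = right_ract (right_lact a m) x.
Proof. by apply: val_inj; apply: ga_mulA. Qed.
Fact right_lactA (a b : B) (m : Be) :
  right_lact a (right_lact b m) = right_lact (a ** b) m.
Proof. by apply: val_inj; apply: ga_mulA. Qed.
Fact right_lact_linearr a : linear (right_lact a).
Proof. by move=> c u v; apply: val_inj; apply: (ga_mul_linearr a). Qed.
Fact right_lact_linearl m : linear (right_lact^~ m).
Proof. by move=> c u v; apply: val_inj; apply: (ga_mul_linearl (val m)). Qed.
Fact right_ract_linearr m : linear (right_ract m).
Proof. by move=> c u v; apply: val_inj; apply: (ga_mul_linearr (val m)). Qed.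
Fact right_ract_linearl x : linear (right_ract^~ x).
Proof. by move=> c u v; apply: val_inj; apply: (ga_mul_linearl (val (x : corner_sort))). Qed.

Section IndObject.
Variable V : gmodule corner.

(** [Be (x)_{eBe} V]; its degree [n] part is spanned by the [m (x) v] with
    [deg m + deg v = n]. *)
Definition ind_sort : lmodType k := tensor right_ract (gm_act V).
Local Notation "m (x) v" := (tens right_ract (gm_act V) m v : ind_sort)
  (at level 40, only parsing).

Definition ind_act (a : B) : ind_sort -> ind_sort :=
  tensor_lift (fun m v => right_lact a m (x) v).

Definition ind_gr (n : int) : set ind_sort :=
  spanned [set t | exists (d d' : int) (m : Be) (v : V),
    [/\ right_gr d m, gm_gr V d' v, d + d' = n & t = m (x) v]].

Let lift_l a v : linear ((fun m v => right_lact a m (x) v)^~ v).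
Proof. by move=> c m m' /=; rewrite right_lact_linearr tens_linearl. Qed.
Let lift_r a m : linear ((fun m v => right_lact a m (x) v) m).
Proof. by move=> c v v' /=; rewrite tens_linearr. Qed.
Let lift_b a m x v : right_lact a (right_ract m x) (x) v =
  right_lact a m (x) (gm_act V x v).
Proof. by rewrite right_ractA tens_bal. Qed.

Lemma ind_act_tens a m v : ind_act a (m (x) v) = right_lact a m (x) v.
Proof. exact: tensor_lift_tens (lift_l a) (lift_r a) (@lift_b a) _ _. Qed.

Fact ind_act_linearr a : linear (ind_act a).
Proof. exact: tensor_lift_linear (lift_l a) (lift_r a) (@lift_b a). Qed.

Fact ind_act_linearl t : linear (ind_act^~ t).
Proof.
move=> c a b; move: t; apply: tensor_ind.
  split=> [|y u v] /=; first by rewrite !(lin0 (ind_act_linearr _)) scaler0 addr0.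
  move=> Hu Hv; rewrite !ind_act_linearr Hu Hv !scalerDr !scalerA.
  by rewrite [y * c]mulrC addrACA.
by move=> m v /=; rewrite !ind_act_tens right_lact_linearl tens_linearl.
Qed.

Fact ind_actA a b t : ind_act a (ind_act b t) = ind_act (ga_mul B a b) t.
Proof.
move: t; apply: tensor_ind.
  split=> [|y u v] /=; first by rewrite !(lin0 (ind_act_linearr _)).
  by move=> Hu Hv; rewrite !ind_act_linearr Hu Hv.
by move=> m v /=; rewrite !ind_act_tens right_lactA.
Qed.

Fact ind_gr_direct : direct_sum ind_gr.
Proof.
have dR := right_gr_direct; have dV := gm_gr_direct V.
have dC := ga_gr_direct corner.
pose g n v d (m : Be) := m (x) ds_proj dV (n - d) v.
have Hg n v d : linear (g n v d) by move=> c u w; rewrite /g tens_linearl.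
pose phi n m v := ds_fold dR (g n v) m.
have phil n v : linear ((phi n)^~ v) by apply: ds_fold_linear.
have phir n m : linear (phi n m).
  move=> c u w; rewrite /phi /ds_fold scaler_sumr -big_split; apply: eq_bigr => d _.
  by rewrite /g ds_proj_linear tens_linearr.
have phiE n d d' m v : right_gr d m -> gm_gr V d' v ->
    phi n m v = if n == d + d' then m (x) v else 0.
  move=> Hm Hv; rewrite /phi (ds_fold_in _ (Hg n v) Hm) /g (ds_proj_in _ _ Hv).
  by rewrite subr_eq addrC; case: eqP; rewrite ?(lin0 (tens_linearr _ _ _)).
have phib n m x v : phi n (right_ract m x) v = phi n m (gm_act V x v).
  move: m; apply: (ds_ind dR) => [|d m Hm].
    split=> [|c u w] /=.
      by rewrite (lin0 (right_ract_linearl _)) !(lin0 (phil _ _)).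
    by move=> Hu Hw; rewrite right_ract_linearl !phil Hu Hw.
  move: x; apply: (ds_ind dC) => [|e' x Hx].
    split=> [|c u w] /=.
      by rewrite (lin0 (right_ract_linearr _)) (lin0 (gm_act_linearl _)) (lin0 (phil _ _))
         (lin0 (phir _ _)).
    by move=> Hu Hw; rewrite right_ract_linearr gm_act_linearl phil phir Hu Hw.
  move: v; apply: (ds_ind dV) => [|d' v Hv].
    split=> [|c u w] /=.
      by rewrite (lin0 (gm_act_linearr _)) !(lin0 (phir _ _)).
    by move=> Hu Hw; rewrite gm_act_linearr !phir Hu Hw.
  have Hmx : right_gr (d + e') (right_ract m x) by apply: ga_grM.
  by rewrite /= (phiE _ _ _ _ _ Hmx Hv) (phiE _ _ _ _ _ Hm (gm_grM Hx Hv)) addrA tens_bal.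
have subT n : is_submod (ind_gr n) by apply: is_submod_spanned.
have grT d d' m v : right_gr d m -> gm_gr V d' v -> ind_gr (d + d') (m (x) v).
  by move=> Hm Hv; apply: spanned_in; exists d, d', m, v.
have pl n := tensor_lift_linear (phil n) (phir n) (@phib n).
have pE n := tensor_lift_tens (phil n) (phir n) (@phib n).
apply: (@direct_sum_of_proj _ _ _ _ subT (fun n => tensor_lift (phi n))) => //.
- apply: tensor_ind; first exact: is_submod_sum_of.
  apply: (ds_ind dR) => [|d m Hm].
    split=> [v|c u w Hu Hw v] /=.
      by rewrite (lin0 (tens_linearl _ _ _)); case: (is_submod_sum_of subT).
    by rewrite tens_linearl; apply: (is_submod_sum_of subT).2.
  apply: (ds_ind dV) => [|d' v Hv].
    split=> [|c u w Hu Hw] /=.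
      by rewrite (lin0 (tens_linearr _ _ _)); case: (is_submod_sum_of subT).
    by rewrite tens_linearr; apply: (is_submod_sum_of subT).2.
  exact: sum_of_in (grT _ _ _ _ Hm Hv).
- move=> n; apply: spanned_sub.
    split=> [|c u w Hu Hw] /=; first by rewrite (lin0 (pl n)).
    by rewrite pl Hu Hw.
  by move=> _ [d [d' [m [v [Hm Hv <- ->]]]]] /=; rewrite pE (phiE _ _ _ _ _ Hm Hv) eqxx.
- move=> n' n v /negbTE nn; move: v; apply: spanned_sub.
    split=> [|c u w Hu Hw] /=; first by rewrite (lin0 (pl _)).
    by rewrite pl Hu Hw scaler0 addr0.
  by move=> _ [d [d' [m [v [Hm Hv dn ->]]]]] /=; rewrite pE (phiE _ _ _ _ _ Hm Hv) dn nn.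
Qed.

Fact ind_grM d n a t : ga_gr B d a -> ind_gr n t -> ind_gr (d + n) (ind_act a t).
Proof.
move=> Ha; move: t; apply: spanned_sub.
  have [g0 gl] := is_submod_spanned [set t | exists (d' d'' : int) (m : Be) (v : V),
    [/\ right_gr d' m, gm_gr V d'' v, d' + d'' = d + n & t = m (x) v]].
  split=> [|c u w Hu Hw] /=; first by rewrite (lin0 (ind_act_linearr _)).
  by rewrite ind_act_linearr; apply: gl.
move=> _ [d' [d'' [m [v [Hm Hv <- ->]]]]] /=; rewrite ind_act_tens.
apply: spanned_in; exists (d + d'), d'', (right_lact a m), v; split=> //.
  exact: ga_grM.
by rewrite addrA.
Qed.

Fact ind_peirce : direct_sum (fun i => [set ind_act (ga_one B i) t | t in setT]).
Proof.
apply: gm_peirce_of ind_act_linearr ind_act_linearl ind_actA _.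
have sub := gm_peirce_submod ind_act_linearr.
apply: tensor_ind; first exact: is_submod_sum_of.
move=> m v; have [s [us [sm _]]] := ga_local_unit (val m).
have -> : m = \sum_(i <- s) right_lact (ga_one B i) m.
  by rewrite -(lin_sum (right_lact_linearl m)); apply: val_inj; rewrite /= sm.
rewrite (lin_sum (tens_linearl _ _ _)); apply: decomposes_of => // i.
by exists (m (x) v) => //; rewrite ind_act_tens.
Qed.

Definition ind_ob : gmodule B :=
  GModule ind_act_linearr ind_act_linearl ind_actA ind_gr_direct ind_grM ind_peirce.

End IndObject.

Section IndMorphism.
Variables (V W : gmodule corner) (f : gmod_mor V W).
Local Notation tensV m v := (tens right_ract (gm_act V) m v : ind_ob V).
Local Notation tensW m v := (tens right_ract (gm_act W) m v : ind_ob W).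

Definition ind_mor_fun : ind_ob V -> ind_ob W :=
  tensor_lift (fun m v => tensW m (f v)).

Let lift_l v : linear ((fun m v => tensW m (f v))^~ v).
Proof. by move=> c m m' /=; rewrite tens_linearl. Qed.
Let lift_r m : linear ((fun m v => tensW m (f v)) m).
Proof. by move=> c v v' /=; have [lf _ _] := gh_homP f; rewrite lf tens_linearr. Qed.
Let lift_b m x v : tensW (right_ract m x) (f v) = tensW m (f (gm_act V x v)).
Proof. by have [_ af _] := gh_homP f; rewrite af tens_bal. Qed.

Lemma ind_mor_tens m v : ind_mor_fun (tensV m v) = tensW m (f v).
Proof. exact: tensor_lift_tens lift_l lift_r lift_b _ _. Qed.

Lemma ind_mor_linear : linear ind_mor_fun.
Proof. exact: tensor_lift_linear lift_l lift_r lift_b. Qed.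

Fact ind_mor_hom : gm_hom 0 ind_mor_fun.
Proof.
split; first exact: ind_mor_linear.
- move=> a; apply: tensor_ind => [|m v].
    split=> [|c u w Hu Hw].
      by rewrite /= !(lin0 (@ind_act_linearr _ a), lin0 ind_mor_linear).
    by rewrite /= !(ind_mor_linear, ind_act_linearr) Hu Hw.
  by rewrite /= ind_mor_tens !ind_act_tens -ind_mor_tens.
- move=> n; rewrite addr0; apply: spanned_sub.
    have [g0 gl] := gm_gr_submod (ind_ob W) n.
    split=> [|c u w Hu Hw] /=; first by rewrite (lin0 ind_mor_linear).
    by rewrite ind_mor_linear; apply: gl.
  move=> _ [d' [d'' [m [v [Hm Hv <- ->]]]]] /=; rewrite ind_mor_tens.
  apply: spanned_in; exists d', d'', m, (f v); split=> //.
  by have [_ _ /(_ _ _ Hv)] := gh_homP f; rewrite addr0.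
Qed.

Definition ind_mor : gmod_mor (ind_ob V) (ind_ob W) := GModMor ind_mor_hom.

End IndMorphism.

Lemma ind_mor_ext (V : gmodule corner) (W : gmodule B) (f g : ind_ob V -> W) :
  linear f -> linear g ->
  (forall m v, f (tens right_ract (gm_act V) m v) = g (tens right_ract (gm_act V) m v)) ->
  f =1 g.
Proof.
move=> lf lg fg; apply: tensor_ind => // ; split=> [|c u w Hu Hw] /=.
  by rewrite (lin0 lf) (lin0 lg).
by rewrite lf lg Hu Hw.
Qed.

Fact ind_id V : ind_mor (gmod_id V) = gmod_id (ind_ob V).
Proof.
apply: gmod_mor_ext; apply: ind_mor_ext; first exact: ind_mor_linear.
  by [].
by move=> m v; rewrite /= ind_mor_tens.
Qed.

Fact ind_comp U V W (g : gmod_mor V W) (f : gmod_mor U V) :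
  ind_mor (gmod_comp g f) = gmod_comp (ind_mor g) (ind_mor f).
Proof.
apply: gmod_mor_ext; apply: ind_mor_ext; first exact: ind_mor_linear.
  by move=> c u v /=; rewrite !ind_mor_linear.
by move=> m v; rewrite /= !ind_mor_tens.
Qed.

Fact ind_linear V W (c : k) (f g h : gmod_mor V W) :
  (forall v, h v = c *: f v + g v) ->
  forall t, ind_mor h t = c *: ind_mor f t + ind_mor g t.
Proof.
move=> Hh; apply: ind_mor_ext; first exact: ind_mor_linear.
  move=> d u v; rewrite /= !ind_mor_linear !scalerDr !scalerA [d * c]mulrC.
  by rewrite addrACA.
by move=> m v; rewrite /= !ind_mor_tens Hh tens_linearr.
Qed.

Definition induction : gmod_functor corner B := GModFunctor ind_id ind_comp ind_linear.

End Corner.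

Section ExternalDirectSum.
Variables (k : fieldType) (I : choiceType) (M : I -> lmodType k).

Definition finitely_supported (f : forall i, M i) :=
  exists s : seq I, forall i, i \notin s -> f i = 0.

Record ext_sum := ExtSum {
  ext_fun :> forall i, M i;
  ext_supported : finitely_supported ext_fun
}.
HB.instance Definition _ := gen_eqMixin ext_sum.
HB.instance Definition _ := gen_choiceMixin ext_sum.
Implicit Types f g h : ext_sum.

Lemma ext_sumP f g : (forall i, f i = g i) -> f = g.
Proof.
case: f g => [f Hf] [g Hg] /= fg.
have E : f = g by apply: functional_extensionality_dep.
by move: Hg; rewrite -E => Hg; congr ExtSum; apply: Prop_irrelevance.
Qed.

Fact ext_zero_supported : finitely_supported (fun i => 0 : M i).
Proof. by exists [::]. Qed.
Definition ext_zero := ExtSum ext_zero_supported.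

Fact ext_opp_supported f : finitely_supported (fun i => - f i).
Proof. by have [s Hs] := ext_supported f; exists s => i /Hs ->; rewrite oppr0. Qed.
Definition ext_opp f := ExtSum (ext_opp_supported f).

Fact ext_add_supported f g : finitely_supported (fun i => f i + g i).
Proof.
have [s Hs] := ext_supported f; have [t Ht] := ext_supported g.
by exists (s ++ t) => i; rewrite mem_cat negb_or => /andP[/Hs-> /Ht->]; rewrite addr0.
Qed.
Definition ext_add f g := ExtSum (ext_add_supported f g).

Fact ext_scale_supported c f : finitely_supported (fun i => c *: f i).
Proof. by have [s Hs] := ext_supported f; exists s => i /Hs ->; rewrite scaler0. Qed.
Definition ext_scale (c : k) f := ExtSum (ext_scale_supported c f).

Fact ext_addA : associative ext_add.
Proof. by move=> f g h; apply: ext_sumP => i /=; rewrite addrA. Qed.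
Fact ext_addC : commutative ext_add.
Proof. by move=> f g; apply: ext_sumP => i /=; rewrite addrC. Qed.
Fact ext_add0 : left_id ext_zero ext_add.
Proof. by move=> f; apply: ext_sumP => i /=; rewrite add0r. Qed.
Fact ext_addN : left_inverse ext_zero ext_opp ext_add.
Proof. by move=> f; apply: ext_sumP => i /=; rewrite addNr. Qed.
HB.instance Definition _ := GRing.isZmodule.Build ext_sum
  ext_addA ext_addC ext_add0 ext_addN.

Fact ext_scaleA a b f : ext_scale a (ext_scale b f) = ext_scale (a * b) f.
Proof. by apply: ext_sumP => i /=; rewrite scalerA. Qed.
Fact ext_scale1 f : ext_scale 1 f = f.
Proof. by apply: ext_sumP => i /=; rewrite scale1r. Qed.
Fact ext_scaleDr a f g : ext_scale a (f + g) = ext_scale a f + ext_scale a g.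
Proof. by apply: ext_sumP => i /=; rewrite scalerDr. Qed.
Fact ext_scaleDl f a b : ext_scale (a + b) f = ext_scale a f + ext_scale b f.
Proof. by apply: ext_sumP => i /=; rewrite scalerDl. Qed.
HB.instance Definition _ := GRing.Zmodule_isLmodule.Build k ext_sum
  ext_scaleA ext_scale1 ext_scaleDr ext_scaleDl.

Definition ext_eval i (f : ext_sum) : M i := f i.
Lemma ext_eval_linear i : linear (ext_eval i). Proof. by []. Qed.

End ExternalDirectSum.

Section HomSpaces.
Variables (k : fieldType) (I : choiceType) (A : lu_galgebra k I).
Variables (V W : gmodule A).

Lemma gm_hom_submod d : is_submod [set f : V -> W | gm_hom d f].
Proof.
split=> /=.
  split=> [c u v|a v|n v _] /=; rewrite ?scaler0 ?addr0 //.
    exact: esym (lin0 (gm_act_linearr a)).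
  by case: (gm_gr_submod W (n + d)).
move=> c f g [lf af gf] [lg ag gg]; split=> [d' u v|a v|n v Hv] /=.
- change (c *: f (d' *: u + v) + g (d' *: u + v) =
    d' *: (c *: f u + g u) + (c *: f v + g v)).
  by rewrite lf lg !scalerDr !scalerA [c * d']mulrC addrACA.
- change (c *: f (gm_act V a v) + g (gm_act V a v) = gm_act W a (c *: f v + g v)).
  by rewrite gm_act_linearr af ag.
- by apply: (gm_gr_submod W (n + d)).2; [apply: gf|apply: gg].
Qed.

(** [Hom_A(V, W)], the sum over [d] of the [Hom_A(V, W)_d]; it is direct, see
    [gm_hom_direct]. *)
Definition gm_Hom_set : set (V -> W) :=
  [set f | exists (s : seq int) (F : int -> V -> W),
    (forall d, gm_hom d (F d)) /\ f = \sum_(d <- s) F d].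

Lemma gm_Hom_setE : gm_Hom_set = sum_of (fun d => [set f : V -> W | gm_hom d f]).
Proof.
apply/seteqP; split=> f [s [F]]; last by move=> [_ HF _ ->]; exists s, F.
by move=> [HF ->]; apply: decomposes_of => //; apply: gm_hom_submod.
Qed.

Lemma gm_Hom_submod : is_submod gm_Hom_set.
Proof. by rewrite gm_Hom_setE; apply/is_submod_sum_of/gm_hom_submod. Qed.

Definition gm_Hom : lmodType k := sub_mod gm_Hom_submod.

Lemma gm_hom_Hom d f : gm_hom d f -> gm_Hom_set f.
Proof. by rewrite gm_Hom_setE => Hf; apply: (sum_of_in gm_hom_submod (j := d)). Qed.

Lemma gm_hom_direct : forall (s : seq int) (F : int -> V -> W), uniq s ->
  (forall d, gm_hom d (F d)) -> \sum_(d <- s) F d = 0 ->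
  forall d, d \in s -> F d = 0.
Proof.
move=> s F us HF sum0 d ds; apply/funext; apply: (ds_ind (gm_gr_direct V)).
  split=> [|c u v Hu Hv] /=; have [lF _ _] := HF d; first by rewrite (lin0 lF).
  by rewrite lF Hu Hv !scaler0 addr0.
move=> n v Hv /=; have [_ _ ind] := gm_gr_direct W.
have H1 m : gm_gr W m (F (m - n) v).
  by have [_ _ /(_ _ _ Hv)] := HF (m - n); rewrite addrC subrK.
have us' : uniq [seq n + e | e <- s] by rewrite map_inj_uniq // => x y /addrI.
have H2 : \sum_(m <- [seq n + e | e <- s]) F (m - n) v = 0.
  rewrite big_map; under eq_bigr => e _ do rewrite [n + e]addrC addrK.
  by have := congr1 (fun f => f v) sum0; rewrite fct_sumE.
have := ind _ _ us' H1 H2 (n + d); rewrite map_f // [n + d]addrC addrK.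
exact.
Qed.

End HomSpaces.

Section Coinduction.
Variables (k : fieldType) (I : choiceType) (B : lu_galgebra k I).
Local Notation "a ** b" := (ga_mul B a b) (at level 40, left associativity).
Variables (e : B) (ee : e ** e = e) (e0 : ga_gr B 0 e).
Local Notation one := (ga_one B).
Local Notation C := (corner ee e0).

Let oneI i : one i ** one i = one i. Proof. by rewrite ga_oneM eqxx. Qed.
Let corP (x : C) : e ** val (x : corner_sort e) = val (x : corner_sort e)
  /\ val (x : corner_sort e) ** e = val (x : corner_sort e).
Proof. exact: two_sidedP ee ee (sub_modP (x : corner_sort e)). Qed.

Section LeftModule.
Variable i : I.

(** [eB1_i], a graded left [eBe]-module. *)
Definition left_sort : lmodType k := sub_mod (two_sided_submod e (one i)).
Implicit Types m : left_sort.

Lemma leftP m : e ** val m = val m /\ val m ** one i = val m.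
Proof. exact: two_sidedP ee (oneI i) (sub_modP m). Qed.

Fact left_act_in (x : C) m : two_sided e (one i) (val (x : corner_sort e) ** val m).
Proof.
by apply: two_sided_in; rewrite ?ga_mulA ?(corP x).1 // -ga_mulA (leftP m).2.
Qed.
Definition left_act (x : C) m : left_sort := to_sub _ (left_act_in x m).
Definition left_gr d : set left_sort := [set m | ga_gr B d (sub_val m)].

Fact left_act_linearr x : linear (left_act x).
Proof. by move=> c u v; apply: val_inj; apply: (ga_mul_linearr (val (x : corner_sort e))). Qed.
Fact left_act_linearl m : linear (left_act^~ m).
Proof. by move=> c u v; apply: val_inj; apply: (ga_mul_linearl (val m)). Qed.
Fact left_actA x y m : left_act x (left_act y m) = left_act (ga_mul C x y) m.
Proof. by apply: val_inj; apply: ga_mulA. Qed.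
Fact left_gr_direct : direct_sum left_gr.
Proof.
apply: (sub_direct_sum (dG := ga_gr_direct B)) => d x.
by apply: two_sided_proj => //; apply: ga_one_gr0.
Qed.
Fact left_grM d n x m : ga_gr C d x -> left_gr n m -> left_gr (d + n) (left_act x m).
Proof. exact: (@ga_grM _ _ B d n). Qed.
Fact left_peirce : direct_sum (fun u => [set left_act (ga_one C u) m | m in setT]).
Proof.
apply: gm_peirce_of left_act_linearr left_act_linearl left_actA _ => m.
apply: (sum_of_in (gm_peirce_submod left_act_linearr) (j := tt)).
by exists m => //; apply: val_inj; apply: (leftP m).1.
Qed.
Definition left_module : gmodule C :=
  GModule left_act_linearr left_act_linearl left_actA left_gr_direct left_grM
    left_peirce.

End LeftModule.

(** Right multiplication by [1_i a 1_j], as a map from [eB1_i] to [eB1_j];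
    elements of [eB1_i] are fixed by right multiplication by [1_i]. *)
Fact right_mul_in i j (a : B) (m : left_module i) :
  two_sided e (one j) (val (m : left_sort i) ** a ** one j).
Proof.
by apply: two_sided_in; rewrite ?ga_mulA ?(leftP _).1 // -ga_mulA oneI.
Qed.
Definition right_mul i j (a : B) (m : left_module i) : left_module j :=
  to_sub _ (right_mul_in j a m).

Lemma right_mul_hom i j a d : ga_gr B d a -> gm_hom d (@right_mul i j a).
Proof.
move=> Ha; split.
- move=> c u v; apply: val_inj => /=.
  by rewrite (ga_mul_linearl a) (ga_mul_linearl (one j)).
- by move=> x v; apply: val_inj => /=; rewrite !ga_mulA.
- move=> n v Hv; rewrite -[_ + d]addr0.
  exact: (ga_grM (ga_grM (Hv : ga_gr B n _) Ha) (ga_one_gr0 B j)).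
Qed.

Lemma right_mul_linear i j m : linear (fun a => @right_mul i j a m).
Proof.
move=> c u v; apply: val_inj => /=.
by rewrite (ga_mul_linearr (val (m : left_sort i))) (ga_mul_linearl (one j)).
Qed.

Arguments right_mul_linear : clear implicits.

Section CoindObject.
Variable V : gmodule C.

(** [(+)_i Hom_{eBe}(eB1_i, V)]; [a] sends the family [f] to the family
    [m |-> sum_j f_j (m (1_i a 1_j))]. *)
Definition coind_sort : lmodType k := ext_sum (fun i => gm_Hom (left_module i) V).
Implicit Types (f : coind_sort) (a : B).
Local Notation ev f j := (val ((f : ext_sum _) j : sub_mod _)).

Definition coind_act_fun a f i (m : left_module i) : V :=
  \sum_(j \in [set: I]) ev f j (right_mul j a m).

Lemma ev_linear f j : linear (ev f j).
Proof.
have [s [F [HF E]]] := sub_modP ((f : ext_sum _) j : sub_mod _).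
have -> : ev f j = \sum_(d <- s) F d by exact: E.
move=> c u v; rewrite !fct_sumE scaler_sumr -big_split.
by apply: eq_bigr => d _ /=; have [-> _ _] := HF d.
Qed.

Arguments ev_linear : clear implicits.

Lemma coind_act_funE a f i s (m : left_module i) : uniq s ->
  (forall j, j \notin s -> (f : ext_sum _) j = 0) ->
  coind_act_fun a f m = \sum_(j <- s) ev f j (right_mul j a m).
Proof.
move=> us f0; rewrite /coind_act_fun (fsbigE s _ us) // => [|j /= _ js].
  by rewrite big_mkcond; apply: eq_bigr => j _; rewrite in_setT.
by rewrite f0.
Qed.

Lemma ext_supp f : exists s : seq I, uniq s /\ forall j, j \notin s -> (f : ext_sum _) j = 0.
Proof.
have [s Hs] := ext_supported (f : ext_sum _).
by exists (undup s); rewrite undup_uniq; split=> // j; rewrite mem_undup; apply: Hs.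
Qed.

Lemma coind_act_fun_linear f i (m : left_module i) :
  linear (fun a => coind_act_fun a f m).
Proof.
have [s [us f0]] := ext_supp f; move=> c a b.
rewrite !(coind_act_funE _ _ us f0) scaler_sumr -big_split.
by apply: eq_bigr => j _ /=; rewrite right_mul_linear ev_linear.
Qed.

Fact coind_act_fun_in a f i : gm_Hom_set (coind_act_fun a f (i := i)).
Proof.
have [s [us f0]] := ext_supp f.
have -> : coind_act_fun a f (i := i) = \sum_(j <- s) (ev f j \o right_mul j a).
  by apply/funext => m; rewrite fct_sumE (coind_act_funE _ _ us f0).
have sH := @gm_Hom_submod _ _ _ (left_module i) V.
apply: is_submod_sum => // j _.
move: a; apply: (ds_ind (ga_gr_direct B)) => [|d a Ha].
  split=> [|c u v Hu Hv] /=.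
    rewrite (_ : _ \o _ = 0); first by case: sH.
    by apply/funext => m /=; rewrite (lin0 (right_mul_linear _ _ _)) (lin0 (ev_linear _ _)).
  rewrite (_ : _ \o _ = c *: (ev f j \o right_mul j u) + (ev f j \o right_mul j v)).
    exact: sH.2.
  by apply/funext => m /=; rewrite right_mul_linear ev_linear.
have [t [F [HF E]]] := sub_modP ((f : ext_sum _) j : sub_mod _).
have -> : ev f j = \sum_(d <- t) F d by exact: E.
rewrite (_ : _ \o _ = \sum_(d' <- t) (F d' \o right_mul j a)).
  apply: is_submod_sum => // d' _.
  exact: (gm_hom_Hom (gm_hom_comp (right_mul_hom i j Ha) (HF d'))).
by apply/funext => m /=; rewrite !fct_sumE.
Qed.

Fact coind_act_supported a f : finitely_supported (fun i =>
  (to_sub _ (coind_act_fun_in a f i) : gm_Hom (left_module i) V)).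
Proof.
have [s [us [sa _]]] := ga_local_unit a; exists s => i is_.
have [t [ut f0]] := ext_supp f.
apply: val_inj; apply/funext => m /=; rewrite (coind_act_funE _ _ ut f0).
apply: big1 => j _; rewrite (_ : right_mul j a m = 0) ?(lin0 (ev_linear _ _)) //.
apply: val_inj => /=; rewrite -(leftP m).2 -[_ ** one i ** a]ga_mulA.
rewrite -sa [one i ** _]ga_mulA ga_mul_sumr big_seq big1 => [|l ls].
  by rewrite !(ga_mul0l, ga_mul0r).
by rewrite ga_oneM; case: eqP => // il; rewrite il ls in is_.
Qed.

Definition coind_act a f : coind_sort := ExtSum (coind_act_supported a f).

Lemma coind_actE a f i (m : left_module i) :
  ev (coind_act a f) i m = coind_act_fun a f m.
Proof. by []. Qed.

Lemma coind_ext f g : (forall i m, ev f i m = ev g i m) -> f = g.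
Proof. by move=> fg; apply: ext_sumP => i; apply: val_inj; apply/funext => m; apply: fg. Qed.

Definition coind_gr d : set coind_sort := [set f | forall i, gm_hom d (ev f i)].

Fact coind_act_linearl f : linear (coind_act^~ f).
Proof. by move=> c a b; apply: coind_ext => i m; apply: coind_act_fun_linear. Qed.

Fact coind_act_linearr a : linear (coind_act a).
Proof.
move=> c f g; apply: coind_ext => i m.
have [s [us f0]] := ext_supp f; have [t [ut g0]] := ext_supp g.
set r := undup (s ++ t); have ur : uniq r by apply: undup_uniq.
have f0' j : j \notin r -> (f : ext_sum _) j = 0.
  by rewrite mem_undup mem_cat negb_or => /andP[/f0].
have g0' j : j \notin r -> (g : ext_sum _) j = 0.
  by rewrite mem_undup mem_cat negb_or => /andP[_ /g0].
have h0 j : j \notin r -> ((c *: f + g : coind_sort) : ext_sum _) j = 0.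
  move=> jr; change (c *: (f : ext_sum _) j + (g : ext_sum _) j = 0).
  by rewrite f0' // g0' // scaler0 addr0.
rewrite coind_actE (coind_act_funE _ _ ur h0).
change (\sum_(j <- r) (c *: ev f j (right_mul j a m) + ev g j (right_mul j a m)) =
  c *: coind_act_fun a f m + coind_act_fun a g m).
by rewrite (coind_act_funE _ _ ur f0') (coind_act_funE _ _ ur g0') scaler_sumr -big_split.
Qed.

Fact coind_actA a b f : coind_act a (coind_act b f) = coind_act (a ** b) f.
Proof.
apply: coind_ext => i m; rewrite !coind_actE.
have [s [us f0]] := ext_supp f; have [t [ut [tb _]]] := ga_local_unit b.
have [r [ur g0]] := ext_supp (coind_act b f).
set q := undup (t ++ r); have uq : uniq q by apply: undup_uniq.
have g0' j : j \notin q -> (coind_act b f : ext_sum _) j = 0.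
  by rewrite mem_undup mem_cat negb_or => /andP[_ /g0].
have qb : (\sum_(l <- q) one l) ** b = b.
  rewrite -{1}tb ga_mulA -[RHS]tb; congr (_ ** _).
  rewrite ga_mul_sumr; apply: eq_big_seq => l lt.
  rewrite ga_mul_suml (bigD1_seq l) //=; last by rewrite mem_undup mem_cat lt.
  by rewrite oneI big1 ?addr0 // => j /negbTE jl; rewrite ga_oneM jl.
rewrite (coind_act_funE _ _ uq g0') (coind_act_funE _ _ us f0).
under eq_bigr => l _ do rewrite coind_actE (coind_act_funE _ _ us f0).
rewrite exchange_big; apply: eq_bigr => j _ /=.
rewrite -(lin_sum (ev_linear f j)); congr (ev f j _).
apply: val_inj; rewrite (lin_sum (f := val)) //=.
rewrite -{2}qb ga_mulA ga_mul_suml !ga_mul_sumr !ga_mul_suml.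
by apply: eq_bigr => l _; rewrite !ga_mulA.
Qed.

Fact coind_gr_submod d : is_submod (coind_gr d).
Proof.
split=> [i|c f g Hf Hg i]; have [h0 hl] := gm_hom_submod (left_module i) V d.
  exact: h0.
exact: (hl c _ _ (Hf i) (Hg i)).
Qed.

Lemma ev_lin i : linear (fun f : coind_sort => ev f i). Proof. by []. Qed.

Fact coind_gr_direct : direct_sum coind_gr.
Proof.
split; first exact: coind_gr_submod.
- move=> f; have [t [ut f0]] := ext_supp f.
  have H i : sum_of (fun d => [set h : left_module i -> V | gm_hom d h]) (ev f i).
    by rewrite -gm_Hom_setE; apply: sub_modP.
  pose s i := sval (cid (H i)); pose F i := sval (cid (svalP (cid (H i)))).
  have HF i : decomposes (fun d => [set h : left_module i -> V | gm_hom d h])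
      (ev f i) (s i) (F i) := svalP (cid (svalP (cid (H i)))).
  have HFd i d : gm_hom d (F i d) by have [_ + _ _] := HF i; apply.
  pose G d i : gm_Hom (left_module i) V :=
    if i \in t then to_sub _ (gm_hom_Hom (HFd i d)) else 0.
  have supG d : finitely_supported (G d).
    by exists t => i; rewrite /G => /negbTE ->.
  pose S := undup (flatten [seq s i | i <- t]).
  exists S, (fun d => ExtSum (supG d)); split.
    move=> d i /=; rewrite /G; case: ifP => _ //=.
    by case: (gm_hom_submod (left_module i) V d).
  apply: ext_sumP => i; apply: val_inj.
  rewrite [RHS](lin_sum (ev_lin i)) /= /G; have [it|it] := boolP (i \in t); last first.
    by rewrite big1 // f0.
  have [us _ F0 E] := HF i; rewrite [LHS]E; apply/esym/sum_widen => //.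
    exact: undup_uniq.
  move=> d ds; rewrite mem_undup; apply/flatten_mapP; exists i => //.
- move=> s F us HF sum0 d ds; apply: coind_ext => i m.
  have := congr1 (fun f : coind_sort => ev f i) sum0.
  rewrite (lin_sum (ev_lin i)) => /(gm_hom_direct us (fun d => HF d i))/(_ d ds).
  by move=> /(congr1 (fun h => h m)).
Qed.

Fact coind_grM d n a f : ga_gr B d a -> coind_gr n f -> coind_gr (d + n) (coind_act a f).
Proof.
move=> Ha Hf i; have [s [us f0]] := ext_supp f.
have -> : ev (coind_act a f) i = \sum_(j <- s) (ev f j \o right_mul j a).
  by apply/funext => m; rewrite fct_sumE coind_actE (coind_act_funE _ _ us f0).
apply: (is_submod_sum (gm_hom_submod (left_module i) V (d + n))) => j _.
exact: (gm_hom_comp (right_mul_hom i j Ha) (Hf j)).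
Qed.

Fact coind_peirce : direct_sum (fun i => [set coind_act (one i) f | f in setT]).
Proof.
apply: gm_peirce_of coind_act_linearr coind_act_linearl coind_actA _ => f.
have [s [us f0]] := ext_supp f.
have -> : f = \sum_(i <- s) coind_act (one i) f.
  apply: ext_sumP => i; apply: val_inj; apply/funext => m.
  rewrite [in RHS](lin_sum (ev_lin i)) /= fct_sumE.
  have E l : ev (coind_act (one l) f) i m = if l == i then ev f i m else 0.
    rewrite coind_actE (coind_act_funE _ _ us f0).
    have rE j : right_mul j (one l) m = if (l == i) && (l == j) then right_mul j (one j) m else 0.
      apply: val_inj => /=; rewrite -{1}(leftP m).2 -2!ga_mulA ga_oneM.
      case: (eqVneq l j) => [->|_]; last by rewrite andbF !ga_mul0r.
      rewrite andbT ga_oneM [j == i]eq_sym; case: eqP => [ij|_]; last by rewrite ga_mul0r.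
      by rewrite /= -ga_mulA oneI; congr (_ ** _); rewrite ij.
    case: (eqVneq l i) => [li|li]; last first.
      by apply: big1 => j _; rewrite rE (negbTE li) (lin0 (ev_linear _ _)).
    subst l.
    have r1 : right_mul i (one i) m = m by apply: val_inj; rewrite /= !(leftP m).2.
    have [is_|is_] := boolP (i \in s).
      rewrite (bigD1_seq i) //= r1 big1 ?addr0 // => j ji.
      by rewrite rE [i == j]eq_sym (negbTE ji) andbF (lin0 (ev_linear _ _)).
    rewrite f0 // big_seq big1 // => j js; rewrite rE eqxx /=.
    by case: eqP => [ij|_]; [rewrite ij js in is_|rewrite (lin0 (ev_linear _ _))].
  rewrite (eq_bigr _ (fun l _ => E l)) -big_mkcond /=.
  have [is_|is_] := boolP (i \in s).
    by rewrite -big_filter (perm_big [:: i]) ?big_seq1 //=; apply: uniq_perm;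
      rewrite ?filter_uniq // => l; rewrite mem_filter inE; case: eqP => [->|].
  by rewrite f0 // big1.
apply: decomposes_of => [|i]; first exact: gm_peirce_submod coind_act_linearr.
by exists f.
Qed.

Definition coind_ob : gmodule B :=
  GModule coind_act_linearr coind_act_linearl coind_actA coind_gr_direct
    coind_grM coind_peirce.

End CoindObject.

Section CoindMorphism.
Variables (V W : gmodule C) (g : gmod_mor V W).
Local Notation ev f j := (val ((f : ext_sum _) j : sub_mod _)).

Fact coind_mor_in (f : coind_ob V) i : gm_Hom_set (g \o ev (f : coind_sort V) i).
Proof.
have [lg _ _] := gh_homP g.
have [s [F [HF E]]] := sub_modP ((f : ext_sum _) i : sub_mod _).
have -> : ev (f : coind_sort V) i = \sum_(d <- s) F d by exact: E.
exists s, (fun d => g \o F d); split.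
  by move=> d; have := gm_hom_comp (HF d) (gh_homP g); rewrite addr0.
by apply/funext => m /=; rewrite !fct_sumE (lin_sum lg).
Qed.

Fact coind_mor_supported (f : coind_ob V) : finitely_supported (fun i =>
  (to_sub _ (coind_mor_in f i) : gm_Hom (left_module i) W)).
Proof.
have [lg _ _] := gh_homP g; have [s [us f0]] := ext_supp f.
exists s => i is_; apply: val_inj; apply/funext => m /=.
by rewrite f0 // (lin0 lg).
Qed.

Definition coind_mor_fun (f : coind_ob V) : coind_ob W := ExtSum (coind_mor_supported f).

Fact coind_mor_hom : gm_hom 0 coind_mor_fun.
Proof.
have [lg _ _] := gh_homP g; split.
- by move=> c f h; apply: coind_ext => i m; apply: lg.
- move=> a f; apply: coind_ext => i m; have [s [us f0]] := ext_supp f.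
  have h0 j : j \notin s -> (coind_mor_fun f : ext_sum _) j = 0.
    by move=> js; apply: val_inj; apply/funext => x /=; rewrite f0 // (lin0 lg).
  rewrite [RHS]coind_actE (coind_act_funE _ _ us h0).
  by rewrite /= [coind_act_fun _ _ _](coind_act_funE _ _ us f0) (lin_sum lg).
- move=> n f Hf i; exact: (gm_hom_comp (Hf i) (gh_homP g)).
Qed.

Definition coind_mor : gmod_mor (coind_ob V) (coind_ob W) := GModMor coind_mor_hom.

End CoindMorphism.

Fact coind_id V : coind_mor (gmod_id V) = gmod_id (coind_ob V).
Proof. by apply: gmod_mor_ext => f; apply: coind_ext. Qed.

Fact coind_comp U V W (g : gmod_mor V W) (f : gmod_mor U V) :
  coind_mor (gmod_comp g f) = gmod_comp (coind_mor g) (coind_mor f).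
Proof. by apply: gmod_mor_ext => h; apply: coind_ext. Qed.

Fact coind_linear V W (c : k) (f g h : gmod_mor V W) :
  (forall v, h v = c *: f v + g v) ->
  forall t, coind_mor h t = c *: coind_mor f t + coind_mor g t.
Proof. by move=> Hh t; apply: coind_ext => i m; apply: Hh. Qed.

Definition coinduction : gmod_functor C B := GModFunctor coind_id coind_comp coind_linear.

End Coinduction.

(** The family [v], indexed by the set [T], is a basis of [V]. *)
Definition is_basis (k : fieldType) (V : lmodType k) (J : choiceType)
    (T : set J) (v : J -> V) :=
  (forall w, exists (s : seq J) (c : J -> k),
    (forall p, p \in s -> T p) /\ w = \sum_(p <- s) c p *: v p) /\
  (forall (s : seq J) (c : J -> k), uniq s -> (forall p, p \in s -> T p) ->
    \sum_(p <- s) c p *: v p = 0 -> forall p, p \in s -> c p = 0).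

Section TriangularBasis.
Variables (k : fieldType) (I : choiceType) (A : lu_galgebra k I).
Variables (disp : Order.disp_t) (L : porderType disp).
Local Notation "a ** b" := (ga_mul A a b) (at level 40, left associativity).
Local Notation one := (ga_one A).

Definition homogeneous (x : A) := exists d, ga_gr A d x.

(** The functions [tb_wt], [tb_X], [tb_H] and [tb_Y] are total, but only their
    values at special indices (the elements of [tb_S]) are ever used: [tb_X i s]
    for [s] in [tb_S], [tb_H s t] for [s], [t] in [tb_S], [tb_Y t j] for [t] in
    [tb_S], and [tb_wt s] for [s] in [tb_S]. *)
Record triangular_basis := TriangularBasis {
  tb_S : set I;
  tb_wt : I -> L;
  tb_X : I -> I -> set A;
  tb_H : I -> I -> set A;
  tb_Y : I -> I -> set A;
  tb_lower_finite : forall l : L, finite_set [set m : L | (m <= l)%O];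
  tb_fiber_finite : forall l : L, finite_set [set s | tb_S s /\ tb_wt s = l];
  tb_X_in : forall i s x, tb_S s -> tb_X i s x ->
    two_sided (one i) (one s) x /\ homogeneous x;
  tb_H_in : forall s t h, tb_S s -> tb_S t -> tb_H s t h ->
    two_sided (one s) (one t) h /\ homogeneous h;
  tb_Y_in : forall t j y, tb_S t -> tb_Y t j y ->
    two_sided (one t) (one j) y /\ homogeneous y;
  tb_basis : is_basis
    [set p : A * A * A | exists s t, [/\ tb_S s, tb_S t,
       exists i, tb_X i s p.1.1, tb_H s t p.1.2 & exists j, tb_Y t j p.2]]
    (fun p : A * A * A => p.1.1 ** p.1.2 ** p.2);
  tb_diag : forall s, tb_S s ->
    tb_X s s = [set one s] /\ tb_Y s s = [set one s];
  tb_X_lt : forall s t, tb_S s -> tb_S t -> s != t ->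
    tb_X s t !=set0 -> (tb_wt t < tb_wt s)%O;
  tb_H_eq : forall s t, tb_S s -> tb_S t -> s != t ->
    tb_H s t !=set0 -> tb_wt s = tb_wt t;
  tb_Y_lt : forall s t, tb_S s -> tb_S t -> s != t ->
    tb_Y s t !=set0 -> (tb_wt s < tb_wt t)%O;
  tb_X_finite : forall i, ~ tb_S i ->
    finite_set [set s | tb_S s /\ tb_X i s !=set0];
  tb_Y_finite : forall i, ~ tb_S i ->
    finite_set [set s | tb_S s /\ tb_Y s i !=set0]
}.

Variables (T : triangular_basis) (l : L).

(** [e_m]; the sum is finite by [tb_fiber_finite]. *)
Definition weight_idem (m : L) : A :=
  \sum_(s \in [set s | tb_S T s /\ tb_wt T s = m]) one s.

Lemma weight_idemE m : weight_idem m =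
  \sum_(s <- fset_set [set s | tb_S T s /\ tb_wt T s = m]) one s.
Proof. exact: fsbig_finite (tb_fiber_finite T m). Qed.

Lemma weight_idem_gr0 m : ga_gr A 0 (weight_idem m).
Proof.
rewrite weight_idemE; apply: is_submod_sum => [|s _]; first exact: ga_gr_submod.
exact: ga_one_gr0.
Qed.

Lemma weight_idemK m : weight_idem m ** weight_idem m = weight_idem m.
Proof.
rewrite weight_idemE ga_mul_suml; apply: eq_big_seq => s Hs.
rewrite ga_mul_sumr (bigD1_seq s) //= ga_oneM eqxx big1 ?addr0 // => t.
by rewrite ga_oneM eq_sym => /negbTE ->.
Qed.

Definition truncation_gens : set A :=
  [set weight_idem m | m in [set m | ~~ (l <= m)%O]].

Lemma truncation_gens_homogeneous x : truncation_gens x -> homogeneous x.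
Proof. by case=> m _ <-; exists 0; apply: weight_idem_gr0. Qed.

(** [A_{>= l}] *)
Definition truncation : lu_galgebra k I := quot_alg truncation_gens_homogeneous.

Definition truncation_idem : truncation :=
  quot_alg_pi truncation_gens_homogeneous (weight_idem l).

Lemma truncation_idemK :
  ga_mul truncation truncation_idem truncation_idem = truncation_idem.
Proof. by rewrite [LHS]quot_alg_piM weight_idemK. Qed.

Lemma truncation_idem_gr0 : ga_gr truncation 0 truncation_idem.
Proof. by exists (weight_idem l) => //; apply: weight_idem_gr0. Qed.

(** [A_l], the corner of [A_{>= l}] at the image of [e_l] *)
Definition weight_algebra : lu_galgebra k unit :=
  corner truncation_idemK truncation_idem_gr0.

(** [j^l_!] and [j^l_*] *)
Definition standardization : gmod_functor weight_algebra truncation :=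
  induction truncation_idemK truncation_idem_gr0.

Definition costandardization : gmod_functor weight_algebra truncation :=
  coinduction truncation_idemK truncation_idem_gr0.

End TriangularBasis.

(* Main.v *)
Require Import Defs.
From mathcomp Require Import all_boot all_order all_algebra.
From mathcomp Require Import finmap all_classical.
From mathcomp Require Import zify.

(** Let [B] be the truncation of [A] at the weights above [l], [e] the image of [e_l]
    in [B], and [C = eBe]. Induction from [C] to [B] is [Be (x)_C -] and coinduction
    is the sum over [i] of the [Hom_C(eB1_i, -)]. They are exact because [Be] is a
    projective right [C]-module and each [eB1_i] is a graded projective left
    [C]-module.

    Projectivity comes from the triangular basis. The truncation ideal of [A] is
    spanned by the basis elements [x h y] whose weight, the common weight of the two
    ends of [h], is not above [l] ([truncation_ideal_low]). Hence the images of the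
    other basis elements form a basis of [B]. Such an element in [Be] ends at an
    idempotent of weight [l], which forces [y] to be an idempotent; so [Be] has a
    basis of products [x h] with both ends of [h] of weight [l], while the [h] alone
    form a basis of [C]. Therefore [Be] is the direct sum of submodules [x C], each
    isomorphic to a direct summand [1_s C] of [C]. This is expressed by a dual basis:
    elements [b_j] of [Be] and [C]-linear coordinates [f_j] with [m = sum_j b_j f_j(m)]
    ([dual_system], [std_dual_system]). The case of [eB] follows by passing to the
    opposite algebra ([costd_dual_system]).

    With a dual basis, an element of [Be (x) V] is [sum_j b_j (x) t_j] for natural
    coordinates [t_j] in [V], from which exactness is read off ([induction_exact]).
    A map from [eB1_i] lifts along a surjection by lifting the images of the
    generators, in their degrees ([coinduction_exact]).

    The finiteness statements use only that [B] inherits finite-dimensional components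
    bounded below from [A] and that [e] is a finite sum of the [1_s]. Then [1_i B e]
    and [eB1_i] have finite-dimensional homogeneous components and are bounded below.
    A tensor of degree [n] involves finitely many pairs of degrees when [V] is bounded
    below, and a homomorphism of degree [n] into [V] is determined on finitely many
    degrees when [V] is bounded above. *)

Set Implicit Arguments.
Unset Strict Implicit.
Unset Printing Implicit Defensive.

Import Order.TTheory GRing.Theory.
Local Open Scope classical_set_scope.
Local Open Scope ring_scope.

(** * Finite-dimensional subspaces and linear extension *)

Section FiniteSpans.
Variable k : fieldType.
Implicit Types V W : lmodType k.

Lemma spanned_mono V (G G' : set V) : G `<=` G' -> spanned G `<=` spanned G'.
Proof.
move=> GG; apply: spanned_sub; first exact: is_submod_spanned.
by move=> x /GG Gx; refine (spanned_in _).
Qed.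

Lemma spanned_linear V W (f : V -> W) (G : set V) (N : set W) v :
  linear f -> is_submod N -> (forall x, G x -> N (f x)) ->
  spanned G v -> N (f v).
Proof.
move=> lf sN GN; apply: (@spanned_sub _ _ G [set x | N (f x)]) => //.
split=> [|c x y /= Nx Ny]; first by rewrite /= (lin0 lf); case: sN.
by rewrite lf; apply: sN.2.
Qed.

Lemma is_submod0 V : is_submod [set 0 : V].
Proof. by split=> // c u v -> ->; rewrite /= scaler0 addr0. Qed.

Lemma is_submod_image V W (f : V -> W) (N : set V) :
  linear f -> is_submod N -> is_submod [set f x | x in N].
Proof.
move=> lf sN; split; first by exists 0; rewrite ?(lin0 lf) //; case: sN.
move=> c _ _ [x Nx <-] [y Ny <-]; exists (c *: x + y); last by rewrite lf.
exact: sN.2.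
Qed.

Lemma is_submod_ker V W (f : V -> W) (N : set V) :
  linear f -> is_submod N -> is_submod (N `&` [set x | f x = 0]).
Proof.
move=> lf sN; split; first by split; [case: sN | apply: lin0].
move=> c u v [Nu fu] [Nv fv]; split; first exact: sN.2.
by rewrite /= lf fu fv scaler0 addr0.
Qed.

Lemma spanned_cons V (x : V) (s : seq V) v : spanned [set` x :: s] v ->
  exists c, spanned [set` s] (v - c *: x).
Proof.
have sS := is_submod_spanned [set` s].
apply: (@spanned_sub _ _ _ [set v | exists c, spanned [set` s] (v - c *: x)]).
  split; first by exists 0; rewrite scale0r subr0; case: sS.
  move=> a u w [c Hu] [d Hw]; exists (a * c + d).
  by rewrite scalerDl opprD addrACA -scalerA -scalerBr; apply: sS.2.
move=> y /=; rewrite inE => /orP[/eqP->|ys].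
  by exists 1; rewrite scale1r subrr; case: sS.
by exists 0; rewrite scale0r subr0; refine (spanned_in _).
Qed.

Lemma spanned_nil V (v : V) : spanned [set` [::]] v -> v = 0.
Proof. by move=> Hv; apply: (spanned_sub (@is_submod0 V) _ Hv). Qed.

Lemma spanned_seqE V (s : seq V) v : spanned [set` s] v ->
  exists c : 'I_(size s) -> k, v = \sum_(i < size s) c i *: s`_i.
Proof.
elim: s v => [v /spanned_nil ->|x s IHs v /spanned_cons[a /IHs[c E]]].
  by exists (fun=> 0); rewrite big_ord0.
exists (fun i => if unlift ord0 i is Some j then c j else a).
rewrite big_ord_recl unlift_none /=.
under eq_bigr => i _ do rewrite liftK.
by rewrite -E addrC subrK.
Qed.

(** Lists replace families indexed by ordinals: they can be concatenated, mapped and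
    recursed upon. *)
Lemma fin_dim_of_seq V (N : set V) (s : seq V) :
  [set` s] `<=` N -> N `<=` spanned [set` s] -> fin_dim N.
Proof.
move=> sN Ns; exists (size s), (fun i : 'I_(size s) => s`_i); split.
  by move=> i; apply: sN; apply: mem_nth.
by move=> v /Ns/spanned_seqE.
Qed.

Lemma fin_dim_seq V (N : set V) : fin_dim N ->
  exists s : seq V, [set` s] `<=` N /\ N `<=` spanned [set` s].
Proof.
move=> [n [b [Nb Nspan]]]; exists [seq b i | i <- enum 'I_n]; split.
  by move=> _ /= /mapP[i _ ->].
move=> v /Nspan[c ->]; apply: (is_submod_sum (is_submod_spanned _)).
move=> i _; apply: (is_submodZ _ (is_submod_spanned _)).
by refine (spanned_in _); rewrite /= map_f ?mem_enum.
Qed.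

(** A subspace of a finitely spanned space is finite-dimensional. By induction on the
    list: the members of [N] with zero coefficient at the head [x] are covered by
    the tail, and one member with nonzero coefficient there is enough to generate
    the rest of [N]. *)
Lemma fin_dim_sub V (N : set V) (s : seq V) :
  is_submod N -> N `<=` spanned [set` s] -> fin_dim N.
Proof.
elim: s N => [|x s IHs] N sN Ns.
  by apply: (@fin_dim_of_seq _ _ [::]).
have sS := is_submod_spanned [set` s].
have [[v0 [c0 [Nv0 c0_neq0 Sv0]]]|noc] := pselect (exists v0 c0,
    [/\ N v0, c0 != 0 & spanned [set` s] (v0 - c0 *: x)]); last first.
  apply: IHs => // v Nv; have [c Hc] := spanned_cons (Ns _ Nv).
  have [c0|c0] := eqVneq c 0; first by move: Hc; rewrite c0 scale0r subr0.
  by case: noc; exists v, c.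
have /fin_dim_seq[t [tN Nt]] : fin_dim (N `&` spanned [set` s]).
  apply: IHs => [|v []//]; split; first by split; [case: sN | case: sS].
  by move=> c u v [Nu Su] [Nv Sv]; split; [apply: sN.2 | apply: sS.2].
have sT := is_submod_spanned [set` v0 :: t].
apply: (@fin_dim_of_seq _ _ (v0 :: t)) => [y /=|v Nv].
  by rewrite inE => /orP[/eqP->//|/tN[]].
have [c Hc] := spanned_cons (Ns _ Nv).
rewrite -[v](subrK ((c / c0) *: v0)); apply: (is_submodD sT); last first.
  by apply: (is_submodZ _ sT); refine (spanned_in _); rewrite /= mem_head.
apply: (@spanned_mono _ [set` t]).
  by move=> y /= yt; rewrite inE yt orbT.
refine (Nt _ _); split; first by apply: is_submodB => //; apply: is_submodZ.
have -> : v - (c / c0) *: v0 = - (c / c0) *: (v0 - c0 *: x) + (v - c *: x).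
  rewrite scalerBr !scaleNr opprK scalerA divfK //.
  by rewrite [RHS]addrC addrA addrAC subrK.
exact: sS.2.
Qed.

Lemma fin_dim_ext V W (N : set V) (f : V -> W) (M : set W) :
  is_submod N -> linear f -> fin_dim M -> (forall v, N v -> M (f v)) ->
  fin_dim (N `&` [set v | f v = 0]) -> fin_dim N.
Proof.
move=> sN lf /fin_dim_seq[sM [_ Ms]] NM /fin_dim_seq[r [rN Nr]].
have /fin_dim_seq[t [tN Nt]] : fin_dim [set f v | v in N].
  apply: (@fin_dim_sub _ _ sM); first exact: is_submod_image.
  by move=> _ [v Nv <-]; refine (Ms _ (NM _ Nv)).
have [u [uN ut]] : exists u : seq V, [set` u] `<=` N /\ [seq f v | v <- u] = t.
  elim: t tN {Nt} => [|y t IHt] tN; first by exists [::].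
  have [v Nv fv] : [set f v | v in N] y by apply: tN; rewrite /= mem_head.
  have [z /= zt|u [uN ut]] := IHt; first by apply: tN; rewrite /= inE zt orbT.
  exists (v :: u); rewrite /= fv ut; split=> // z /=.
  by rewrite inE => /orP[/eqP->|/uN].
have su := is_submod_spanned [set` u].
apply: (@fin_dim_sub _ _ (u ++ r)) => // v Nv.
have [v' Su fv'] : [set f x | x in spanned [set` u]] (f v).
  have Stv : spanned [set` t] (f v) by refine (Nt _ _); exists v.
  apply: (spanned_sub (is_submod_image lf su) _ Stv) => y /=.
  by rewrite -ut => /mapP[z zu ->]; exists z => //; refine (spanned_in _).
have sur := is_submod_spanned [set` u ++ r].
rewrite -[v](subrK v'); apply: (is_submodD sur).
  apply: (@spanned_mono _ [set` r]); first by move=> y /= yr; rewrite mem_cat yr orbT.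
  refine (Nr _ _); split; last by rewrite /= (linB lf) fv' subrr.
  by apply: is_submodB => //; apply: (spanned_sub _ uN).
by apply: spanned_mono Su => y /= yr; rewrite mem_cat yr.
Qed.

(** The form in which finite dimension is used below: finitely many linear maps with
    finite-dimensional images that jointly separate the points of [N]. *)
Lemma fin_dim_separated V W (J : eqType) (s : seq J) (f : J -> V -> W) (N : set V) :
  is_submod N -> (forall j, linear (f j)) ->
  (forall j, j \in s -> exists M, fin_dim M /\ forall v, N v -> M (f j v)) ->
  (forall v, N v -> (forall j, j \in s -> f j v = 0) -> v = 0) ->
  fin_dim N.
Proof.
move=> + lf; elim: s N => [|j s IHs] N sN fM f0.
  apply: (@fin_dim_of_seq _ _ [::]) => // v Nv.
  by rewrite (f0 _ Nv) //; case: (is_submod_spanned [set` [::] : seq V]).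
have [M [fdM NM]] := fM j (mem_head _ _).
apply: (fin_dim_ext sN (lf j) fdM NM); apply: IHs; first exact: is_submod_ker.
  move=> i si; have [|P [fdP NP]] := fM i; first by rewrite inE si orbT.
  by exists P; split=> // v [/NP].
move=> v [Nv fv] H; apply: f0 => // i; rewrite inE => /orP[/eqP->//|].
exact: H.
Qed.

End FiniteSpans.

Section LinearExtension.
Variables (k : fieldType) (V W : lmodType k) (J : choiceType).
Variables (T : set J) (v : J -> V) (g : J -> W).
Hypothesis basis_v : is_basis T v.

Let spV w : spanned [set v p | p in T] w.
Proof.
have [s [c [sT ->]]] := basis_v.1 w.
apply: (is_submod_sum (is_submod_spanned _)) => p /sT Tp.
apply: (is_submodZ _ (is_submod_spanned _)).
by refine (spanned_in _); exists p.
Qed.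

Lemma basis_ind (P : set V) : is_submod P -> (forall p, T p -> P (v p)) ->
  forall w, P w.
Proof.
by move=> sP TP w; apply: (spanned_sub sP _ (spV w)) => _ [p /TP Pp <-].
Qed.

Let graph : set (V * W)%type := spanned [set (v p, g p) | p in T].

Let graph_fun z : graph (0, z) -> z = 0.
Proof.
pose line p := [set u : (V * W)%type |
  exists c, (T p \/ c = 0) /\ u = c *: (v p, g p)].
have sline p : is_submod (line p).
  split; first by exists 0; split; [right | rewrite scale0r].
  move=> a _ _ [c [Hc ->]] [d [Hd ->]]; exists (a * c + d); split.
    case: Hc => [|->]; [by left | case: Hd => [|->]; first by left].
    by right; rewrite mulr0 addr0.
  by rewrite scalerDl scalerA.
have : graph `<=` sum_of line.
  apply: spanned_sub; first exact: is_submod_sum_of.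
  move=> _ [p Tp <-]; apply: (sum_of_in sline (j := p)).
  by exists 1; split; [left | rewrite scale1r].
move=> /[apply] -[s [f [us lf f0 E]]].
have /choice[c Hc] := lf.
(* [line p] is zero off [T], so an index outside [T] can only carry a zero coefficient. *)
have us' : uniq [seq p <- s | c p != 0] by rewrite filter_uniq.
have sT p : p \in [seq p <- s | c p != 0] -> T p.
  by rewrite mem_filter => /andP[+ _]; case: (Hc p) => -[//|->]; rewrite eqxx.
have c0 : forall p, p \in s -> c p = 0.
  move=> p ps; apply/eqP/negPn/negP => cp.
  have ps' : p \in [seq p <- s | c p != 0] by rewrite mem_filter cp.
  move: cp; rewrite (basis_v.2 _ c us' sT _ p ps') ?eqxx // big_filter big_mkcond /=.
  have := congr1 fst E; rewrite /= raddf_sum /= => E1; rewrite [RHS]E1.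
  apply: eq_bigr => q _; rewrite (Hc q).2 /=.
  by case: eqP => //= ->; rewrite scale0r.
have := congr1 snd E; rewrite /= raddf_sum /= => ->.
by rewrite big_seq big1 // => p ps; rewrite (Hc p).2 /= c0 // scale0r.
Qed.

(** A map defined on a basis extends linearly. The extension is obtained as the
    subspace of [V * W] generated by the pairs [(v p, g p)]; independence of the
    [v p] says that this subspace is the graph of a function. *)
Lemma basis_extension : exists f : V -> W, linear f /\ forall p, T p -> f (v p) = g p.
Proof.
have sg : is_submod graph by apply: is_submod_spanned.
have gF w z z' : graph (w, z) -> graph (w, z') -> z = z'.
  move=> H H'; apply/eqP; rewrite -subr_eq0; apply/eqP/graph_fun.
  by rewrite -(subrr w); apply: (is_submodB sg H H').
have /choice[f Hf] : forall w, exists z, graph (w, z).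
  apply: basis_ind => [|p Tp].
    split; first by exists 0; case: sg.
    move=> c w w' [z Hz] [z' Hz']; exists (c *: z + z').
    exact: (sg.2 c _ _ Hz Hz').
  by exists (g p); refine (spanned_in _); exists p.
exists f; split=> [c w w'|p Tp].
  exact: (gF _ _ _ (Hf _) (sg.2 c _ _ (Hf w) (Hf w'))).
by apply: (gF _ _ _ (Hf _)); refine (spanned_in _); exists p.
Qed.

End LinearExtension.

(** * The truncation ideal *)

Section TriangularSpan.
Variables (k : fieldType) (I : choiceType) (A : lu_galgebra k I).
Variables (disp : Order.disp_t) (L : porderType disp).
Variables (T : triangular_basis A L) (l : L).
Local Notation "a ** b" := (ga_mul A a b) (at level 40, left associativity).
Local Notation one := (ga_one A).
Local Notation S := (tb_S T).
Local Notation wt := (tb_wt T).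

Lemma ga_oneK i : one i ** one i = one i.
Proof. by rewrite ga_oneM eqxx. Qed.

Lemma two_sided_oneP i j x :
  two_sided (one i) (one j) x -> one i ** x = x /\ x ** one j = x.
Proof. by apply: two_sidedP; apply: ga_oneK. Qed.

Lemma two_sided_onel i j x i' : two_sided (one i) (one j) x ->
  one i' ** x = if i' == i then x else 0.
Proof.
move=> /two_sided_oneP[<- _]; rewrite ga_mulA ga_oneM.
by case: eqP => [->//|_]; rewrite ga_mul0l.
Qed.

Lemma two_sided_oner i j x j' : two_sided (one i) (one j) x ->
  x ** one j' = if j' == j then x else 0.
Proof.
move=> /two_sided_oneP[_ <-]; rewrite -ga_mulA ga_oneM [j == _]eq_sym.
by case: eqP => // _; rewrite ga_mul0r.
Qed.

Lemma tb_XE i s x : S s -> tb_X T i s x -> one i ** x = x /\ x ** one s = x.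
Proof. by move=> Ss /(tb_X_in Ss)[/two_sided_oneP]. Qed.

Lemma tb_HE s t h : S s -> S t -> tb_H T s t h -> one s ** h = h /\ h ** one t = h.
Proof. by move=> Ss St /(tb_H_in Ss St)[/two_sided_oneP]. Qed.

Lemma tb_YE t j y : S t -> tb_Y T t j y -> one t ** y = y /\ y ** one j = y.
Proof. by move=> St /(tb_Y_in St)[/two_sided_oneP]. Qed.

Lemma tb_X_diag s x : S s -> tb_X T s s x -> x = one s.
Proof. by move=> Ss; rewrite (tb_diag Ss).1. Qed.

Lemma tb_Y_diag s x : S s -> tb_Y T s s x -> x = one s.
Proof. by move=> Ss; rewrite (tb_diag Ss).2. Qed.

Lemma tb_H_wt s t h : S s -> S t -> tb_H T s t h -> wt s = wt t.
Proof.
move=> Ss St Hh; have [->//|st] := eqVneq s t.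
by apply: (tb_H_eq Ss St st); exists h.
Qed.

Definition tb_prod (i j s t : I) : set A := [set z | exists x h y,
  [/\ tb_X T i s x, tb_H T s t h, tb_Y T t j y & z = x ** h ** y]].

Definition tb_block i j : set A :=
  [set z | exists s t, [/\ S s, S t & tb_prod i j s t z]].

Lemma tb_prod_basis (P : set A) : is_submod P ->
  (forall i j s t z, S s -> S t -> tb_prod i j s t z -> P z) -> forall a, P a.
Proof.
move=> sP HP; apply: (basis_ind (tb_basis T) sP).
move=> [[x h] y] [s [t [Ss St [i Hx] Hh [j Hy]]]].
by apply: (HP i j s t) => //; exists x, h, y.
Qed.

Lemma tb_prod_two_sided i j s t z : S s -> S t -> tb_prod i j s t z ->
  two_sided (one i) (one j) z.
Proof.
move=> Ss St [x [h [y [Hx Hh Hy ->]]]]; apply: two_sided_in.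
  by rewrite !ga_mulA (tb_XE Ss Hx).1.
by rewrite -!ga_mulA (tb_YE St Hy).2.
Qed.

Lemma tb_block_span i j a : spanned (tb_block i j) (one i ** a ** one j).
Proof.
have sB := is_submod_spanned (tb_block i j).
apply: (tb_prod_basis (P := [set a | spanned (tb_block i j) (one i ** a ** one j)])).
  split=> [|c u v Hu Hv] /=; first by rewrite ga_mul0r ga_mul0l; case: sB.
  by rewrite ga_mulDr ga_mulDl ga_mulZr ga_mulZl; apply: sB.2.
move=> i' j' s t z Ss St Hz /=; have Wz := tb_prod_two_sided Ss St Hz.
rewrite (two_sided_onel i Wz); case: eqP => [ii|_]; last by rewrite ga_mul0l; case: sB.
rewrite (two_sided_oner j Wz); case: eqP => [jj|_]; last by case: sB.
by subst i' j'; refine (spanned_in _); exists s, t.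
Qed.

Lemma ga_piece_ind (P : set A) : is_submod P ->
  (forall i j a, P (one i ** a ** one j)) -> forall a, P a.
Proof.
by move=> sP HP; apply: (ds_ind (ga_peirce A) sP) => -[i j] _ [a _ <-] /=.
Qed.

Lemma spanned_mul (G G' N : set A) : is_submod N ->
  (forall u w, G u -> G' w -> N (u ** w)) ->
  forall u w, spanned G u -> spanned G' w -> N (u ** w).
Proof.
move=> sN GN u w Hu Hw; apply: (spanned_linear (ga_mul_linearl w) sN _ Hu) => x Gx.
by apply: (spanned_linear (ga_mul_linearr x) sN _ Hw) => y Gy; apply: GN.
Qed.

Definition tb_low : set A := [set z | exists i j s t,
  [/\ S s, S t, ~~ (l <= wt s)%O & tb_prod i j s t z]].

(** This is where the order on weights enters. Write [a 1_s] and [1_s b] in the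
    triangular basis, as sums of [x h y] with [y] in [Y(t, s)] and of [x' h' y'] with
    [x'] in [X(s, u)]. If [t != s] or [u != s] the product factors through an
    idempotent of smaller weight, and induction applies. Otherwise it is
    [x (h h') y'], and expanding [h h'] in the basis yields, up to terms that again
    factor through smaller weights, elements of [H]. The induction is on the size of
    the finite lower set of the weight of [s]. *)
Lemma tb_low_gen s : S s -> ~~ (l <= wt s)%O ->
  forall a b, spanned tb_low (a ** one s ** b).
Proof.
have sL := is_submod_spanned tb_low.
have [n] := ubnP #|` fset_set [set m : L | (m <= wt s)%O]|.
elim: n s => // n IHn s; rewrite ltnS => Hn Ss Ls.
have IH u : S u -> (wt u < wt s)%O -> forall a b, spanned tb_low (a ** one u ** b).
  move=> Su us; apply: IHn => //; last first.
    by apply: contra Ls => /le_trans; apply; apply: ltW.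
  have down_setE (c m : L) : (m \in fset_set [set m | (m <= c)%O]) = (m <= c)%O.
    rewrite in_fset_set; last exact: (tb_lower_finite T).
    by apply/idP/idP => [/set_mem|] // ?; apply/mem_set.
  apply: leq_trans Hn; apply: fproper_ltn_card; apply/andP; split.
    apply/fsubsetP => m; rewrite !down_setE.
    by move=> /le_trans; apply; apply: ltW.
  apply/negP => /fsubsetP/(_ (wt s)); rewrite !down_setE lexx => /(_ isT).
  by move=> /(lt_le_trans us); rewrite ltxx.
have low0 : spanned tb_low 0 by case: sL.
have mid i j z z' : tb_block i s z -> tb_block s j z' -> spanned tb_low (z ** z').
  move=> [v [t [Sv St [x [h [y [Hx Hh Hy ->]]]]]]].
  move=> [u' [t' [Su' St' [x' [h' [y' [Hx' Hh' Hy' ->]]]]]]].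
  have [ts|ts] := eqVneq t s; last first.
    set w := _ ** y'.
    have -> : x ** h ** y ** w = x ** h ** one t ** (y ** w).
      by rewrite ga_mulA -(ga_mulA _ (one t) y) (tb_YE St Hy).1.
    by refine (IH t St _ _ _); apply: (tb_Y_lt St Ss ts); exists y.
  have [us|us] := eqVneq u' s; last first.
    set w := _ ** y.
    have -> : w ** (x' ** h' ** y') = w ** x' ** one u' ** (h' ** y').
      by rewrite -(ga_mulA w) (tb_XE Su' Hx').2 !ga_mulA.
    refine (IH u' Su' _ _ _); apply: (tb_X_lt Ss Su'); last by exists x'.
    by rewrite eq_sym.
  subst t u'; rewrite (tb_Y_diag Ss Hy) (tb_X_diag Ss Hx').
  have wv := tb_H_wt Sv Ss Hh; have wt' := tb_H_wt Ss St' Hh'.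
  have -> : x ** h ** one s ** (one s ** h' ** y') = x ** (h ** h') ** y'.
    by rewrite (tb_HE Ss St' Hh').1 -(ga_mulA x h) (tb_HE Sv Ss Hh).2 !ga_mulA.
  have {1}-> : h ** h' = one v ** (h ** h') ** one t'.
    by rewrite !ga_mulA (tb_HE Sv Ss Hh).1 -!ga_mulA (tb_HE Ss St' Hh').2.
  have lin : linear (fun w => x ** w ** y').
    by move=> c w w'; rewrite ga_mulDr ga_mulDl ga_mulZr ga_mulZl.
  refine (spanned_linear lin sL _ (@tb_block_span v t' (h ** h'))).
  move=> _ [v1 [v2 [Sv1 Sv2 [x2 [h2 [y2 [Hx2 Hh2 Hy2 ->]]]]]]].
  have [e1|e1] := eqVneq v1 v; last first.
    have -> : x ** (x2 ** h2 ** y2) ** y' = x ** x2 ** one v1 ** (h2 ** y2 ** y').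
      by rewrite -(ga_mulA x x2) (tb_XE Sv1 Hx2).2 !ga_mulA.
    refine (IH v1 Sv1 _ _ _); rewrite -wv; apply: (tb_X_lt Sv Sv1); last by exists x2.
    by rewrite eq_sym.
  have [e2|e2] := eqVneq v2 t'; last first.
    have -> : x ** (x2 ** h2 ** y2) ** y' = x ** x2 ** h2 ** one v2 ** (y2 ** y').
      by rewrite !ga_mulA -(ga_mulA _ (one v2)) (tb_YE Sv2 Hy2).1.
    by refine (IH v2 Sv2 _ _ _); rewrite wt'; apply: (tb_Y_lt Sv2 St' e2); exists y2.
  subst v1 v2; rewrite (tb_X_diag Sv Hx2) (tb_Y_diag St' Hy2).
  rewrite (tb_HE Sv St' Hh2).1 (tb_HE Sv St' Hh2).2.
  refine (spanned_in _); exists i, j, v, t'; split=> //; first by rewrite wv.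
  by exists x, h2, y'.
move=> a b.
have lin b' : linear (fun a => a ** one s ** b').
  by move=> c w w'; rewrite !ga_mulDl !ga_mulZl.
move: a; apply: ga_piece_ind.
  split=> [|c u w Hu Hw] /=; first by rewrite (lin0 (lin b)).
  by rewrite (lin b); apply: sL.2.
move=> i i' a; move: b; apply: ga_piece_ind.
  split=> [|c u w Hu Hw] /=; first by rewrite ga_mul0r.
  by rewrite ga_mulDr ga_mulZr; apply: sL.2.
move=> j' j b /=.
rewrite -(ga_mulA (one i ** a)) ga_oneM; case: eqP => [->|_]; last first.
  by rewrite ga_mul0r ga_mul0l.
have [<-|sj] := eqVneq s j'; last first.
  by rewrite !ga_mulA -(ga_mulA _ (one s)) ga_oneM (negbTE sj) ga_mul0r !ga_mul0l.
exact: (spanned_mul sL (@mid i j) (@tb_block_span _ _ _) (@tb_block_span _ _ _)).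
Qed.

Lemma tb_low_ideal : is_ideal (spanned tb_low).
Proof.
have sL := is_submod_spanned tb_low; split=> // a z Hz; split.
  apply: (spanned_linear (ga_mul_linearr a) sL _ Hz).
  move=> _ [i [j [s [t [Ss St Ls [x [h [y [Hx Hh Hy ->]]]]]]]]].
  have -> : a ** (x ** h ** y) = a ** x ** one s ** (h ** y).
    by rewrite -(ga_mulA a) (tb_XE Ss Hx).2 !ga_mulA.
  exact: (tb_low_gen Ss Ls).
apply: (spanned_linear (ga_mul_linearl a) sL _ Hz).
move=> _ [i [j [s [t [Ss St Ls [x [h [y [Hx Hh Hy ->]]]]]]]]].
have -> : x ** h ** y ** a = x ** one s ** (h ** y ** a).
  by rewrite (tb_XE Ss Hx).2 !ga_mulA.
exact: (tb_low_gen Ss Ls).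
Qed.

Local Notation N := (ideal_gen (truncation_gens T l)).

(** Consequently the truncation ideal is spanned by the basis elements [x h y] of
    weight not above [l], and the other basis elements stay independent in the
    quotient. *)
Lemma truncation_ideal_low : N `<=` spanned tb_low.
Proof.
move=> z; apply; split; first exact: tb_low_ideal.
move=> _ [m lm <-]; rewrite weight_idemE.
apply: (is_submod_sum (is_submod_spanned _)) => s.
rewrite in_fset_set; last exact: (tb_fiber_finite T).
move=> /set_mem[Ss sm]; rewrite -(ga_oneK s) -{1}(ga_oneK s).
by refine (tb_low_gen Ss _ _ _); rewrite sm.
Qed.

Lemma one_weight_idem s m : S s ->
  one s ** weight_idem T m = (if wt s == m then one s else 0) /\
  weight_idem T m ** one s = (if wt s == m then one s else 0).
Proof.
move=> Ss; rewrite weight_idemE ga_mul_sumr ga_mul_suml.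
set F := fset_set _.
have inF : (s \in F) = (wt s == m).
  rewrite in_fset_set; last exact: (tb_fiber_finite T).
  by apply/idP/eqP => [/set_mem[]//|sm]; apply/mem_set.
rewrite -inF; have [sF|sF] := boolP (s \in F); last first.
  split; rewrite big_seq big1 // => t tF; rewrite ga_oneM; case: eqP => // st.
    by rewrite st tF in sF.
  by rewrite -st tF in sF.
split; rewrite (bigD1_seq s) ?fset_uniq //= ga_oneK big1 ?addr0 // => t ts.
  by rewrite ga_oneM eq_sym (negbTE ts).
by rewrite ga_oneM (negbTE ts).
Qed.

Lemma truncation_one s : S s -> ~~ (l <= wt s)%O -> N (one s).
Proof.
move=> Ss Ls; have [sN iN] := ideal_gen_ideal (truncation_gens T l).
have := (one_weight_idem (wt s) Ss).1; rewrite eqxx => <-.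
apply: (iN _ _ _).1; apply: ideal_gen_sub; exists (wt s) => //.
Qed.

End TriangularSpan.

(** * The dual basis of the standard bimodule *)

(** A homogeneous dual basis, modulo [N], of the right module [V e] over the corner
    [e V e]: generators [b j] of [V e] and [e V e]-linear coordinates [f j] with
    values in [e V e] such that [x = sum_j b_j f_j(x)], a sum that is finite for each
    [x]. By the dual basis lemma this expresses that [V e] is projective. Working
    modulo [N] lets the coordinates be built from a basis of [V] before passing to the
    quotient; leaving the product [mul] free lets the same notion be used for the
    opposite product, where it concerns the left module [e V]. *)
Record dual_system (k : fieldType) (V : lmodType k) (mul : V -> V -> V)
    (gr : int -> set V) (N : set V) (e : V) (J : choiceType)
    (b : J -> V) (deg : J -> int) (f : J -> V -> V) : Prop := DualSystem {
  dual_linear : forall j, linear (f j);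
  dual_ideal : forall j x, N x -> N (f j x);
  dual_gr : forall j, gr (deg j) (b j);
  dual_grf : forall j n x, gr n x -> gr (n - deg j) (f j x);
  dual_gen : forall j, N (mul (b j) e - b j);
  dual_corner : forall j x, mul x e = x ->
    N (mul e (f j x) - f j x) /\ N (mul (f j x) e - f j x);
  dual_mor : forall j x c, mul x e = x -> mul e c = c -> mul c e = c ->
    N (f j (mul x c) - mul (f j x) c);
  dual_sum : forall x, mul x e = x -> exists s : seq J,
    [/\ uniq s, forall j, j \notin s -> N (f j x)
      & N (x - \sum_(j <- s) mul (b j) (f j x))]
}.

Section RightDual.
Variables (k : fieldType) (I : choiceType) (A : lu_galgebra k I).
Variables (disp : Order.disp_t) (L : porderType disp).
Variables (T : triangular_basis A L) (l : L).
Local Notation "a ** b" := (ga_mul A a b) (at level 40, left associativity).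
Local Notation one := (ga_one A).
Local Notation S := (tb_S T).
Local Notation wt := (tb_wt T).
Local Notation N := (ideal_gen (truncation_gens T l)).
Local Notation e := (weight_idem T l).

Let sN : is_submod N. Proof. exact: (ideal_gen_ideal _).1. Qed.
Let NMl a x : N x -> N (a ** x).
Proof. by move=> Nx; have [] := (ideal_gen_ideal (truncation_gens T l)).2 a x Nx. Qed.
Let NMr a x : N x -> N (x ** a).
Proof. by move=> Nx; have [] := (ideal_gen_ideal (truncation_gens T l)).2 a x Nx. Qed.
Let N0 : N 0. Proof. by case: sN. Qed.

Lemma tb_prod_low i j s t z : S s -> S t -> ~~ (l <= wt s)%O ->
  tb_prod T i j s t z -> N z.
Proof.
move=> Ss St Ls [x [h [y [Hx Hh Hy ->]]]]; rewrite -(tb_XE Ss Hx).2.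
exact: (NMr _ (NMr _ (NMl _ (truncation_one Ss Ls)))).
Qed.

(** Modulo the ideal, a basis element [x h y] of [A 1_t], with [t] of weight [l], has
    [y = 1_t]: any other [y] starts at a smaller weight, which puts [x h y] in the
    ideal. *)
Lemma tb_block_weight i t z : S t -> wt t = l -> tb_block T i t z ->
  N z \/ exists s x h,
    [/\ S s, wt s = l, tb_X T i s x, tb_H T s t h & z = x ** h].
Proof.
move=> St tl [s [t' [Ss St' Hz]]]; have [x [h [y [Hx Hh Hy zE]]]] := Hz.
have [tt|tt] := eqVneq t' t; last first.
  left; apply: (tb_prod_low Ss St' _ Hz); rewrite (tb_H_wt Ss St' Hh) -tl.
  have := tb_Y_lt St' St tt (ex_intro _ y Hy).
  by move=> lt1; apply/negP => /(lt_le_trans lt1); rewrite ltxx.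
right; subst t'; exists s, x, h; split=> //; first by rewrite (tb_H_wt Ss St Hh).
by rewrite zE (tb_Y_diag St Hy) -ga_mulA (tb_HE Ss St Hh).2.
Qed.

Lemma weight_idem_right (P : set A) z : is_submod P ->
  (forall t, S t -> wt t = l -> P (z ** one t)) -> P (z ** e).
Proof.
move=> sP HP; rewrite weight_idemE ga_mul_sumr; apply: is_submod_sum => // t.
rewrite in_fset_set; last exact: (tb_fiber_finite T).
by move=> /set_mem[St tl]; apply: HP.
Qed.

(** The generators [x] of [A e_l] over the corner are recorded together with the
    idempotent [1_s] at which they end, since [x] contributes a copy of [1_s A e_l]. *)
Definition std_gen : set (I * A) :=
  [set j | [/\ S j.1, wt j.1 = l & exists i, tb_X T i j.1 j.2]].

Definition std_coef (s : I) : set A := [set c | one s ** c = c /\ c ** e = c].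

Lemma std_span a :
  spanned (N `|` [set z | exists j c, [/\ std_gen j, std_coef j.1 c & z = j.2 ** c]])
    (a ** e).
Proof.
set G := N `|` _; have sG := is_submod_spanned G.
apply: weight_idem_right => // t St tl; move: a; apply: ga_piece_ind.
  split=> [|c u v Hu Hv] /=; first by rewrite ga_mul0l; case: sG.
  by rewrite ga_mulDl ga_mulZl; apply: sG.2.
move=> i j a /=; rewrite -ga_mulA ga_oneM; case: eqP => [->|_]; last first.
  by rewrite ga_mul0r; case: sG.
refine (spanned_sub sG _ (@tb_block_span _ _ _ _ _ T _ _ _)) => z.
move=> /(tb_block_weight St tl)[Nz|[s [x [h [Ss sl Hx Hh ->]]]]].
  by refine (spanned_in _); left.
refine (spanned_in _); right; exists (s, x), h; split=> //.
  by split=> //; exists i.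
split; first exact: (tb_HE Ss St Hh).1.
by rewrite -{1}(tb_HE Ss St Hh).2 -ga_mulA (one_weight_idem l St).1 tl eqxx (tb_HE Ss St Hh).2.
Qed.

Lemma std_coef_span s c : S s -> wt s = l -> std_coef s c ->
  spanned (N `|` [set h | exists t, [/\ S t, wt t = l & tb_H T s t h]]) c.
Proof.
move=> Ss sl [sc <-]; set G := N `|` _; have sG := is_submod_spanned G.
apply: weight_idem_right => // t St tl; rewrite -sc.
refine (spanned_sub sG _ (@tb_block_span _ _ _ _ _ T _ _ _)) => z.
move=> /(tb_block_weight St tl)[Nz|[s' [x [h [Ss' sl' Hx Hh ->]]]]].
  by refine (spanned_in _); left.
refine (spanned_in _); right; exists t; split=> //.
have [ss|ss] := eqVneq s s'.
  by subst s'; rewrite (tb_X_diag Ss Hx) (tb_HE Ss St Hh).1.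
by have := tb_X_lt Ss Ss' ss (ex_intro _ x Hx); rewrite sl sl' ltxx.
Qed.

(** The coordinate along [x] is the linear map defined on the basis of [A] by
    [x h y |-> h y] and by [0] on the elements [x' h y] with [x' != x]. It kills the
    truncation ideal modulo itself because that ideal is spanned by basis elements. *)
Lemma std_functional j d : std_gen j -> ga_gr A d j.2 -> exists f : A -> A,
  [/\ linear f, forall x, N x -> N (f x),
      forall n x, ga_gr A n x -> ga_gr A (n - d) (f x)
    & forall j' c, std_gen j' -> std_coef j'.1 c ->
        N (f (j'.2 ** c) - (if j == j' then c else 0))].
Proof.
case: j => s x [/= Ss sl [i Hx]] Hd.
(* The factor [one s] is the identity on an [h] starting at [s]; for an [x] that also
   belongs to some [X(i, s')] with [s' != s] it makes the coordinate vanish. *)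
have [f [lf fE]] := basis_extension
  (fun p => if p.1.1 == x then one s ** p.1.2 ** p.2 else 0) (tb_basis T).
have {}fE i' j' s' t' x' h' y' : S s' -> S t' -> tb_X T i' s' x' ->
    tb_H T s' t' h' -> tb_Y T t' j' y' ->
    f (x' ** h' ** y') = if x' == x then one s ** h' ** y' else 0.
  move=> Ss' St' Hx' Hh' Hy'; apply: (fE (x', h', y')).
  by exists s', t'; split=> //; [exists i' | exists j'].
have Nf z : N z -> N (f z).
  move=> /truncation_ideal_low; apply: (spanned_linear lf sN).
  move=> _ [i' [j' [s' [t' [Ss' St' Ls' [x' [h' [y' [Hx' Hh' Hy' ->]]]]]]]]].
  rewrite (fE _ _ _ _ _ _ _ Ss' St' Hx' Hh' Hy'); case: eqP => // _.
  rewrite (two_sided_onel s (tb_H_in Ss' St' Hh').1).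
  case: eqP => [ss|_]; last by rewrite ga_mul0l.
  by move: Ls'; rewrite -ss sl lexx.
exists f; split=> //.
- have lp n := ds_proj_linear (ga_gr_direct A) n.
  have fp : forall z n, f (ds_proj (ga_gr_direct A) n z) =
      ds_proj (ga_gr_direct A) (n - d) (f z).
    apply: (tb_prod_basis (T := T) (P := [set z | forall n,
      f (ds_proj (ga_gr_direct A) n z) = ds_proj (ga_gr_direct A) (n - d) (f z)])).
      split=> [n|c u v Hu Hv n] /=; first by rewrite !(lin0 (lp _)) (lin0 lf) (lin0 (lp _)).
      by rewrite lp !lf lp Hu Hv.
    move=> i' j' s' t' _ Ss' St' [x' [h' [y' [Hx' Hh' Hy' ->]]]] n /=.
    have [dx Gx] := (tb_X_in Ss' Hx').2; have [dh Gh] := (tb_H_in Ss' St' Hh').2.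
    have [dy Gy] := (tb_Y_in St' Hy').2.
    have fz := fE _ _ _ _ _ _ _ Ss' St' Hx' Hh' Hy'.
    move: fz; case: eqP => [xx|_] fz; last first.
      rewrite fz (lin0 (lp _)) (ds_proj_in _ _ (ga_grM (ga_grM Gx Gh) Gy)).
      by case: ifP => _; rewrite ?fz ?(lin0 lf).
    rewrite xx in fz *; rewrite (ds_proj_in _ _ (ga_grM (ga_grM Hd Gh) Gy)) fz.
    rewrite (ds_proj_in _ _ (ga_grM (ga_grM (ga_one_gr0 A s) Gh) Gy)) add0r.
    rewrite subr_eq [dh + dy + d]addrC addrA; case: ifP => _; rewrite ?fz ?(lin0 lf) //.
  move=> n z Hz; rewrite -[z](ds_proj_id (ga_gr_direct A) Hz) fp; exact: ds_projG.
- move=> [s' x'] c [/= Ss' sl' [i' Hx']] Hc.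
  apply: (spanned_sub _ _ (std_coef_span Ss' sl' Hc) :
    [set c | N (f (x' ** c) - (if (s, x) == (s', x') then c else 0))] c).
    split=> [|a u v Hu Hv] /=; first by rewrite ga_mul0r (lin0 lf) if_same subrr.
    rewrite ga_mulDr ga_mulZr lf.
    have -> : (if (s, x) == (s', x') then a *: u + v else 0) =
      a *: (if (s, x) == (s', x') then u else 0) + (if (s, x) == (s', x') then v else 0).
      by case: ifP => // _; rewrite scaler0 addr0.
    by rewrite opprD addrACA -scalerBr; apply: sN.2.
  move=> h [Nh|[t [St tl Hh]]] /=.
    by refine (is_submodB sN (Nf _ (NMl _ Nh)) _); case: ifP.
  have Ht : tb_Y T t t (one t) by rewrite (tb_diag St).2.
  rewrite -{1}(tb_HE Ss' St Hh).2 ga_mulA.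
  rewrite (fE _ _ _ _ _ _ _ Ss' St Hx' Hh Ht) -ga_mulA (tb_HE Ss' St Hh).2.
  rewrite (two_sided_onel s (tb_H_in Ss' St Hh).1) xpair_eqE [x' == x]eq_sym.
  by case: (s == s'); case: (x == x'); rewrite /= subrr.
Qed.

(** Modulo the truncation ideal, [A e_l] is the direct sum over [x] in [X(s)], [s] of
    weight [l], of the submodules [x (1_s A e_l)], and multiplication by [x] is
    injective on [1_s A e_l]; the coordinates are those of [std_functional]. *)
Theorem std_dual_system : exists (J : choiceType) (b : J -> A) (deg : J -> int)
  (f : J -> A -> A), dual_system (ga_mul A) (ga_gr A) N e b deg f.
Proof.
pose J : choiceType := {j : I * A | j \in std_gen}.
have genJ (j : J) : std_gen (val j) by apply/set_mem/(valP j).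
have /choice[df Hdf] (j : J) : exists df : int * (A -> A),
    ga_gr A df.1 (val j).2 /\
    [/\ linear df.2, forall x, N x -> N (df.2 x),
      forall n x, ga_gr A n x -> ga_gr A (n - df.1) (df.2 x)
    & forall j' c, std_gen j' -> std_coef j'.1 c ->
        N (df.2 (j'.2 ** c) - (if val j == j' then c else 0))].
  have [Sj _ [i Xj]] := genJ j; have [d Hd] := (tb_X_in Sj Xj).2.
  by have [f Hf] := std_functional (genJ j) Hd; exists (d, f).
pose f (j : J) := (df j).2.
have lf j : linear (f j) by have [_ []] := Hdf j.
have Nf j x : N x -> N (f j x) by have [_ [_ + _ _]] := Hdf j; apply.
have fE (j j' : J) c : std_coef (val j').1 c ->
    N (f j ((val j').2 ** c) - (if j == j' then c else 0)).
  by have [_ [_ _ _ H]] := Hdf j; apply: H.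
have ecoef s c : S s -> wt s = l -> std_coef s c -> e ** c = c.
  by move=> Ss sl [<- _]; rewrite ga_mulA (one_weight_idem l Ss).2 sl eqxx.
(* All properties of the coordinates are linear and need checking on [N] and the [x c] only. *)
have ind (P : set A) : is_submod P -> N `<=` P ->
    (forall (j : J) c, std_coef (val j).1 c -> P ((val j).2 ** c)) ->
    forall x, x ** e = x -> P x.
  move=> sP NP HP x <-; apply: (spanned_sub sP _ (std_span x)).
  move=> z [/NP//|[j [c [Hj Hc ->]]]].
  by apply: (HP (exist _ j (mem_set Hj))).
exists J, (fun j => (val j).2), (fun j => (df j).1), f; split=> //.
- by move=> j; have [] := Hdf j.
- by move=> j n x; have [_ [_ _ + _]] := Hdf j; apply.
- move=> j; have [Sj lj [i Xj]] := genJ j.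
  rewrite -{1}(tb_XE Sj Xj).2 -ga_mulA (one_weight_idem l Sj).1 lj eqxx.
  by rewrite (tb_XE Sj Xj).2 subrr.
- move=> j; apply: ind.
  + split=> [|c u v [Hu1 Hu2] [Hv1 Hv2]] /=.
      by rewrite (lin0 (lf j)) ga_mul0l ga_mul0r subrr.
    rewrite lf ga_mulDr ga_mulDl ga_mulZr ga_mulZl !opprD ![_ + (- _ - _)]addrACA.
    by rewrite -!scalerBr; split; apply: sN.2.
  + by move=> x Nx; split; refine (is_submodB sN _ _); first
      [refine (NMl _ (Nf _ _ Nx)) | refine (NMr _ (Nf _ _ Nx)) | refine (Nf _ _ Nx)].
  + move=> j' c Hc /=.
    have [Sj lj _] := genJ j'; have ec := ecoef _ _ Sj lj Hc.
    have step u : u ** e = u -> e ** u = u -> N (f j ((val j').2 ** c) - u) ->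
        N (e ** f j ((val j').2 ** c) - f j ((val j').2 ** c)) /\
        N (f j ((val j').2 ** c) ** e - f j ((val j').2 ** c)).
      move=> ue eu Hu; set w := f j _ in Hu *.
      have E1 : e ** w - w = e ** (w - u) - (w - u).
        by rewrite ga_mulBr eu opprB addrA subrK.
      have E2 : w ** e - w = (w - u) ** e - (w - u).
        by rewrite ga_mulBl ue opprB addrA subrK.
      by rewrite E1 E2; split; refine (is_submodB sN _ Hu);
        first [exact: (NMl _ Hu) | exact: (NMr _ Hu)].
    by apply: step (fE j j' c Hc); case: ifP => _; rewrite ?ga_mul0l ?ga_mul0r ?ec ?Hc.2.
- move=> j x c xe ec ce; move: x xe; apply: ind.
  + split=> [|a u v Hu Hv] /=.
      by rewrite !ga_mul0l (lin0 (lf j)) ga_mul0l subrr.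
    rewrite ga_mulDl ga_mulZl !lf ga_mulDl ga_mulZl opprD addrACA -scalerBr.
    exact: sN.2.
  + by move=> x Nx; refine (is_submodB sN (Nf _ _ (NMr _ Nx)) (NMr _ (Nf _ _ Nx))).
  + move=> j' c' [sc' c'e] /=.
    have Hcc : std_coef (val j').1 (c' ** c).
      by split; rewrite ?ga_mulA ?sc' // -ga_mulA ce.
    have H1 := fE j j' _ Hcc; have H2 := NMr c (fE j j' c' (conj sc' c'e)).
    rewrite -ga_mulA; rewrite ga_mulBl in H2.
    have E : (if j == j' then c' ** c else 0) = (if j == j' then c' else 0) ** c.
      by case: ifP => // _; rewrite ga_mul0l.
    rewrite -E in H2; have := is_submodB sN H1 H2.
    by rewrite opprB addrA subrK.
- apply: ind.
  + split=> [|a u v].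
      exists [::]; split=> // [j _|]; first by rewrite (lin0 (lf j)).
      by rewrite big_nil subrr.
    move=> [s [us s0 Hs]] [t [ut t0 Ht]].
    have widen (x : A) (q r : seq J) : uniq q -> uniq r -> {subset q <= r} ->
        (forall j, j \notin q -> N (f j x)) ->
        N (x - \sum_(j <- q) (val j).2 ** f j x) ->
        N (x - \sum_(j <- r) (val j).2 ** f j x).
      move=> uq ur qr q0 Hq; rewrite (bigID (mem q)) /= -[X in N (_ - (X + _))]big_filter.
      rewrite (perm_big q) /=.
        rewrite opprD addrA; refine (is_submodB sN Hq _).
        rewrite -big_filter; apply: (is_submod_sum sN) => j.
        by rewrite mem_filter => /andP[/q0 Nj _]; exact: (NMl _ Nj).
      apply: uniq_perm; rewrite ?filter_uniq // => j.
      by rewrite mem_filter; case: (boolP (j \in q)) => //= /qr.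
    have ur : uniq (undup (s ++ t)) by apply: undup_uniq.
    exists (undup (s ++ t)); split=> //.
      move=> j; rewrite mem_undup mem_cat negb_or lf => /andP[/s0 Hu /t0 Hv].
      exact: sN.2.
    under eq_bigr => j _ do rewrite lf ga_mulDr ga_mulZr.
    rewrite big_split -scaler_sumr /= opprD addrACA -scalerBr; apply: sN.2.
      by apply: (widen _ s) => // j; rewrite mem_undup mem_cat => ->.
    by apply: (widen _ t) => // j; rewrite mem_undup mem_cat => ->; rewrite orbT.
  + move=> x Nx; exists [::]; split=> // [j _|]; first exact: Nf.
    by rewrite big_nil subr0.
  + move=> j c Hc; exists [:: j]; split=> //.
      move=> j'; rewrite inE => /negbTE j'j; have := fE j' j c Hc.
      by rewrite j'j subr0.
    rewrite big_seq1; have := NMl (val j).2 (fE j j c Hc).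
    rewrite eqxx ga_mulBr => /(is_submodB sN N0).
    by rewrite sub0r opprB.
Qed.

End RightDual.

(** * The opposite algebra *)

Section Opposite.
Variables (k : fieldType) (I : choiceType) (A : lu_galgebra k I).

Definition op_mul (a b : A) : A := ga_mul A b a.

Fact op_mulA : associative op_mul.
Proof. by move=> a b c; rewrite /op_mul ga_mulA. Qed.

Fact op_oneM i j : op_mul (ga_one A i) (ga_one A j) = if i == j then ga_one A i else 0.
Proof. by rewrite /op_mul ga_oneM eq_sym; case: eqP => // ->. Qed.

Fact op_grM d n a b : ga_gr A d a -> ga_gr A n b -> ga_gr A (d + n) (op_mul a b).
Proof. by move=> Ha Hb; rewrite addrC; apply: ga_grM. Qed.

Fact op_peirce : direct_sum (fun p : I * I =>
  [set op_mul (op_mul (ga_one A p.1) a) (ga_one A p.2) | a in setT]).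
Proof.
have E (p : I * I) : [set op_mul (op_mul (ga_one A p.1) a) (ga_one A p.2) | a in setT] =
    [set ga_mul A (ga_mul A (ga_one A p.2) a) (ga_one A p.1) | a in setT].
  by apply: eq_imagel => a _; rewrite /op_mul ga_mulA.
have [sP spP indP] := ga_peirce A.
have swK : involutive (fun p : I * I => (p.2, p.1)) by case.
split=> [p|v|s f us Gf sum0 p ps].
- by rewrite E; apply: (sP (p.2, p.1)).
- have [s [f [Gf ->]]] := spP v.
  exists [seq (p.2, p.1) | p <- s], (fun p => f (p.2, p.1)); split=> [p|].
    by rewrite E; apply: (Gf (p.2, p.1)).
  by rewrite big_map; apply: eq_bigr => -[].
- have := indP [seq (p.2, p.1) | p <- s] (fun p => f (p.2, p.1)).
  rewrite map_inj_uniq; last exact: inv_inj swK.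
  move=> /(_ us); rewrite big_map => H.
  have {}H := H _ _ (p.2, p.1); rewrite (swK p) in H.
  apply: H.
  + by move=> q; have := Gf (q.2, q.1); rewrite E.
  + by rewrite -[RHS]sum0; apply: eq_bigr => -[].
  + by apply/mapP; exists p.
Qed.

(** The axioms of a triangular basis are symmetric under reversal of products, with
    [X] and [Y] exchanged; passing to the opposite algebra turns statements on the
    right module [A e_l] into statements on the left module [e_l A]. *)
Definition op_alg : lu_galgebra k I :=
  LUGAlgebra (ga_mul := op_mul) (@ga_mul_linearl _ _ A) (@ga_mul_linearr _ _ A)
    op_mulA op_oneM (@ga_one_homog _ _ A) (ga_gr_direct A) op_grM op_peirce.

Lemma op_two_sided (e f x : A) :
  two_sided (B := op_alg) e f x <-> two_sided f e x.
Proof. by split=> -[y _ <-]; exists y => //=; rewrite /op_mul ga_mulA. Qed.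

Lemma op_ideal_gen (G : set A) : ideal_gen (A := op_alg) G = ideal_gen G.
Proof.
have E (N : set A) : is_ideal (A := op_alg) N <-> is_ideal N.
  by split=> -[sN H]; split=> // a x /(H a)[].
by apply/seteqP; split=> x Hx N [/E HN GN]; apply: Hx.
Qed.

Variables (disp : Order.disp_t) (L : porderType disp) (T : triangular_basis A L).
Local Notation S := (tb_S T).

Fact op_basis : is_basis
    [set p : op_alg * op_alg * op_alg | exists s t, [/\ S s, S t,
       exists i, tb_Y T s i p.1.1, tb_H T t s p.1.2 & exists j, tb_X T j t p.2]]
    (fun p => op_mul (op_mul p.1.1 p.1.2) p.2).
Proof.
pose sw (p : A * A * A) := (p.2, p.1.2, p.1.1).
have swK : involutive sw by move=> [[]].
have [sp ind] := tb_basis T; split=> [w|s c us sT sum0 p ps].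
  have [s [c [sT ->]]] := sp w.
  exists [seq sw p | p <- s], (fun p => c (sw p)); split.
    move=> _ /mapP[p ps ->]; have [s' [t [Ss St Hx Hh Hy]]] := sT p ps.
    by exists t, s'.
  rewrite big_map; apply: eq_bigr => p _; rewrite swK /op_mul /= ga_mulA //.
have := ind [seq sw p | p <- s] (fun p => c (sw p)).
rewrite map_inj_uniq; last exact: inv_inj swK.
move=> /(_ us); rewrite big_map => H.
have {}H := H _ _ (sw p); rewrite (swK p) in H.
apply: H; last by apply/mapP; exists p.
  move=> _ /mapP[q qs ->]; have [s' [t [Ss St Hx Hh Hy]]] := sT q qs.
  by exists t, s'.
rewrite -[RHS]sum0; apply: eq_bigr => q _; rewrite swK /op_mul /= ga_mulA //.
Qed.

Definition op_triangular : triangular_basis op_alg L.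
Proof.
refine (@TriangularBasis k I op_alg disp L S (tb_wt T) (fun i s => tb_Y T s i)
  (fun s t => tb_H T t s) (fun t j => tb_X T j t) (tb_lower_finite T)
  (tb_fiber_finite T) _ _ _ op_basis _ _ _ _ (@tb_Y_finite _ _ _ _ _ T) (@tb_X_finite _ _ _ _ _ T)).
- by move=> i s x Ss /(tb_Y_in Ss)[/op_two_sided].
- by move=> s t h Ss St /(tb_H_in St Ss)[/op_two_sided].
- by move=> t j y St /(tb_X_in St)[/op_two_sided].
- by move=> s Ss; have [? ?] := tb_diag Ss.
- by move=> s t Ss St st; apply: (tb_Y_lt St Ss); rewrite eq_sym.
- by move=> s t Ss St st H; apply/esym; apply: (tb_H_eq St Ss) => //; rewrite eq_sym.
- by move=> s t Ss St st; apply: (tb_X_lt St Ss); rewrite eq_sym.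
Defined.

Theorem costd_dual_system (l : L) : exists (J : choiceType) (b : J -> A)
    (deg : J -> int) (f : J -> A -> A),
  dual_system op_mul (ga_gr A) (ideal_gen (truncation_gens T l))
    (weight_idem T l) b deg f.
Proof.
have [J [b [deg [f Hf]]]] := std_dual_system op_triangular l.
exists J, b, deg, f; move: Hf; rewrite op_ideal_gen.
exact.
Qed.

End Opposite.

(** * Exactness of induction *)

Section DualSystemQuotient.
Variables (k : fieldType) (V W : lmodType k) (mulV : V -> V -> V) (mulW : W -> W -> W).
Variables (grV : int -> set V) (grW : int -> set W) (N : set V) (e : V).
Variables (pi : V -> W) (rep : W -> V).
Hypotheses (pi_lin : linear pi) (repK : cancel rep pi).
Hypothesis piM : forall x y, mulW (pi x) (pi y) = pi (mulV x y).
Hypothesis pi_gr : forall d w, grW d w <-> exists2 x, grV d x & pi x = w.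
Hypothesis pi_ker : forall x, pi x = 0 <-> N x.
Hypotheses (mulA : associative mulV) (ee : mulV e e = e).

(** Stated for a bare product so that it also covers the opposite product on the
    quotient, which is not literally the quotient of the opposite algebra. *)
Lemma dual_system_quotient (J : choiceType) (b : J -> V) (deg : J -> int)
    (f : J -> V -> V) : dual_system mulV grV N e b deg f ->
  dual_system mulW grW [set 0] (pi e) (pi \o b) deg (fun j => pi \o f j \o rep).
Proof.
case=> lf Nf gb gf be fe fM fsum.
have piE x y : pi x = pi y <-> N (x - y).
  by rewrite -pi_ker (linB pi_lin); split=> [->|/eqP]; rewrite ?subrr // subr_eq0 => /eqP.
have pifE j x : pi (f j (rep (pi x))) = pi (f j x).
  by apply/piE; rewrite -(linB (lf j)); refine (Nf _ _ _); apply/piE; rewrite repK.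
have lift x : mulW x (pi e) = x -> exists2 y, mulV y e = y & pi y = x.
  by exists (mulV (rep x) e); rewrite -?mulA ?ee // -piM repK.
have lift2 x : mulW (pi e) x = x -> mulW x (pi e) = x ->
    exists y, [/\ mulV e y = y, mulV y e = y & pi y = x].
  move=> ex xe; exists (mulV e (mulV (rep x) e)); split.
  - by rewrite !mulA ee.
  - by rewrite -!mulA ee.
  - by rewrite -!piM repK xe.
have zeroE x y : x = y -> [set 0] (x - y :> W) by move=> ->; rewrite /= subrr.
split=> [j c x y|j x -> /=|j|j n _ /pi_gr[x Hx <-]|j|j _ /lift[x xe <-]|
    j x' c'|_ /lift[x xe <-]] /=.
- rewrite -pi_lin -lf; apply/piE; rewrite -(linB (lf j)); refine (Nf _ _ _).
  by apply/piE; rewrite pi_lin !repK.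
- by rewrite -(lin0 pi_lin) pifE (lin0 (lf j)) (lin0 pi_lin).
- by apply/pi_gr; exists (b j).
- by rewrite pifE; apply/pi_gr; exists (f j x) => //; apply: gf.
- by apply: zeroE; rewrite piM; apply/piE.
- by rewrite pifE; have [? ?] := fe j x xe; split; apply: zeroE; rewrite piM; apply/piE.
- move=> /lift[x xe <-] ec' /(lift2 _ ec')[c [ec ce <-]].
  by apply: zeroE; rewrite piM !pifE piM; apply/piE; apply: fM.
- have [s [us s0 Hs]] := fsum x xe; exists s; split=> // [j /s0 Nj|].
    by rewrite pifE; apply/pi_ker.
  apply: zeroE; rewrite (eq_bigr (fun j => pi (mulV (b j) (f j x)))) => [|j _].
    by rewrite -(lin_sum pi_lin); apply/piE.
  by rewrite pifE piM.
Qed.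

End DualSystemQuotient.

Lemma gmod_mor_proj (k : fieldType) (I : choiceType) (A : lu_galgebra k I)
    (V W : gmodule A) (g : gmod_mor V W) n v :
  ds_proj (gm_gr_direct W) n (g v) = g (ds_proj (gm_gr_direct V) n v).
Proof.
have [lg _ gg] := gh_homP g; have lp (U : gmodule A) m := ds_proj_linear (gm_gr_direct U) m.
move: v; apply: (ds_ind (gm_gr_direct V)).
  split=> [|c u w Hu Hw] /=; first by rewrite !(lin0 (lp _ _), lin0 lg).
  by rewrite !(lp, lg) Hu Hw.
move=> m v Hv /=; have := gg _ _ Hv; rewrite addr0 => Hgv.
by rewrite (ds_proj_in _ _ Hv) (ds_proj_in _ _ Hgv); case: ifP; rewrite ?(lin0 lg).
Qed.

Section CornerElements.
Variables (k : fieldType) (I : choiceType) (B : lu_galgebra k I) (e : B).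
Local Notation "a ** b" := (ga_mul B a b) (at level 40, left associativity).
Hypothesis ee : e ** e = e.

Lemma right_bimodP (m : right_bimod e) : val m ** e = val m.
Proof. by have [x _ E] := sub_modP m; rewrite [val m](esym E) -ga_mulA ee. Qed.

Lemma cornerP (e0 : ga_gr B 0 e) (x : corner ee e0) :
  e ** val (x : corner_sort e) = val (x : corner_sort e) /\
  val (x : corner_sort e) ** e = val (x : corner_sort e).
Proof. exact: two_sidedP ee ee (sub_modP (x : corner_sort e)). Qed.

Lemma sub_set0 (x y : B) : [set 0] (x - y) -> x = y.
Proof. by move=> /eqP; rewrite subr_eq0 => /eqP. Qed.

End CornerElements.

Section InductionExact.
Variables (k : fieldType) (I : choiceType) (B : lu_galgebra k I).
Local Notation "a ** b" := (ga_mul B a b) (at level 40, left associativity).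
Variables (e : B) (ee : e ** e = e) (e0 : ga_gr B 0 e).
Variables (J : choiceType) (b : J -> B) (deg : J -> int) (f : J -> B -> B).
Hypothesis dual : dual_system (ga_mul B) (ga_gr B) [set 0] e b deg f.
Local Notation C := (corner ee e0).
Local Notation Be := (right_bimod e).
Local Notation ract := (right_ract (e := e) (ee := ee) (e0 := e0)).
Local Notation ind := (ind_ob (ee := ee) (e0 := e0)).
Local Notation tensV V m v := (tens (ract) (gm_act V) m v : ind V).

Let gen_in j : right_set e (b j).
Proof. by exists (b j) => //; apply/sub_set0/(dual_gen dual). Qed.
Let gen j : Be := to_sub (right_set_submod e) (gen_in j).

Let coord_in j (m : Be) : two_sided e e (f j (val m)).
Proof.
have [H1 H2] := dual_corner dual j (right_bimodP ee m).
by apply: two_sided_in; apply: sub_set0.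
Qed.
Let coord j (m : Be) : C := to_sub (two_sided_submod e e) (coord_in j m).

Let coord_linear j : linear (coord j).
Proof. by move=> c u v; apply: val_inj; apply: (dual_linear dual j). Qed.

Let coordM j (m : Be) (x : C) :
  coord j (ract m x) = ga_mul C (coord j m) x.
Proof.
have [ex xe] := cornerP x; apply: val_inj => /=; apply: sub_set0.
exact: (dual_mor dual j (right_bimodP ee m) ex xe).
Qed.

Section Coordinates.
Variable V : gmodule C.

(** The coordinate [f j] induces [Be (x) V -> V], [m (x) v |-> f_j(m) v]. *)
Definition ind_coord j : ind V -> V :=
  tensor_lift (fun m v => gm_act V (coord j m) v).

Let lift_l j v : linear ((fun m v => gm_act V (coord j m) v)^~ v).
Proof. by move=> c m m' /=; rewrite coord_linear gm_act_linearl. Qed.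
Let lift_r j m : linear ((fun m v => gm_act V (coord j m) v) m).
Proof. by move=> c v v' /=; rewrite gm_act_linearr. Qed.
Let lift_b j m x v : gm_act V (coord j (ract m x)) v =
  gm_act V (coord j m) (gm_act V x v).
Proof. by rewrite coordM gm_actA. Qed.

Lemma ind_coord_tens j m v : ind_coord j (tensV V m v) = gm_act V (coord j m) v.
Proof. exact: (tensor_lift_tens (lift_l j) (lift_r j) (@lift_b j)). Qed.

Lemma ind_coord_linear j : linear (ind_coord j).
Proof. exact: (tensor_lift_linear (lift_l j) (lift_r j) (@lift_b j)). Qed.

(** The identity [t = sum_j b_j (x) t_j] reduces every question on [Be (x) V] to the
    coordinates [t_j] in [V]. *)
Lemma ind_coord_sum t : exists s, t = \sum_(j <- s) tensV V (gen j) (ind_coord j t).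
Proof.
suff [s [_ _ E]] : exists s, [/\ uniq s, forall j, j \notin s -> ind_coord j t = 0
    & t = \sum_(j <- s) tensV V (gen j) (ind_coord j t)] by exists s.
have tr m := tens_linearr ract (gm_act V) m.
have tl v := tens_linearl (ract) (gm_act V) v.
move: t; apply: tensor_ind.
  split=> [|c u v [s [us s0 Es]] [t [ut t0 Et]]] /=.
    by exists [::]; split=> // [j _|]; rewrite ?big_nil ?(lin0 (ind_coord_linear j)).
  exists (undup (s ++ t)); split; first exact: undup_uniq.
    move=> j; rewrite mem_undup mem_cat negb_or ind_coord_linear => /andP[/s0-> /t0->].
    by rewrite scaler0 addr0.
  under eq_bigr => j _ do rewrite ind_coord_linear tr.
  rewrite big_split -scaler_sumr /= {1}Es {1}Et.
  congr (_ *: _ + _); apply/esym/sum_widen; rewrite ?undup_uniq // => j.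
  - by rewrite mem_undup mem_cat => ->.
  - by move=> /s0 ->; rewrite (lin0 (tr _)).
  - by rewrite mem_undup mem_cat => ->; rewrite orbT.
  - by move=> /t0 ->; rewrite (lin0 (tr _)).
move=> m v; have [s [us s0 Hs]] := dual_sum dual (right_bimodP ee m); exists s; split=> //.
  move=> j /s0 /= fj0; rewrite ind_coord_tens (_ : coord j m = 0).
    exact: (lin0 (gm_act_linearl v)).
  exact: val_inj.
have mE : m = \sum_(j <- s) ract (gen j) (coord j m).
  apply: val_inj; rewrite (lin_sum (f := val)) //=.
  exact: sub_set0.
rewrite {1}mE (lin_sum (tl v)); apply: eq_bigr => j _.
by rewrite tens_bal ind_coord_tens.
Qed.

End Coordinates.

Lemma ind_coord_mor (V W : gmodule C) (g : gmod_mor V W) j t :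
  ind_coord j (ind_mor g t) = g (ind_coord j t).
Proof.
have [lg ag _] := gh_homP g; move: t; apply: tensor_ind.
  split=> [|c u v Hu Hv] /=.
    by rewrite (lin0 (ind_mor_linear g)) !(lin0 (@ind_coord_linear _ j)) (lin0 lg).
  by rewrite ind_mor_linear !ind_coord_linear lg Hu Hv.
by move=> m v /=; rewrite ind_mor_tens !ind_coord_tens ag.
Qed.

(** For injectivity, if [f] kills all coordinates of [t], then they vanish and so does
    [t]. For exactness in the middle, if [g] kills the coordinates, they lift to the
    kernel of [g]. *)
Theorem induction_exact : exact_functor (induction ee e0).
Proof.
move=> U V W f0 g [f_inj fg g_onto] /=.
have [lf _ _] := gh_homP f0; have [lg _ _] := gh_homP g.
have lF := ind_mor_linear f0; have lG := ind_mor_linear g.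
have tr (X : gmodule C) m := tens_linearr ract (gm_act X) m.
split.
- move=> t t' /eqP; rewrite -subr_eq0 -(linB lF) => /eqP E.
  apply/eqP; rewrite -subr_eq0; move: (t - t') E => {t t'} t E.
  have [s ->] := ind_coord_sum t; apply/eqP/big1 => j _.
  rewrite (_ : ind_coord j t = 0) ?(lin0 (tr _ _)) //; apply: f_inj.
  by rewrite -ind_coord_mor (E : ind_mor f0 t = 0) (lin0 lf) (lin0 (@ind_coord_linear _ j)).
- move=> t; split=> [gt|[u <-]]; last first.
    move: u; apply: tensor_ind => [|m u].
      split=> [|c x y /= Hx Hy]; first by rewrite /= (lin0 lF) (lin0 lG).
      by rewrite /= lF lG Hx Hy scaler0 addr0.
    rewrite /= !ind_mor_tens (_ : g (f0 u) = 0) ?(lin0 (tr _ _)) //.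
    by apply/fg; exists u.
  have [s ->] := ind_coord_sum t.
  apply: (is_submod_sum (N := [set w | exists u, ind_mor f0 u = w])).
    split; first by exists 0; apply: (lin0 lF).
    by move=> c _ _ [x <-] [y <-]; exists (c *: x + y); apply: lF.
  move=> j _; have [|u <-] := (fg (ind_coord j t)).1.
    by rewrite -ind_coord_mor gt (lin0 (@ind_coord_linear _ j)).
  by exists (tensV U (gen j) u); rewrite /= ind_mor_tens.
- apply: tensor_ind => [|m w].
    split; first by exists 0; apply: (lin0 lG).
    by move=> c _ _ [x <-] [y <-]; exists (c *: x + y); apply: lG.
  by have [v <-] := g_onto w; exists (tensV V m v); rewrite /= ind_mor_tens.
Qed.

End InductionExact.

(** * Exactness of coinduction *)

Section LiftingHoms.
Variables (k : fieldType) (I : choiceType) (A : lu_galgebra k I).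
Variables (M V W : gmodule A) (g : gmod_mor V W).

(** Kernels of degree-preserving maps are graded: an injective [g] reflects degrees. *)
Lemma gm_hom_factor_inj d (F : M -> W) : injective g -> gm_hom d F ->
  (forall m, exists v, g v = F m) -> exists2 K, gm_hom d K & forall m, g (K m) = F m.
Proof.
move=> g_inj [lF aF gF] /choice[K HK]; have [lg ag _] := gh_homP g.
exists K => //; split.
- by move=> c u v; apply: g_inj; rewrite lg !HK lF.
- by move=> a v; apply: g_inj; rewrite ag !HK aF.
- move=> n m Hm; have := gF _ _ Hm; rewrite -HK => H.
  have := gmod_mor_proj g (n + d) (K m); rewrite (ds_proj_id _ H) => /g_inj ->.
  exact: ds_projG.
Qed.

(** [Hom] consists of finite sums of homogeneous maps, so liftings are only needed for
    the homogeneous components. *)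
Lemma gm_Hom_lift (P : int -> (M -> W) -> Prop) (F : gm_Hom M W) :
  (forall d F', gm_hom d F' -> P d F' ->
    exists2 K, gm_hom d K & forall m, g (K m) = F' m) ->
  (forall s F', decomposes (fun d => [set h | gm_hom d h]) (val F) s F' ->
    forall d, P d (F' d)) ->
  exists K : gm_Hom M V, forall m, g (val K m) = val F m.
Proof.
move=> lift HP; have [lg _ _] := gh_homP g.
have [s [F' dec]] : sum_of (fun d => [set h : M -> W | gm_hom d h]) (val F).
  by rewrite -gm_Hom_setE; apply: sub_modP.
have [_ HF' _ FE] := dec; have PF' := HP _ _ dec.
have /choice[K HK] d : exists K, gm_hom d K /\ forall m, g (K m) = F' d m.
  by have [K HK gK] := lift d _ (HF' d) (PF' d); exists K.
have KS : gm_Hom_set (\sum_(d <- s) K d) by exists s, K; split=> // d; case: (HK d).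
exists (to_sub (@gm_Hom_submod _ _ _ M V) KS) => m /=.
rewrite FE !fct_sumE (lin_sum lg); apply: eq_bigr => d _.
exact: (HK d).2.
Qed.

End LiftingHoms.

Section CoinductionExact.
Variables (k : fieldType) (I : choiceType) (B : lu_galgebra k I).
Local Notation "a ** b" := (ga_mul B a b) (at level 40, left associativity).
Variables (e : B) (ee : e ** e = e) (e0 : ga_gr B 0 e).
Local Notation one := (ga_one B).
Local Notation C := (corner ee e0).
Local Notation eB := (left_module ee e0).
Local Notation coind := (coind_ob (ee := ee) (e0 := e0)).
Local Notation ev f i := (val ((f : ext_sum _) i : sub_mod _)).

(** Liftings can be chosen one [i] at a time; choosing [0] over [0] keeps the support
    finite. *)
Lemma coind_mor_onto (V W : gmodule C) (g : gmod_mor V W) (h : coind W) :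
  (forall i, exists K : gm_Hom (eB i) V, forall m, g (val K m) = ev (h : coind_sort W) i m) ->
  exists h', coind_mor g h' = h.
Proof.
move=> lift; have [lg _ _] := gh_homP g.
have exK : forall i, exists K : gm_Hom (eB i) V,
    ((h : ext_sum _) i = 0 -> K = 0) /\
    forall m, g (val K m) = ev (h : coind_sort W) i m.
  move=> i; have [hi0|hi0] := pselect ((h : ext_sum _) i = 0).
    by exists 0; split=> // m; rewrite hi0 /= (lin0 lg).
  by have [K HK] := lift i; exists K.
pose K i := sval (cid (exK i)); have HK i := svalP (cid (exK i)).
have supK : finitely_supported K.
  by have [s [us h0]] := ext_supp h; exists s => i /h0/(HK i).1.
exists (ExtSum supK); apply: coind_ext => i m /=; exact: (HK i).2.
Qed.

Section OntoHom.
Variables (J : choiceType) (b : J -> B) (deg : J -> int) (f : J -> B -> B).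
Hypothesis dual : dual_system (@op_mul _ _ B) (ga_gr B) [set 0] e b deg f.
Variable i : I.

Let gen_in j : two_sided e (one i) (b j ** one i).
Proof.
apply: two_sided_in; last by rewrite -ga_mulA ga_oneK.
by rewrite ga_mulA; congr (_ ** _); apply/sub_set0/(dual_gen dual).
Qed.
Let gen j : eB i := to_sub (two_sided_submod e (one i)) (gen_in j).

Let coord_in j (m : eB i) : two_sided e e (f j (val (m : left_sort e i))).
Proof.
have [H1 H2] := dual_corner dual j ((leftP ee (m : left_sort e i)).1).
by apply: two_sided_in; apply: sub_set0.
Qed.
Let coord j (m : eB i) : C := to_sub (two_sided_submod e e) (coord_in j m).

Let coord_linear j : linear (coord j).
Proof. by move=> c u v; apply: val_inj; apply: (dual_linear dual j). Qed.

Let coordM j (m : eB i) (x : C) :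
  coord j (gm_act (eB i) x m) = ga_mul C x (coord j m).
Proof.
have [ex xe] := cornerP x; apply: val_inj => /=; apply: sub_set0.
exact: (dual_mor dual j (leftP ee (m : left_sort e i)).1 xe ex).
Qed.

Let coord_sum (m : eB i) : exists s, [/\ uniq s,
  forall j, j \notin s -> coord j m = 0
  & m = \sum_(j <- s) gm_act (eB i) (coord j m) (gen j)].
Proof.
have [s [us s0 Hs]] := dual_sum dual (leftP ee (m : left_sort e i)).1.
exists s; split=> // [j /s0 fj|]; first exact: val_inj.
apply: val_inj; rewrite (lin_sum (f := val)) //=.
rewrite -[LHS](leftP ee (m : left_sort e i)).2 (sub_set0 Hs) ga_mul_suml.
by apply: eq_bigr => j _; rewrite /op_mul ga_mulA.
Qed.

(** Projectivity of [eB1_i], with control of degrees: [m = sum_j f_j(m) b_j 1_i], so a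
    lift of [F] is [m |-> sum_j f_j(m) v_j] where [v_j] is a homogeneous preimage of
    [F(b_j 1_i)]. The sum is finite for each [m], though not uniformly so. *)
Lemma gm_hom_lift_onto (V W : gmodule C) (g : gmod_mor V W) d (F : eB i -> W) :
  (forall w, exists v, g v = w) -> gm_hom d F ->
  exists2 K, gm_hom d K & forall m, g (K m) = F m.
Proof.
move=> g_onto [lF aF gF]; have [lg ag _] := gh_homP g.
have gen_gr j : gm_gr (eB i) (deg j) (gen j).
  by rewrite -[deg j]addr0; apply: ga_grM (dual_gr dual j) (ga_one_gr0 B i).
have /choice[v Hv] j : exists v, gm_gr V (deg j + d) v /\ g v = F (gen j).
  have [v gv] := g_onto (F (gen j)); have HF := gF _ _ (gen_gr j).
  exists (ds_proj (gm_gr_direct V) (deg j + d) v); split; first exact: ds_projG.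
  by rewrite -gmod_mor_proj gv (ds_proj_id _ HF).
have al x := gm_act_linearr (g := V) x; have all w := gm_act_linearl (g := V) w.
pose K m := \sum_(j \in [set: J]) gm_act V (coord j m) (v j).
have KE m s : uniq s -> (forall j, j \notin s -> coord j m = 0) ->
    K m = \sum_(j <- s) gm_act V (coord j m) (v j).
  move=> us s0; rewrite /K (fsbigE s _ us) // => [|j /= _ /s0 ->].
    by rewrite big_mkcond; apply: eq_bigr => j _; rewrite in_setT.
  exact: (lin0 (all _)).
exists K; first split.
- move=> c m m'; have [s [us s0 _]] := coord_sum m; have [t [ut t0 _]] := coord_sum m'.
  have ur : uniq (undup (s ++ t)) by apply: undup_uniq.
  have s0' j : j \notin undup (s ++ t) -> coord j m = 0.
    by rewrite mem_undup mem_cat negb_or => /andP[/s0].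
  have t0' j : j \notin undup (s ++ t) -> coord j m' = 0.
    by rewrite mem_undup mem_cat negb_or => /andP[_ /t0].
  rewrite (KE _ _ ur s0') (KE _ _ ur t0') (KE _ _ ur); last first.
    by move=> j jr; rewrite coord_linear s0' // t0' // scaler0 addr0.
  rewrite scaler_sumr -big_split; apply: eq_bigr => j _ /=.
  by rewrite coord_linear all.
- move=> x m; have [s [us s0 _]] := coord_sum m.
  rewrite (KE _ _ us s0) (KE _ _ us); last first.
    by move=> j js; rewrite coordM s0 // (lin0 (ga_mul_linearr x)).
  rewrite (lin_sum (al x)); apply: eq_bigr => j _.
  by rewrite coordM gm_actA.
- move=> n m Hm; have [s [us s0 _]] := coord_sum m; rewrite (KE _ _ us s0).
  apply: (is_submod_sum (gm_gr_submod V (n + d))) => j _.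
  have Hc : ga_gr C (n - deg j) (coord j m) by apply: (dual_grf dual).
  by have := gm_grM Hc (Hv j).1; rewrite addrA subrK.
- move=> m; have [s [us s0 E]] := coord_sum m.
  rewrite (KE _ _ us s0) (lin_sum lg) [in RHS]E (lin_sum lF).
  by apply: eq_bigr => j _; rewrite ag aF (Hv j).2.
Qed.

End OntoHom.

Theorem coinduction_exact (J : choiceType) (b : J -> B) (deg : J -> int)
    (f : J -> B -> B) :
  dual_system (@op_mul _ _ B) (ga_gr B) [set 0] e b deg f ->
  exact_functor (coinduction ee e0).
Proof.
move=> dual U V W f0 g [f_inj fg g_onto] /=; have [lf _ _] := gh_homP f0.
split.
- move=> h h' E; apply: coind_ext => i m; apply: f_inj.
  by have := congr1 (fun x : coind_sort V => ev x i m) E.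
- move=> h; split=> [gh|[u <-]]; last first.
    by apply: coind_ext => i m /=; apply/fg; exists (ev (u : coind_sort U) i m).
  apply: coind_mor_onto => i.
  apply: (gm_Hom_lift (P := fun _ F => forall m, g (F m) = 0)).
    by move=> d F HF gF; apply: gm_hom_factor_inj => // m; apply/fg.
  move=> s F [us HF F0 FE] d m; have [ds|ds] := boolP (d \in s); last first.
    by rewrite F0 //; have [lg _ _] := gh_homP g; rewrite (lin0 lg).
  have HgF d' : gm_hom d' (g \o F d').
    by have := gm_hom_comp (HF d') (gh_homP g); rewrite addr0.
  have sum0 : \sum_(d' <- s) (g \o F d') = 0.
    apply/funext => x; have := congr1 (fun y : coind_sort W => ev y i x) gh.
    rewrite /= FE !fct_sumE => gx; have [lg _ _] := gh_homP g.
    by rewrite -(lin_sum lg).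
  exact: (congr1 (fun F' => F' m) (gm_hom_direct us HgF sum0 ds)).
- move=> h; apply: coind_mor_onto => i.
  apply: (gm_Hom_lift (P := fun _ _ => True)) => // d F HF _.
  exact: (gm_hom_lift_onto dual g_onto HF).
Qed.

End CoinductionExact.

(** * Finiteness of induced and coinduced modules *)

Lemma int_lower_bound (J : eqType) (s : seq J) (N : J -> int) :
  exists M, forall j, j \in s -> (M <= N j)%R.
Proof.
elim: s => [|j s [M HM]]; first by exists 0.
exists (Order.min (N j) M) => i; rewrite inE => /orP[/eqP->|/HM MN].
  by rewrite ge_min lexx.
by rewrite ge_min MN orbT.
Qed.

Lemma int_interval (a b : int) : exists s : seq int,
  forall d : int, (a <= d)%R -> (d <= b)%R -> d \in s.
Proof.
exists [seq a + n%:Z | n <- iota 0 `|b - a|%N.+1] => d ad db.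
apply/mapP; exists `|d - a|%N; last by lia.
by rewrite mem_iota; lia.
Qed.

Section CornerFiniteness.
Variables (k : fieldType) (I : choiceType) (B : lu_galgebra k I).
Local Notation "a ** b" := (ga_mul B a b) (at level 40, left associativity).
Local Notation one := (ga_one B).
Variables (e : B) (ee : e ** e = e) (e0 : ga_gr B 0 e) (F : seq I).
Hypothesis eE : e = \sum_(s <- F) one s.
Hypotheses (B_fd : ga_locally_fd B) (B_bb : ga_bounded_below B).
Local Notation C := (corner ee e0).
Local Notation Be := (right_bimod e).
Local Notation eB := (left_module ee e0).

Let idem_mulr x : (forall s, s \in F -> x ** one s = 0) -> x ** e = 0.
Proof. by move=> H; rewrite eE ga_mul_sumr big_seq big1. Qed.

Let idem_mull x : (forall s, s \in F -> one s ** x = 0) -> e ** x = 0.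
Proof. by move=> H; rewrite eE ga_mul_suml big_seq big1. Qed.

Let ga_piece_in i j d (a : B) : ga_gr B d a -> one i ** a = a ->
  ga_piece (A := B) i j d (a ** one j).
Proof. by move=> Ha ia; exists a; rewrite ?ia. Qed.

Let ga_piece_in' i j d (a : B) : ga_gr B d a -> a ** one j = a ->
  ga_piece (A := B) i j d (one i ** a).
Proof. by move=> Ha ia; exists a; rewrite // -ga_mulA ia. Qed.

(** The degree [d] part of [1_i B e]. *)
Definition right_piece i d : set Be :=
  [set m | ga_gr B d (val m) /\ one i ** val m = val m].

Lemma right_piece_submod i d : is_submod (right_piece i d).
Proof.
have [g0 gl] := ga_gr_submod B d; split; first by split; rewrite /= ?ga_mul0r.
move=> c u v [Hu iu] [Hv iv]; split; first exact: gl.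
by rewrite /= ga_mulDr ga_mulZr iu iv.
Qed.

Lemma right_piece_sep (m : Be) :
  (forall s, s \in F -> val m ** one s = 0) -> m = 0.
Proof.
by move=> H; apply: val_inj; rewrite -[LHS](right_bimodP ee) idem_mulr.
Qed.

(** As [e] is a finite sum of the [1_s], an element [m] of [1_i B e] is determined by
    the finitely many [m 1_s], each in a component of [B]. *)
Lemma right_piece_fd i d : fin_dim (right_piece i d).
Proof.
apply: (fin_dim_separated (s := F) (f := fun s (m : Be) => val m ** one s)).
- exact: right_piece_submod.
- by move=> s c u v /=; rewrite ga_mulDl ga_mulZl.
- move=> s _; exists (ga_piece (A := B) i s d); split; first exact: B_fd.
  by move=> m [Hm im]; apply: ga_piece_in.
- by move=> m _; apply: right_piece_sep.
Qed.

Lemma right_piece_bb i : exists N : int, forall d, (d < N)%R ->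
  forall m, right_piece i d m -> m = 0.
Proof.
have /choice[N HN] := B_bb i; have [M HM] := int_lower_bound F N.
exists M => d dM m Hm; apply: right_piece_sep => s sF.
have : ga_piece (A := B) i s d (val m ** one s) by case: Hm => ? ?; apply: ga_piece_in.
by rewrite HN //; apply: lt_le_trans dM (HM s sF).
Qed.

Lemma left_gr_sep i (m : eB i) :
  (forall s, s \in F -> one s ** val (m : left_sort e i) = 0) -> m = 0.
Proof.
move=> H; apply: val_inj; rewrite -[LHS](leftP ee (m : left_sort e i)).1.
exact: idem_mull.
Qed.

Lemma left_gr_fd i d : fin_dim (gm_gr (eB i) d).
Proof.
apply: (fin_dim_separated (s := F)
  (f := fun s (m : eB i) => one s ** val (m : left_sort e i))).
- exact: gm_gr_submod.
- by move=> s c u v /=; rewrite ga_mulDr ga_mulZr.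
- move=> s _; exists (ga_piece (A := B) s i d); split; first exact: B_fd.
  by move=> m Hm; apply: (ga_piece_in' _ Hm (leftP ee (m : left_sort e i)).2).
- by move=> m _; apply: left_gr_sep.
Qed.

Lemma left_gr_bb i : exists N : int, forall d, (d < N)%R ->
  forall m, gm_gr (eB i) d m -> m = 0.
Proof.
have /choice[N HN] s := B_bb s i; have [M HM] := int_lower_bound F N.
exists M => d dM m Hm; apply: left_gr_sep => s sF.
have : ga_piece (A := B) s i d (one s ** val (m : left_sort e i)).
  exact: (ga_piece_in' _ Hm (leftP ee (m : left_sort e i)).2).
by rewrite HN //; apply: lt_le_trans dM (HM s sF).
Qed.

Section Module.
Variable V : gmodule C.

Lemma corner_one_act (v : V) : gm_act V (ga_one C tt) v = v.
Proof.
move: v; apply: (ds_ind (gm_peirce V)).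
  split=> [|c u v /= Hu Hv]; first exact: (lin0 (gm_act_linearr _)).
  by rewrite /= gm_act_linearr Hu Hv.
by move=> [] _ [v _ <-] /=; rewrite gm_actA (@ga_oneM _ _ C tt tt).
Qed.

(** The corner has a unit, so boundedness and local finiteness of a module over it
    concern its whole homogeneous components. *)
Lemma corner_pieceE d : @gm_piece _ _ _ V tt d = gm_gr V d.
Proof.
apply/seteqP; split=> v; first by move=> [w Hw <-]; rewrite corner_one_act.
by move=> Hv; exists v => //; rewrite corner_one_act.
Qed.

Lemma gm_piece_submod (W : gmodule B) i d : is_submod (@gm_piece _ _ _ W i d).
Proof. exact: is_submod_image (gm_act_linearr _) (gm_gr_submod W d). Qed.

Lemma gm_piece_eq0 (W : gmodule B) i d :
  (forall w, gm_piece (V := W) i d w -> w = 0) -> @gm_piece _ _ _ W i d = [set 0].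
Proof.
move=> H; apply/seteqP; split=> w; first exact: H.
by move=> ->; case: (gm_piece_submod W i d).
Qed.

Local Notation tensV m v := (tens (right_ract (e := e) (ee := ee) (e0 := e0))
  (gm_act V) m v : ind_ob V).

Lemma ind_piece_ind i n (P : set (ind_ob V)) : is_submod P ->
  (forall d m v, right_piece i d m -> gm_gr V (n - d) v -> P (tensV m v)) ->
  forall t, gm_piece (V := ind_ob V) i n t -> P t.
Proof.
move=> sP HP _ [t Ht <-] /=.
apply: (spanned_linear (@ind_act_linearr _ _ _ _ _ _ V (one i)) sP _ Ht).
move=> _ [d [d' [m [v [Hm Hv dn ->]]]]]; rewrite ind_act_tens.
apply: (HP d); last by rewrite -dn addrC addKr.
split; last by rewrite /= ga_mulA ga_oneK.
by rewrite -[d]add0r; apply: ga_grM => //; apply: ga_one_gr0.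
Qed.

(** A tensor [m (x) v] of degree [n] has [deg m + deg v = n]; both degrees are bounded
    below. *)
Lemma ind_bounded_below : bounded_below V -> bounded_below (ind_ob V).
Proof.
move=> /(_ tt)[N2 HN2] i; have [N1 HN1] := right_piece_bb i.
exists (N1 + N2) => n nN; apply: gm_piece_eq0.
apply: ind_piece_ind => [|d m v Hm Hv] /=; first exact: is_submod0.
have [dN|dN] := ltP d N1.
  by rewrite (HN1 _ dN m Hm) (lin0 (tens_linearl _ _ _)).
have : gm_piece (V := V) tt (n - d) v by rewrite corner_pieceE.
rewrite HN2 => [->|]; first exact: (lin0 (tens_linearr _ _ _)).
by lia.
Qed.

(** In a fixed degree [n] only finitely many pairs of degrees of [m] and [v] occur, and
    for each of them [m] and [v] run through finite-dimensional spaces. *)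
Lemma ind_locally_fd : locally_fd V -> bounded_below V -> locally_fd (ind_ob V).
Proof.
move=> V_fd /(_ tt)[N2 HN2] i n; have [N1 HN1] := right_piece_bb i.
have /choice[r Hr] d := fin_dim_seq (right_piece_fd i d).
have /choice[q Hq] d : exists q : seq V, gm_gr V (n - d) `<=` spanned [set` q].
  by have [q [_ Hq]] := fin_dim_seq (V_fd tt (n - d)); exists q; rewrite -corner_pieceE.
have [s Hs] := int_interval N1 (n - N2).
apply: (fin_dim_sub (s := flatten [seq [seq tensV m v | m <- r d, v <- q d] | d <- s])).
  exact: gm_piece_submod.
set G := flatten _; have sG := is_submod_spanned [set` G].
have G0 : spanned [set` G] 0 by case: sG.
apply: ind_piece_ind => [//|d m v Hm Hv] /=.
have [dN|dN] := ltP d N1.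
  by rewrite (HN1 _ dN m Hm) (lin0 (tens_linearl _ _ _)).
have [dN2|dN2] := ltP (n - d) N2.
  have : gm_piece (V := V) tt (n - d) v by rewrite corner_pieceE.
  by rewrite HN2 // => ->; rewrite (lin0 (tens_linearr _ _ _)).
have ds : d \in s by apply: Hs => //; lia.
apply: (spanned_linear (tens_linearl _ _ v) sG _ ((Hr d).2 _ Hm)) => m' Hm'.
apply: (spanned_linear (tens_linearr _ _ m') sG _ (Hq d _ Hv)) => v' Hv'.
refine (spanned_in _); apply/flatten_mapP; exists d => //.
by apply/allpairsP; exists (m', v').
Qed.

Local Notation ev f i := (val ((f : ext_sum _) i : sub_mod _)).

Lemma coind_piece_gr i n (f : coind_ob V) : gm_piece (V := coind_ob V) i n f ->
  forall j, gm_hom n (ev (f : coind_sort V) j).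
Proof.
by move=> [f' Hf' <-]; have := gm_grM (ga_one_gr0 B i) Hf'; rewrite add0r.
Qed.

(** [1_i] projects onto the summand [Hom(eB1_i, V)]. *)
Lemma coind_piece_eq0 i n (f : coind_ob V) : gm_piece (V := coind_ob V) i n f ->
  (forall d m, gm_gr (eB i) d m -> ev (f : coind_sort V) i m = 0) -> f = 0.
Proof.
move=> Hf f0; apply: coind_ext => j m.
have [ij|ij] := eqVneq i j.
  subst j; move: m; apply: (ds_ind (gm_gr_direct (eB i))) => [|d m /f0//].
  have [lf _ _] := coind_piece_gr Hf i.
  split=> [|c u v Hu Hv]; first exact: lin0 lf.
  by apply: etrans (lf c u v) _; rewrite Hu Hv scaler0 addr0.
have [f' _ <-] := Hf; have [s [us s0]] := ext_supp f'.
rewrite [LHS](coind_act_funE _ _ us s0) big1 // => h _.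
rewrite (_ : right_mul h (one i) m = 0) ?(lin0 (ev_linear _ (j := h))) //.
apply: val_inj => /=; rewrite -(leftP ee (m : left_sort e j)).2 -[_ ** _ ** one i]ga_mulA.
by rewrite ga_oneM eq_sym (negbTE ij) ga_mul0r ga_mul0l.
Qed.

(** A homomorphism of degree [n] sends degree [d] to degree [d + n]: the former is
    bounded below on [eB1_i], the latter bounded above on [V]. *)
Lemma coind_bounded_above : bounded_above V -> bounded_above (coind_ob V).
Proof.
move=> /(_ tt)[N2 HN2] i; have [N1 HN1] := left_gr_bb i.
exists (N2 - N1) => n nN; apply: gm_piece_eq0 => f Hf.
apply: (coind_piece_eq0 Hf) => d m Hm; have [lf _ gf] := coind_piece_gr Hf i.
have [dN|dN] := ltP d N1; first by rewrite (HN1 _ dN m Hm) (lin0 lf).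
have := gf _ _ Hm; rewrite -corner_pieceE HN2 //.
by lia.
Qed.

(** By the two bounds, a homomorphism of degree [n] is determined by its values on
    finitely many homogeneous components of [eB1_i], each of finite dimension. *)
Lemma coind_locally_fd : locally_fd V -> bounded_above V -> locally_fd (coind_ob V).
Proof.
move=> V_fd /(_ tt)[N2 HN2] i n; have [N1 HN1] := left_gr_bb i.
have /choice[r Hr] d := fin_dim_seq (left_gr_fd i d).
have [s Hs] := int_interval N1 (N2 - n).
apply: (fin_dim_separated (s := flatten [seq r d | d <- s])
  (f := fun m (f : coind_ob V) => ev (f : coind_sort V) i m)).
- exact: gm_piece_submod.
- by [].
- move=> m /flatten_mapP[d _ md]; exists (gm_gr V (d + n)); split.
    by rewrite -corner_pieceE.
  move=> f /coind_piece_gr/(_ i)[_ _ gf]; apply: gf; exact: (Hr d).1.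
- move=> f Hf f0; apply: (coind_piece_eq0 Hf) => d m Hm.
  have [lf _ gf] := coind_piece_gr Hf i.
  have [dN|dN] := ltP d N1; first by rewrite (HN1 _ dN m Hm) (lin0 lf).
  have [dN2|dN2] := ltP N2 (d + n).
    by have := gf _ _ Hm; rewrite -corner_pieceE HN2.
  have ds : d \in s by apply: Hs => //; lia.
  apply: (spanned_linear lf (@is_submod0 _ _) _ ((Hr d).2 _ Hm)) => m' Hm' /=.
  by apply: f0; apply/flatten_mapP; exists d.
Qed.

End Module.
End CornerFiniteness.

Section QuotientFiniteness.
Variables (k : fieldType) (I : choiceType) (A : lu_galgebra k I) (G : set A).
Variable HG : forall g, G g -> exists d, ga_gr A d g.
Local Notation pi := (quot_alg_pi HG).
Local Notation Q := (quot_alg HG).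

Lemma quot_alg_pi_linear : linear pi.
Proof. exact: quot_pi_linear. Qed.

Lemma quot_alg_piece i j d : ga_piece (A := Q) i j d = [set pi a | a in ga_piece (A := A) i j d].
Proof.
apply/seteqP; split=> [_ [_ [a Ha <-] <-]|_ [_ [a Ha <-] <-]].
  exists (ga_mul A (ga_mul A (ga_one A i) a) (ga_one A j)); first by exists a.
  by rewrite /quot_alg_pi -!(@quot_alg_piM _ _ _ G).
exists (pi a); first by exists a.
by rewrite /quot_alg_pi -!(@quot_alg_piM _ _ _ G).
Qed.

Lemma quot_alg_locally_fd : ga_locally_fd A -> ga_locally_fd Q.
Proof.
move=> A_fd i j d; rewrite quot_alg_piece.
have [s [sP Ps]] := fin_dim_seq (A_fd i j d).
apply: (fin_dim_of_seq (s := [seq pi a | a <- s])).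
  by move=> _ /= /mapP[a /sP Ha ->]; exists a.
move=> _ [a /Ps Ha <-].
apply: (spanned_linear quot_alg_pi_linear (is_submod_spanned _) _ Ha) => x xs.
by refine (spanned_in _); apply: map_f.
Qed.

Lemma quot_alg_bounded_below : ga_bounded_below A -> ga_bounded_below Q.
Proof.
move=> A_bb i j; have [N HN] := A_bb i j; exists N => d /HN E.
by rewrite quot_alg_piece E image_set1 (lin0 quot_alg_pi_linear).
Qed.

Lemma quot_alg_dual_system (mulA : A -> A -> A) (mulQ : Q -> Q -> Q) e
    (J : choiceType) (b : J -> A) deg f :
  (forall x y, mulQ (pi x) (pi y) = pi (mulA x y)) ->
  associative mulA -> mulA e e = e ->
  dual_system mulA (ga_gr A) (ideal_gen G) e b deg f ->
  exists f', dual_system mulQ (ga_gr Q) [set 0] (pi e) (pi \o b) deg f'.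
Proof.
move=> piM mA ee dual.
pose rep : Q -> A := quot_repr (HN := (ideal_gen_ideal G).1).
exists (fun j => pi \o f j \o rep).
refine (@dual_system_quotient k A Q mulA mulQ (ga_gr A) (ga_gr Q) (ideal_gen G) e pi
  rep quot_alg_pi_linear _ piM _ _ mA ee J b deg f dual).
- by move=> x; apply: quot_reprK.
- by move=> d w; split=> -[x Hx <-]; exists x.
- move=> x; rewrite -(lin0 quot_alg_pi_linear) -[X in ideal_gen G X]subr0.
  exact: quot_piP.
Qed.

End QuotientFiniteness.

Theorem lemma4p1 (k : closedFieldType) (I : choiceType) (A : lu_galgebra k I)
    (A_fd : ga_locally_fd A) (A_bb : ga_bounded_below A)
    (disp : Order.disp_t) (L : porderType disp) (T : triangular_basis A L)
    (l : L) :
  (exact_functor (standardization T l) /\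
   (forall V : gmodule (weight_algebra T l),
      locally_fd V -> bounded_below V ->
      locally_fd (standardization T l V) /\
      bounded_below (standardization T l V))) /\
  (exact_functor (costandardization T l) /\
   (forall V : gmodule (weight_algebra T l),
      locally_fd V -> bounded_above V ->
      locally_fd (costandardization T l V) /\
      bounded_above (costandardization T l V))).
Proof.
set HG := @truncation_gens_homogeneous _ _ _ _ _ T l.
have B_fd : ga_locally_fd (truncation T l) by apply: quot_alg_locally_fd.
have B_bb : ga_bounded_below (truncation T l) by apply: quot_alg_bounded_below.
have eE : truncation_idem T l = \sum_(s <- fset_set [set s | tb_S T s /\ tb_wt T s = l])
    ga_one (truncation T l) s.
  by rewrite /truncation_idem weight_idemE (lin_sum (quot_alg_pi_linear HG)).
split; split.
- have [J [b [deg [f Hf]]]] := std_dual_system T l.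
  have [f' Hf'] := quot_alg_dual_system (HG := HG) (mulQ := ga_mul (truncation T l))
    (fun x y => @quot_alg_piM _ _ _ (truncation_gens T l) x y)
    (@ga_mulA _ _ A) (weight_idemK T l) Hf.
  exact: (induction_exact Hf').
- move=> V V_fd V_bb; split; first exact: ind_locally_fd eE B_fd B_bb _ V_fd V_bb.
  exact: (ind_bounded_below eE B_bb V_bb).
- have [J [b [deg [f Hf]]]] := costd_dual_system T l.
  have [f' Hf'] := quot_alg_dual_system (HG := HG) (mulQ := @op_mul _ _ (truncation T l))
    (fun x y => @quot_alg_piM _ _ _ (truncation_gens T l) y x)
    (@op_mulA _ _ A) (weight_idemK T l) Hf.
  exact: (coinduction_exact Hf').
- move=> V V_fd V_ba; split; first exact: (coind_locally_fd eE B_fd B_bb V_fd V_ba).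
  exact: (coind_bounded_above eE B_bb V_ba).
Qed.
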